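(* Let $n\ge 2$ be an integer, let $p\in(1,n)$, and put $\mu_1:=[(n-p)/p]^p$. For any $\mu\in(-\infty,\mu_1)$ and any $s\in(0,p)$, there exists a positive weak solution of $$-\Delta_p u-\mu\frac{u^{p-1}}{|x|^p}=u^{p^\star-1}+\frac{u^{p^\star(s)-1}}{|x|^s}\quad\text{in }\mathbb{R}^n .$$ More precisely, there exists $u\in D_1^p(\mathbb{R}^n)\cap C^1(\mathbb{R}^n\setminus\{0\})$ such that $u>0$ in $\mathbb{R}^n\setminus\{0\}$ and $u$ solves this equation weakly in $\mathbb{R}^n$.
   Context: $\Delta_p u:=\operatorname{div}(|\nabla u|^{p-2}\nabla u)$ is the $p$-Laplace operator. The exponents are $p^\star:=\frac{np}{n-p}$ and $p^\star(s):=\frac{p(n-s)}{n-p}$. The space $D_1^p(\mathbb{R}^n)$ is the completion of $C_c^\infty(\mathbb{R}^n)$ (smooth compactly supported functions) for the norm $u\mapsto\|\nabla u\|_p$, where $\|\cdot\|_p$ is the norm of $L^p(\mathbb{R}^n)$. Weak solution: for $f\in L^1_{\mathrm{loc}}(\mathbb{R}^n)$, a function $u\in D_1^p(\mathbb{R}^n)$ is a weak solution of $-\Delta_p u=f$ in $\mathbb{R}^n$ if $\int_{\mathbb{R}^n}|\nabla u|^{p-2}(\nabla u,\nabla\varphi)\,dx=\int_{\mathbb{R}^n}f\varphi\,dx$ for all $\varphi\in C_c^\infty(\mathbb{R}^n)$. For the equation in the claim, $f=\mu\frac{u^{p-1}}{|x|^p}+u^{p^\star-1}+\frac{u^{p^\star(s)-1}}{|x|^s}$.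 *)

(* Defs.v *)
(* Points of R^n are row vectors 'rV[R]_n. *)
From HB Require Import structures.
From mathcomp Require Import all_boot all_order all_algebra.
From mathcomp Require Import all_classical all_reals all_analysis.
Set Implicit Arguments.
Unset Strict Implicit.
Unset Printing Implicit Defensive.
Import Order.TTheory GRing.Theory Num.Theory.
Import numFieldNormedType.Exports.
Local Open Scope classical_set_scope.
Local Open Scope ring_scope.

(* The sigma-algebra on R^n is the one generated by the coordinates, i.e. the
   Borel sigma-algebra. *)
Section measurable_rV.
Context (R : realType) (n : nat).

Let coord (i : 'I_n) (x : 'rV[R]_n) : R := x ord0 i.

Let rV_set0 : g_sigma_preimage coord set0.
Proof. exact: sigma_algebra0. Qed.

Let rV_setC A : g_sigma_preimage coord A -> g_sigma_preimage coord (~` A).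
Proof. exact: sigma_algebraC. Qed.

Let rV_bigcup (F : (set 'rV[R]_n)^nat) :
  (forall i, g_sigma_preimage coord (F i)) ->
  g_sigma_preimage coord (\bigcup_i (F i)).
Proof. exact: sigma_algebra_bigcup. Qed.

HB.instance Definition _ :=
  @isMeasurable.Build (measure_tuple_display default_measure_display)
    'rV[R]_n (g_sigma_preimage coord) rV_set0 rV_setC rV_bigcup.

Lemma measurable_coord (i : 'I_n) :
  measurable_fun [set: 'rV[R]_n] (fun x : 'rV[R]_n => x ord0 i).
Proof.
move=> _ Y mY; rewrite setTI; apply: sub_sigma_algebra => /=.
rewrite -bigcup_seq/=; exists i => /=; first by rewrite mem_index_enum.
by exists Y => //; rewrite setTI.
Qed.

Lemma measurable_fun_rVP d (T : measurableType d) (f : T -> 'rV[R]_n) :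
  (forall i, measurable_fun [set: T] (fun t => f t ord0 i)) ->
  measurable_fun [set: T] f.
Proof.
move=> mf _ A mA; rewrite setTI.
have : g_sigma_preimage (fun i => coord i \o f) (f @^-1` A).
  by rewrite g_sigma_preimage_comp; exists A => //; rewrite setTI.
apply: smallest_sub; first exact: sigma_algebra_measurable.
rewrite -bigcup_seq/=; apply: bigcup_sub => i _.
by move=> B [C mC <-]; exact: mf.
Qed.

End measurable_rV.

(* Lebesgue measure on R^n, by iterated products: R^0 is a point of mass 1 and
   R^(n+1) = R * R^n. *)
Section lebesgue_rV.
Context (R : realType).

Definition rV_cons n (z : R * 'rV[R]_n) : 'rV[R]_n.+1 :=
  row_mx (z.1)%:M z.2 : 'rV[R]_(1 + n).

Definition rV_uncons n (x : 'rV[R]_n.+1) : R * 'rV[R]_n :=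
  (x ord0 ord0, \row_i x ord0 (lift ord0 i)).

Lemma rV_cons0 n (z : R * 'rV[R]_n) : rV_cons z ord0 ord0 = z.1.
Proof.
have e : ord0 = lshift n ord0 :> 'I_(1 + n) by exact/val_inj.
rewrite /rV_cons; move: (row_mxEl (z.1)%:M z.2 ord0 (ord0 : 'I_1)).
by rewrite -e [in RHS]mxE.
Qed.

Lemma rV_cons_lift n (z : R * 'rV[R]_n) i :
  rV_cons z ord0 (lift ord0 i) = z.2 ord0 i.
Proof.
have e : lift ord0 i = rshift 1 i :> 'I_(1 + n) by exact/val_inj.
by rewrite /rV_cons; move: (row_mxEr (z.1)%:M z.2 ord0 i); rewrite -e.
Qed.

Lemma rV_consK n : cancel (@rV_cons n) (@rV_uncons n).
Proof.
move=> [a y]; rewrite /rV_uncons rV_cons0; congr pair.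
by apply/rowP => i; rewrite mxE rV_cons_lift.
Qed.

Lemma rV_unconsK n : cancel (@rV_uncons n) (@rV_cons n).
Proof.
move=> x; apply/rowP => i; case: (unliftP ord0 i) => [j|] ->.
  by rewrite rV_cons_lift mxE.
by rewrite rV_cons0.
Qed.

Lemma measurable_rV_cons n : measurable_fun setT (@rV_cons n).
Proof.
apply: measurable_fun_rVP => i; case: (unliftP ord0 i) => [j|] ->.
  under eq_fun do rewrite rV_cons_lift.
  exact: (measurableT_comp (measurable_coord j) measurable_snd).
by under eq_fun do rewrite rV_cons0; exact: measurable_fst.
Qed.

Lemma measurable_rV_uncons n : measurable_fun setT (@rV_uncons n).
Proof.
apply/measurable_fun_pairP; split; first exact: measurable_coord.
apply: measurable_fun_rVP => i /=.
by under eq_fun do rewrite mxE; exact: measurable_coord.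
Qed.

Section cons_measure.
Local Open Scope ereal_scope.
Context (n : nat) (m : {sigma_finite_measure set 'rV[R]_n -> \bar R}).

Definition cons_measure : set 'rV[R]_n.+1 -> \bar R :=
  pushforward (@lebesgue_measure R \x m) (@rV_cons n).

Let mpre (A : set 'rV[R]_n.+1) :
  measurable A -> measurable (@rV_cons n @^-1` A).
Proof.
by move=> mA; rewrite -[X in measurable X]setTI; exact: measurable_rV_cons.
Qed.

Let cons_measure0 : cons_measure set0 = 0.
Proof. by rewrite /cons_measure /pushforward preimage_set0 measure0. Qed.

Let cons_measure_ge0 A : 0 <= cons_measure A.
Proof. exact: (measure_ge0 (@lebesgue_measure R \x m)). Qed.

Let cons_measure_sigma_additive : semi_sigma_additive cons_measure.
Proof.
move=> F mF tF mUF; rewrite /cons_measure /pushforward preimage_bigcup.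
apply: measure_semi_sigma_additive.
- by move=> k; exact: mpre.
- apply/trivIsetP => /= i j _ _ ij; rewrite -preimage_setI.
  by move/trivIsetP : tF => /(_ _ _ _ _ ij) ->//; rewrite preimage_set0.
- by rewrite -preimage_bigcup; exact: mpre.
Qed.

HB.instance Definition _ := isMeasure.Build _ _ _
  cons_measure cons_measure0 cons_measure_ge0 cons_measure_sigma_additive.

Let cons_measure_sigma_finite : sigma_finite setT cons_measure.
Proof.
have /sigma_finiteP[F [TF ndF Foo]] := sigma_finiteT (@lebesgue_measure R).
have /sigma_finiteP[G [TG ndG Goo]] := sigma_finiteT m.
exists (fun k => @rV_uncons n @^-1` (F k `*` G k)).
  rewrite -preimage_bigcup (_ : \bigcup_k _ = setT) ?preimage_setT//.
  apply/seteqP; split=> // -[x y] _.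
  have : [set: measurableTypeR R] x by [].
  have : [set: 'rV[R]_n] y by [].
  rewrite TF TG => -[k _ Gky] [l _ Flx]; exists (maxn k l) => //; split => /=.
    by move: x Flx; exact/subsetPset/ndF/leq_maxr.
  by move: y Gky; exact/subsetPset/ndG/leq_maxl.
move=> k; have [mF Fk] := Foo k; have [mG Gk] := Goo k; split.
  rewrite -[X in measurable X]setTI; apply: measurable_rV_uncons => //.
  exact: measurableX.
rewrite /cons_measure /pushforward -comp_preimage.
rewrite (_ : _ \o _ = id); last by apply/funext => z /=; rewrite rV_consK.
by rewrite preimage_id product_measure1E// lte_mul_pinfty// ge0_fin_numE.
Qed.

HB.instance Definition _ := Measure_isSigmaFinite.Build _ _ _
  cons_measure cons_measure_sigma_finite.

End cons_measure.

Fixpoint lebesgue_rV n : {sigma_finite_measure set 'rV[R]_n -> \bar R} :=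
  match n with
  | 0 => [the {sigma_finite_measure set 'rV[R]_0 -> \bar R} of
           \d_(0 : 'rV[R]_0)]
  | n.+1 => [the {sigma_finite_measure set 'rV[R]_n.+1 -> \bar R} of
              cons_measure (lebesgue_rV n)]
  end.

End lebesgue_rV.

Section euclidean.
Context (R : realType) (n : nat).
Implicit Types x y : 'rV[R]_n.

Definition dot x y : R := \sum_(i < n) x ord0 i * y ord0 i.

(* The library's norm on matrices is the sup norm. *)
Definition enorm x : R := Num.sqrt (dot x x).

End euclidean.

Section differential.
Context (R : realType) (n : nat).
Implicit Types u phi : 'rV[R]_n -> R.

Definition partial (i : 'I_n) u : 'rV[R]_n -> R :=
  fun x => 'D_(delta_mx ord0 i) u x.

Definition grad u (x : 'rV[R]_n) : 'rV[R]_n := \row_i partial i u x.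

Definition smooth u := forall (s : seq 'I_n) x,
  differentiable (foldr partial u s) x.

Definition test_function phi :=
  smooth phi /\ compact (closure [set x | phi x != 0]).

Definition C1_on (U : set 'rV[R]_n) u := forall x, U x ->
  differentiable u x /\ forall i, {for x, continuous (partial i u)}.

End differential.

Section D1p.
Context (R : realType) (n : nat) (p : R).
Implicit Types (u : 'rV[R]_n -> R) (G : 'rV[R]_n -> 'rV[R]_n).
Implicit Types phi : ('rV[R]_n -> R)^nat.

Definition Lp_norm (q : R) u : \bar R :=
  'N[lebesgue_rV R n]_(q%:E)[EFin \o u].

Definition sobolev_exp : R := n%:R * p / (n%:R - p).
Definition hardy_sobolev_exp (s : R) : R := p * (n%:R - s) / (n%:R - p).

Definition grad_cauchy phi := forall e : R, 0 < e ->
  exists N, forall k l, (N <= k)%N -> (N <= l)%N ->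
    (Lp_norm p (fun x => enorm (grad (phi k \- phi l)%R x)) < e%:E)%E.

(* An element of the completion of C_c^oo for the norm |grad|_p is represented
   by a Cauchy sequence phi of test functions.  By the Sobolev inequality
   (1 < p < n) such a sequence converges in L^(p^star), and the element is
   identified with its limit u. *)
Definition D1p_repr phi u :=
  [/\ forall k, test_function (phi k),
      grad_cauchy phi,
      measurable_fun setT u &
      Lp_norm sobolev_exp (phi k \- u) @[k --> \oo] --> 0%E].

Definition D1p u := exists phi, D1p_repr phi u.

(* G is the gradient of u in D1p, extended from test functions by density. *)
Definition D1p_grad u G := measurable_fun setT G /\
  exists phi, D1p_repr phi u /\
    Lp_norm p (fun x => enorm (grad (phi k) x - G x)) @[k --> \oo] --> 0%E.

(* The library's locally_integrable is specific to R. *)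
Definition loc_integrable (f : 'rV[R]_n -> R) := measurable_fun setT f /\
  forall K, compact K -> (\int[lebesgue_rV R n]_(x in K) `|f x|%:E < +oo)%E.

(* Weak solution of -Delta_p u = f in R^n.  Where G x = 0, the integrand
   |G|^(p-2) (G, grad v) is 0, also for p < 2, as dot 0 _ = 0. *)
Definition p_laplace_weak_solution u (f : 'rV[R]_n -> R) :=
  [/\ D1p u, loc_integrable f &
    exists G, D1p_grad u G /\
      forall v, test_function v ->
        (\int[lebesgue_rV R n]_x
            (enorm (G x) `^ (p - 2) * dot (G x) (grad v x))%:E
         = \int[lebesgue_rV R n]_x (f x * v x)%:E)%E].

End D1p.

(* Main.v *)
(* The radial change of variables t = ln |x|, u(x) = exp(-delta t + l(t)) with
   delta = (n - p) / p makes the equation autonomous: if zeta is the radial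
   component of -|grad u|^(p-2) grad u, divided by u^(p-1) and multiplied by
   |x|^(p-1), then l' = delta - psi(zeta) with psi the inverse of
   z |-> |z|^(p-2) z, and zeta' is an explicit function of zeta and l. This
   system has a conserved quantity, and on its zero level l is a function of
   zeta, so that zeta solves a scalar autonomous equation on an interval whose
   endpoints correspond to l = -oo. The resulting homoclinic orbit satisfies
   l(t) <= C - alpha |t|, which gives enough decay at 0 and at infinity to
   approximate u in the energy norm by test functions of |x|^2, and to
   integrate by parts against any test function. *)
Require Import Defs.
From HB Require Import structures.
From mathcomp Require Import all_boot all_order all_algebra.
From mathcomp Require Import all_classical all_reals all_analysis.
From mathcomp Require Import measurable_realfun.
From mathcomp Require Import ring lra.
Set Implicit Arguments.
Unset Strict Implicit.
Unset Printing Implicit Defensive.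
Import Order.TTheory GRing.Theory Num.Theory.
Import numFieldNormedType.Exports.
Local Open Scope classical_set_scope.
Local Open Scope ring_scope.

(** * Smooth functions on R^n *)

(** The conserved quantity carries the factor [e^(p l)], so it vanishes along every orbit with
    [zeta] bounded and [l -> -oo]: the zero level is forced. There the factor cancels, leaving
    [e^((P1 - p) l) / P1 + e^((P2 - p) l) / P2 = - energy zeta], whose left side increases from 0 to
    [+oo] in [l]; so [l] is recovered exactly where [energy < 0]. The function [energy] is convex
    with minimum [(mu - delta^p) / p], which is where [mu < mu_1] enters. The other difficulty is
    the origin, where [u] and its flux may be singular while test functions must be smooth. Hence
    approximants are smooth functions of [|x|^2], not of [|x|], and integration by parts is done on
    fields cut off near 0, followed by dominated convergence. Integrals over R^n are never taken in
    polar coordinates: radial weights are dominated by products of one-variable kernels, and Tonelli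
    and the divergence theorem are applied one coordinate at a time. *)

Section Ck.
Context (R : realType) (V : normedModType R) (D : set V).
Implicit Types u v : V -> R.

(** The set [D] of directions lets one notion serve both R, with the single direction 1, and R^n,
    with the coordinate vectors. Recursing on the derivative makes the product, quotient and chain
    rules plain inductions; full differentiability is kept at each level because the chain rule
    needs it. *)
Fixpoint Ck (k : nat) u : Prop :=
  (forall x, differentiable u x) /\
  if k is k'.+1 then forall e, D e -> Ck k' (fun x => 'D_e u x) else True.

Lemma Ck_differentiable k u : Ck k u -> forall x, differentiable u x.
Proof. by case: k => [|k] []. Qed.

Lemma Ck_pred k u : Ck k.+1 u -> Ck k u.
Proof.
elim: k u => [|k IH] u [du Du]; first by split.
by split=> // e De; apply: IH; exact: Du.
Qed.

Lemma Ck_cst k (c : R) : Ck k (fun=> c).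
Proof.
elim: k c => [|k IH] c; split=> //; try by move=> x; exact: differentiable_cst.
move=> e De; rewrite (_ : 'D_e _ = (fun=> 0)); first exact: IH.
by apply/funext => x; rewrite derive_cst.
Qed.

Lemma CkD k u v : Ck k u -> Ck k v -> Ck k (fun x => u x + v x).
Proof.
elim: k u v => [|k IH] u v [du Du] [dv Dv]; split=> //;
  try by move=> x; exact: differentiableD.
move=> e De; rewrite (_ : 'D_e _ = (fun x => 'D_e u x + 'D_e v x)).
  by apply: IH; [exact: Du|exact: Dv].
by apply/funext => x; rewrite deriveD//; exact: diff_derivable.
Qed.

Lemma CkM k u v : Ck k u -> Ck k v -> Ck k (fun x => u x * v x).
Proof.
elim: k u v => [|k IH] u v Cu Cv; (split=> //;
  first by move=> x; apply: differentiableM;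
    [exact: Ck_differentiable Cu _|exact: Ck_differentiable Cv _]).
move=> e De.
have [[du Du] [dv Dv]] := (Cu, Cv).
rewrite (_ : 'D_e _ = (fun x => u x * 'D_e v x + v x * 'D_e u x)).
  apply: CkD; apply: IH; by [exact: Ck_pred|exact: Du|exact: Dv].
by apply/funext => x; rewrite deriveM//; exact: diff_derivable.
Qed.

Lemma CkZ k (c : R) u : Ck k u -> Ck k (fun x => c * u x).
Proof. by move=> Cu; apply: CkM => //; exact: Ck_cst. Qed.

Lemma Ck_sum k (I : Type) (r : seq I) (f : I -> V -> R) :
  (forall i, Ck k (f i)) -> Ck k (fun x => \sum_(i <- r) f i x).
Proof.
move=> Cf; elim: r => [|i r IH].
  under eq_fun do rewrite big_nil; exact: Ck_cst.
by under eq_fun do rewrite big_cons; exact: CkD.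
Qed.

Lemma CkV k u : (forall x, u x != 0) -> Ck k u -> Ck k (fun x => (u x)^-1).
Proof.
move=> u0; elim: k => [|k IH] Cu; (split => //;
  first by move=> x; apply: differentiableV => //; exact: Ck_differentiable Cu _).
move=> e De; have [du Du] := Cu.
rewrite (_ : 'D_e _ =
    (fun x => (-1) * (((u x)^-1 * (u x)^-1) * 'D_e u x))).
  by apply/CkZ/CkM; [apply: CkM; apply: IH; exact: Ck_pred|exact: Du].
apply/funext => x; rewrite deriveV//; last exact: diff_derivable.
by rewrite -exprVn expr2 mulN1r scaleNr.
Qed.

End Ck.

Section Ck_comp.
Context (R : realType) (V : normedModType R) (D : set V).

Lemma derive_comp (f : R -> R) (u : V -> R) x e : differentiable f (u x) ->
  differentiable u x -> 'D_e (f \o u) x = 'D_1 f (u x) * 'D_e u x.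
Proof.
move=> df du; rewrite !deriveE//; last exact: differentiable_comp.
rewrite diff_comp//= -[in LHS](mulr1 ('d u x e)).
by rewrite -[_ * 1]/(_ *: (1 : R)) linearZ/= mulrC.
Qed.

Lemma Ck_comp k (f : R -> R) (u : V -> R) :
  Ck [set (1 : R)] k f -> Ck D k u -> Ck D k (f \o u).
Proof.
elim: k f u => [|k IH] f u Cf Cu; (split => //;
  first by move=> x; apply: differentiable_comp;
    [exact: Ck_differentiable Cu _|exact: Ck_differentiable Cf _]).
move=> e De; have [[df Df] [du Du]] := (Cf, Cu).
rewrite (_ : 'D_e _ = (fun x => ((fun y => 'D_1 f y) \o u) x * 'D_e u x)).
  by apply: CkM; [apply: IH; [exact: Df|exact: Ck_pred]|exact: Du].
by apply/funext => x; rewrite derive_comp.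
Qed.

End Ck_comp.

Section smooth1.
Context (R : realType).

Definition smooth1 (f : R -> R) := forall k, Ck [set (1 : R)] k f.

Lemma Ck_id k : Ck [set (1 : R)] k (@id R).
Proof.
case: k => [|k]; split => //.
move=> e ->; under eq_fun do rewrite derive_id; exact: Ck_cst.
Qed.

Lemma smooth1_affine (a b : R) : smooth1 (fun x => a * x + b).
Proof.
by move=> k; apply: CkD; [apply: CkZ; exact: Ck_id|exact: Ck_cst].
Qed.

Lemma smooth1_derive f : smooth1 f -> smooth1 (fun x => 'D_1 f x).
Proof. by move=> Cf k; have [_] := Cf k.+1; apply. Qed.

Lemma smooth1_continuous f : smooth1 f -> continuous f.
Proof.
by move=> Cf x; apply: differentiable_continuous; exact: (Ck_differentiable (Cf 0%N)).
Qed.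

Lemma smooth1_is_derive f x : smooth1 f -> is_derive x (1 : R) f ('D_1 f x).
Proof.
move=> Cf; apply/derivableP/diff_derivable.
exact: (Ck_differentiable (Cf 0%N)).
Qed.

End smooth1.

(** * Coordinates, the squared norm and radial functions on R^n *)

Section smooth_rV.
Context (R : realType) (n : nat).
Implicit Types (u v : 'rV[R]_n -> R) (x y e : 'rV[R]_n).

Let D : set 'rV[R]_n := range (fun i : 'I_n => delta_mx ord0 i : 'rV[R]_n).

(** [Ck] strips the derivative applied first to [u], which in the [foldr] of [smooth] sits at the
    end of the list; hence the inductions go through [rcons]. *)
Lemma smoothP u : smooth u <-> forall k, Ck D k u.
Proof.
split=> [su k|Cu s].
  elim: k u su => [|k IH] u su; split => //; try exact: (su [::]).
  move=> _ [i _ <-]; apply: IH => s x.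
  by have := su (rcons s i) x; rewrite foldr_rcons.
elim/last_ind: s u Cu => [|s i IH] u Cu.
  exact: (Ck_differentiable (Cu 0%N)).
rewrite foldr_rcons; apply: IH => k.
by have [_] := Cu k.+1; apply; exists i.
Qed.

Lemma differentiable_coord_rV (i : 'I_n) (x : 'rV[R]_n) :
  differentiable (fun y : 'rV[R]_n => y ord0 i) x.
Proof. exact: differentiable_coord. Qed.

Lemma derive_coord (i : 'I_n) (x e : 'rV[R]_n) :
  'D_e (fun y : 'rV[R]_n => y ord0 i) x = e ord0 i.
Proof.
rewrite deriveE; last exact: differentiable_coord.
have @f : {linear 'rV[R]_n -> R}.
  by exists (fun N : 'rV[R]_n => N ord0 i); do 2![eexists]; do ?[constructor];
     rewrite ?mxE// => ? *; rewrite ?mxE//; move=> ?; rewrite !mxE.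
rewrite (_ : (fun _ => _) = f) // diff_lin//.
exact: coord_continuous.
Qed.

Lemma Ck_coord k (i : 'I_n) : Ck D k (fun y : 'rV[R]_n => y ord0 i).
Proof.
case: k => [|k]; (split => //; first by move=> x; exact: differentiable_coord).
move=> e De; rewrite (_ : 'D_e _ = (fun=> e ord0 i)); first exact: Ck_cst.
by apply/funext => x; rewrite derive_coord.
Qed.

Definition sqn (x : 'rV[R]_n) : R := dot x x.

Lemma Ck_sqn k : Ck D k sqn.
Proof.
by apply: Ck_sum => i; apply: CkM; exact: Ck_coord.
Qed.

Lemma smooth_radial (V : R -> R) : smooth1 V -> smooth (V \o sqn).
Proof.
by move=> sV; apply/smoothP => k; apply: Ck_comp => //; exact: Ck_sqn.
Qed.

Lemma differentiable_sqn x : differentiable sqn x.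
Proof. exact: Ck_differentiable (Ck_sqn 0) x. Qed.

Lemma derive_sqn (x e : 'rV[R]_n) : 'D_e sqn x = 2 * dot x e.
Proof.
rewrite /sqn /dot (_ : (fun _ => _) =
  \sum_(i < n) (fun y : 'rV[R]_n => y ord0 i * y ord0 i)); last first.
  by apply/funext => y; rewrite fct_sumE.
rewrite derive_sum => [|i]; last first.
  by apply: diff_derivable; apply: differentiableM; exact: differentiable_coord.
rewrite mulr_sumr; apply: eq_bigr => i _.
rewrite deriveM ?derive_coord; try exact/diff_derivable/differentiable_coord.
by rewrite /GRing.scale/=; ring.
Qed.

Lemma dot_delta x (i : 'I_n) : dot x (delta_mx ord0 i) = x ord0 i.
Proof.
rewrite /dot (bigD1 i)//= big1 => [|j ji].
  by rewrite mxE !eqxx mulr1 addr0.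
by rewrite mxE eqxx/= (negbTE ji) mulr0.
Qed.

Lemma sqn_ge0 x : 0 <= sqn x.
Proof. by apply: sumr_ge0 => i _; rewrite -expr2 sqr_ge0. Qed.

Lemma coord_le_sqn x i : x ord0 i ^+ 2 <= sqn x.
Proof.
rewrite /sqn /dot (bigD1 i)//= -expr2 lerDl.
by apply: sumr_ge0 => j _; rewrite -expr2 sqr_ge0.
Qed.

Lemma sqn_eq0 x : (sqn x == 0) = (x == 0).
Proof.
apply/eqP/eqP => [x0|->]; last by apply: big1 => i _; rewrite mxE mul0r.
apply/rowP => i; rewrite mxE; apply/eqP; rewrite -sqrf_eq0 eq_le sqr_ge0.
by rewrite -[leRHS]x0 coord_le_sqn.
Qed.

Lemma sqn_gt0 x : (0 < sqn x) = (x != 0).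
Proof. by rewrite lt_def sqn_eq0 sqn_ge0 andbT. Qed.

Lemma enorm_sqn x : enorm x = Num.sqrt (sqn x). Proof. by []. Qed.

Lemma enormZ (c : R) x : enorm (c *: x) = `|c| * enorm x.
Proof.
rewrite /enorm (_ : dot _ _ = c ^+ 2 * dot x x).
  by rewrite sqrtrM ?sqr_ge0// sqrtr_sqr.
by rewrite /dot mulr_sumr; apply: eq_bigr => i _; rewrite !mxE; ring.
Qed.

Lemma dotZl (c : R) x y : dot (c *: x) y = c * dot x y.
Proof. by rewrite /dot mulr_sumr; apply: eq_bigr => i _; rewrite !mxE mulrA. Qed.

Lemma grad_radial (V : R -> R) x : differentiable V (sqn x) ->
  grad (V \o sqn) x = (2 * 'D_1 V (sqn x)) *: x.
Proof.
move=> dV; apply/rowP => i; rewrite !mxE /partial derive_comp//.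
  by rewrite derive_sqn dot_delta; ring.
exact: differentiable_sqn.
Qed.

Lemma gradB u v x : differentiable u x -> differentiable v x ->
  grad (u \- v) x = grad u x - grad v x.
Proof.
move=> du dv; apply/rowP => i; rewrite !mxE /partial deriveB//;
  exact: diff_derivable.
Qed.

End smooth_rV.

(** * Calculus on the real line and smooth steps *)

Section real_line.
Context {R : realType}.
Implicit Types (f g : R -> R) (x y t : R).

Lemma is_derive_near f g x d : (\forall y \near x, f y = g y) ->
  is_derive x (1 : R) g d -> is_derive x (1 : R) f d.
Proof.
move=> fg; apply: near_eq_is_derive; near do symmetry; exact: fg.
Unshelve. all: by end_near. Qed.

Lemma is_derive_continuous f x d : is_derive x (1 : R) f d -> {for x, continuous f}.
Proof.
by move=> [df _]; apply/differentiable_continuous/derivable1_diffP.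
Qed.

Lemma is_derive1D f x d : is_derive x (1 : R) f d -> 'D_1 f x = d.
Proof. by case. Qed.

Lemma is_derive1E f x d : is_derive x (1 : R) f d -> (f^`())%classic x = d.
Proof. by move=> df; rewrite derive1E is_derive1D. Qed.

Lemma is_derive_differentiable f x d : is_derive x (1 : R) f d -> differentiable f x.
Proof. by move=> [df _]; exact/derivable1_diffP. Qed.

Lemma isd_cst (c x : R) : is_derive x (1 : R) (fun _ : R => c) (0 : R).
Proof. exact: is_derive_cst. Qed.

Lemma isd_id (x : R) : is_derive x (1 : R) (fun y : R => y) (1 : R).
Proof. exact: is_derive_id. Qed.

Lemma isdD f g (x a b : R) : is_derive x (1 : R) f a -> is_derive x (1 : R) g b ->
  is_derive x (1 : R) (fun y : R => f y + g y) (a + b).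
Proof. exact: is_deriveD. Qed.

Lemma isdN f (x a : R) : is_derive x (1 : R) f a ->
  is_derive x (1 : R) (fun y : R => - f y) (- a).
Proof. exact: is_deriveN. Qed.

Lemma isdB f g (x a b : R) : is_derive x (1 : R) f a -> is_derive x (1 : R) g b ->
  is_derive x (1 : R) (fun y : R => f y - g y) (a - b).
Proof. exact: is_deriveB. Qed.

Lemma isdM f g (x a b : R) : is_derive x (1 : R) f a -> is_derive x (1 : R) g b ->
  is_derive x (1 : R) (fun y : R => f y * g y) (a * g x + f x * b).
Proof.
move=> df dg; apply: (is_derive_eq (is_deriveM df dg)).
by rewrite /GRing.scale/=; ring.
Qed.

Lemma isdZ f (c x a : R) : is_derive x (1 : R) f a ->
  is_derive x (1 : R) (fun y : R => c * f y) (c * a).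
Proof. exact: is_deriveZ. Qed.

Lemma isd_comp f g (x a b : R) : is_derive x (1 : R) g b ->
  is_derive (g x) (1 : R) f a -> is_derive x (1 : R) (fun y : R => f (g y)) (a * b).
Proof. by move=> dg df; exact: is_derive1_comp. Qed.

Lemma isd_expR f (x a : R) : is_derive x (1 : R) f a ->
  is_derive x (1 : R) (fun y : R => expR (f y)) (expR (f x) * a).
Proof. by move=> /isd_comp; apply; exact: is_derive_expR. Qed.

Lemma isd_ln f (x a : R) : 0 < f x -> is_derive x (1 : R) f a ->
  is_derive x (1 : R) (fun y : R => ln (f y)) (a / f x).
Proof.
by move=> fx0 df; rewrite mulrC; apply: (isd_comp df); exact: is_derive1_ln.
Qed.

Lemma isd_affine (a b x : R) : is_derive x (1 : R) (fun y : R => a * y + b) a.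
Proof.
apply: is_derive_eq (isdD (isdZ a (isd_id x)) (isd_cst b x)) _.
by rewrite mulr1 addr0.
Qed.

Lemma isd_sum (I : Type) (r : seq I) (F : I -> R -> R) (x : R) (dF : I -> R) :
  (forall i, is_derive x (1 : R) (F i) (dF i)) ->
  is_derive x (1 : R) (fun y : R => \sum_(i <- r) F i y) (\sum_(i <- r) dF i).
Proof.
move=> FdF; elim: r => [|i r IH].
  by rewrite big_nil; under eq_fun do rewrite big_nil; exact: isd_cst.
by rewrite big_cons; under eq_fun do rewrite big_cons; exact: isdD.
Qed.

Lemma cts_comp f g (x : R) : {for x, continuous g} -> {for g x, continuous f} ->
  {for x, continuous (fun y : R => f (g y))}.
Proof. by move=> cg cf; exact: continuous_comp. Qed.

Lemma cts_compT f g : continuous g -> continuous f -> continuous (fun y : R => f (g y)).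
Proof. by move=> cg cf x; exact: (cts_comp (cg x) (cf (g x))). Qed.

Lemma ctsM f g (x : R) : {for x, continuous f} -> {for x, continuous g} ->
  {for x, continuous (fun y : R => f y * g y)}.
Proof. exact: cvgM. Qed.

Lemma ctsD f g (x : R) : {for x, continuous f} -> {for x, continuous g} ->
  {for x, continuous (fun y : R => f y + g y)}.
Proof. exact: cvgD. Qed.

Lemma ctsB f g (x : R) : {for x, continuous f} -> {for x, continuous g} ->
  {for x, continuous (fun y : R => f y - g y)}.
Proof. exact: cvgB. Qed.

Lemma ctsV f (x : R) : f x != 0 -> {for x, continuous f} ->
  {for x, continuous (fun y : R => (f y)^-1)}.
Proof. exact: cvgV. Qed.

Lemma ctsMT f g : continuous f -> continuous g -> continuous (fun y : R => f y * g y).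
Proof. by move=> cf cg x; exact: (ctsM (cf x) (cg x)). Qed.

Lemma ctsDT f g : continuous f -> continuous g -> continuous (fun y : R => f y + g y).
Proof. by move=> cf cg x; exact: (ctsD (cf x) (cg x)). Qed.

Lemma cts_cstT (c : R) : continuous (fun _ : R => c).
Proof. by move=> x; exact: cvg_cst. Qed.

Lemma cts_affine (a b : R) : continuous (fun y : R => a * y + b).
Proof. by move=> x; exact: is_derive_continuous (isd_affine a b x). Qed.

(** The difference quotient at [x0] is at most [C |x - x0|]. This handles the point 0 of the flat
    functions, where their formula changes. *)
Lemma is_derive_quadratic f (C x0 : R) :
  (forall x, `|f x - f x0| <= C * (x - x0) ^+ 2) -> is_derive x0 (1 : R) f 0.
Proof.
move=> fC.
suff F : h^-1 *: (f (h *: (1 : R) + x0) - f x0) @[h --> 0^'] --> (0 : R).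
  by split; [apply/cvg_ex; exists 0|exact: cvg_lim F].
apply/cvgrPdist_le => /= e e0.
have C0 : 0 <= C.
  have := fC (x0 + 1); rewrite (_ : x0 + 1 - x0 = 1); last by ring.
  by rewrite expr1n mulr1; exact: le_trans.
near=> h.
have h0 : h != 0 by near: h; exact: nbhs_dnbhs_neq.
rewrite sub0r normrN /GRing.scale/= mulr1 normrM normfV.
rewrite ler_pdivrMl ?normr_gt0//.
apply: (le_trans (fC _)); rewrite addrK -real_normK ?num_real//.
rewrite mulrC expr2 -mulrA ler_wpM2l//.
have : `|h| <= e / (C + 1).
  near: h; apply: dnbhs0_le; rewrite divr_gt0//; lra.
rewrite ler_pdivlMr; last lra.
have := normr_ge0 h; nra.
Unshelve. all: by end_near. Qed.

Lemma continuous_bounded_itv f (a b : R) :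
  (forall x : R, a <= x <= b -> {for x, continuous f}) ->
  exists2 C : R, 0 <= C & forall x : R, a <= x <= b -> `|f x| <= C.
Proof.
move=> cf; have [ab|ba] := leP a b; last first.
  by exists 0 => // x /andP[ax xb]; move: (le_trans ax xb); rewrite leNgt ba.
have cnf : {within `[a, b], continuous (fun x => `|f x|)}.
  apply: continuous_in_subspaceT => x; rewrite inE/= in_itv/= => /cf cfx.
  exact: continuous_comp cfx (@norm_continuous _ R (f x)).
have [c _ cM] := EVT_max ab cnf.
exists `|f c| => // x xab; apply: cM; by rewrite in_itv.
Qed.

(** The classical flat function [e^(-1/t)] with an extra factor [t^-m], which makes the family
    stable under differentiation: a derivative combines the members [m + 1] and [m + 2], so
    smoothness follows by induction on the order for all [m] at once. *)
Definition flat (m : nat) t : R :=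
  if 0 < t then (t^-1) ^+ m * expR (- t^-1) else 0.

Lemma flat_gt0 m t : 0 < t -> 0 < flat m t.
Proof.
by move=> t0; rewrite /flat t0 mulr_gt0 ?expR_gt0// exprn_gt0// invr_gt0.
Qed.

Lemma flat_eq0 m t : t <= 0 -> flat m t = 0.
Proof. by move=> t0; rewrite /flat ltNge t0. Qed.

Lemma flat_ge0 m t : 0 <= flat m t.
Proof.
by have [t0|t0] := leP t 0; [rewrite flat_eq0|exact/ltW/flat_gt0].
Qed.

(** The exponential series gives [e^(1/t) >= t^-(m+2) / (m+2)!], which beats [t^-m] with [t^2] to
    spare. *)
Lemma flat_quadratic m t : `|flat m t| <= (m.+2)`!%:R * t ^+ 2.
Proof.
rewrite ger0_norm ?flat_ge0//.
have [t0|t0] := leP t 0; first by rewrite flat_eq0// mulr_ge0// sqr_ge0.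
rewrite /flat t0.
have := @expR_ge1Dxn R t^-1 m.+1; rewrite invr_ge0 (ltW t0) => /(_ isT) H.
have F : 0 < (m.+2)`!%:R :> R by rewrite ltr0n fact_gt0.
have {}H : t^-1 ^+ m.+2 <= (m.+2)`!%:R * expR t^-1.
  by rewrite mulrC -ler_pdivrMr//; apply: le_trans H; rewrite lerDr.
rewrite expRN ler_pdivrMr ?expR_gt0// mulrAC.
have -> : t^-1 ^+ m = t ^+ 2 * t^-1 ^+ m.+2.
  by rewrite !exprS; field; rewrite gt_eqF.
by rewrite mulrC ler_wpM2r// sqr_ge0.
Qed.

Lemma is_derive_flat m t : is_derive t (1 : R) (flat m)
  (- m%:R * flat m.+1 t + flat m.+2 t).
Proof.
have [t0|t0|->] := ltgtP t 0.
- rewrite !flat_eq0 ?ltW// mulr0 addr0; apply: (@is_derive_near _ (cst 0)).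
  near=> y; rewrite flat_eq0//; apply/ltW; near: y; exact: lt_nbhsl.
- apply: (@is_derive_near _ (fun y => (y^-1) ^+ m * expR (- y^-1))).
    near=> y; rewrite /flat ifT//; near: y; exact: lt_nbhsr.
  have dV : is_derive t (1 : R) (fun y => y^-1) (- (t ^- 2)).
    have := @is_deriveV R id t 1 1; rewrite gt_eqF// => /(_ isT (is_derive_id _ _)).
    by rewrite /GRing.scale/= mulr1.
  have dX : is_derive t (1 : R) (fun y => y^-1 ^+ m) (m%:R * t^-1 ^+ m.-1 * - (t ^- 2)).
    rewrite (_ : (fun y => _) = (fun y : R => y^-1) ^+ m); last first.
      by apply/funext => y; rewrite exprfctE.
    exact: is_deriveX.
  have dE : is_derive t (1 : R) (fun y => expR (- y^-1)) (expR (- t^-1) * (t ^- 2)).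
    have dN := is_deriveN dV.
    have := @is_derive1_comp _ expR (fun y => - y^-1) t _ _ (is_derive_expR _) dN.
    by rewrite opprK.
  have := is_deriveM dX dE.
  rewrite /GRing.scale/= => H.
  apply: (is_derive_eq H).
  rewrite /flat t0; case: m {dX H} => [|m] /=.
    by rewrite mulr0n !expr0; field; rewrite gt_eqF.
  by rewrite !exprS; field; rewrite gt_eqF.
- rewrite !flat_eq0// mulr0 addr0.
  apply: (@is_derive_quadratic _ (m.+2)`!%:R) => x.
  by rewrite (@flat_eq0 _ 0)// !subr0 flat_quadratic.
Unshelve. all: by end_near. Qed.

Lemma smooth1_flat m : smooth1 (flat m).
Proof.
move=> k; elim: k m => [|k IH] m; (split => //;
  first by move=> x; exact: is_derive_differentiable (is_derive_flat m x)).
move=> e ->; rewrite (_ : 'D_(1 : R) _ = (fun x => - m%:R * flat m.+1 x + flat m.+2 x)).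
  by apply: CkD => //; exact: CkZ.
by apply/funext => x; rewrite (is_derive1D (is_derive_flat m x)).
Qed.

Lemma smooth1M f g : smooth1 f -> smooth1 g -> smooth1 (fun x => f x * g x).
Proof. by move=> sf sg k; exact: CkM. Qed.

Lemma smooth1_comp f g : smooth1 f -> smooth1 g -> smooth1 (f \o g).
Proof. by move=> sf sg k; exact: Ck_comp. Qed.

Lemma derive_locally_cst f (c x : R) : (\forall y \near x, f y = c) -> 'D_1 f x = 0.
Proof.
by move=> fc; apply: is_derive1D; apply: (is_derive_near fc); exact: is_derive_cst.
Qed.

(** The witness is [flat 0 t / (flat 0 t + flat 0 (1 - t))]; its denominator is positive since [t]
    and [1 - t] are never both nonpositive. *)
Lemma smooth_step : exists S : R -> R, [/\ smooth1 S,
  (forall t : R, t <= 0 -> S t = 0) /\ (forall t : R, 1 <= t -> S t = 1),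
  forall t : R, 0 <= S t <= 1, forall t : R, t <= 0 \/ 1 <= t -> 'D_(1 : R) S t = 0
  & exists2 C : R, 0 <= C & forall t, `|'D_(1 : R) S t| <= C].
Proof.
pose d t := flat 0 t + flat 0 (1 - t).
have d_gt0 t : 0 < d t.
  have [t0|t0] := leP t 0.
    by rewrite /d ltr_wpDl ?flat_ge0// flat_gt0//; lra.
  by rewrite /d ltr_pwDl ?flat_ge0// flat_gt0.
have sd : smooth1 d.
  move=> k; apply: CkD; first exact: smooth1_flat.
  have := smooth1_comp (smooth1_flat 0) (smooth1_affine (-1) 1) k.
  by congr Ck; apply/funext => t /=; congr flat; ring.
pose S t := flat 0 t * (d t)^-1.
have sS : smooth1 S.
  move=> k; apply: CkM; first exact: smooth1_flat.
  by apply: CkV => // x; rewrite gt_eqF.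
have S0 t : t <= 0 -> S t = 0 by move=> t0; rewrite /S flat_eq0// mul0r.
have S1 t : 1 <= t -> S t = 1.
  move=> t1; rewrite /S /d (@flat_eq0 _ (1 - t)); last lra.
  by rewrite addr0 divff// gt_eqF// flat_gt0//; lra.
have S01 t : 0 <= S t <= 1.
  rewrite /S divr_ge0 ?flat_ge0 ?(ltW (d_gt0 _))//=.
  by rewrite ler_pdivrMr ?d_gt0// mul1r lerDl flat_ge0.
have dS t : derivable S t 1.
  by apply: diff_derivable; exact: Ck_differentiable (sS 0%N) t.
(* At such [t] the function [S] attains its minimum 0 or its maximum 1. This also settles the
   endpoints 0 and 1, where [S] is not locally constant. *)
have dS0 t : t <= 0 \/ 1 <= t -> 'D_(1 : R) S t = 0.
  have tI : t \in `](t - 1), (t + 1)[ by rewrite in_itv/=; lra.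
  move=> [t0|t1]; apply: is_derive1D.
    apply: (@derive1_at_min _ S (t - 1) (t + 1)) => //; first lra.
    by move=> y _; rewrite (S0 t)//; have /andP[] := S01 y.
  apply: (@derive1_at_max _ S (t - 1) (t + 1)) => //; first lra.
  by move=> y _; rewrite (S1 t)//; have /andP[] := S01 y.
exists S; split => //.
have [C C0 HC] := @continuous_bounded_itv (fun x => 'D_(1 : R) S x) 0 1
  (fun x _ => smooth1_continuous (smooth1_derive sS) (x := x)).
exists C => // t; have [t0|t0] := leP t 0; first by rewrite dS0 ?normr0//; left.
have [t1|t1] := leP 1 t; first by rewrite dS0 ?normr0//; right.
by apply: HC; rewrite !ltW.
Qed.

Lemma uniform_continuity_itv f (a b e : R) : continuous f -> 0 < e ->
  exists2 d : R, 0 < d & forall x y : R, a <= x <= b -> `|x - y| < d -> `|f x - f y| < e.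
Proof.
move=> cf e0.
have /compact_near_coveringP := @segment_compact R a b.
move=> /(_ R (0^'+) (fun d x => forall y, `|x - y| < d -> `|f x - f y| < e)).
case.
  move=> x _.
  have /cvgrPdist_lt /(_ (e / 2)) := cf x; rewrite divr_gt0// => /(_ isT).
  move=> [d /= d0 Hd].
  exists (ball x (d / 2), [set r | 0 < r < d / 2]).
    split; first by apply: nbhsx_ballx; rewrite divr_gt0.
    exists (d / 2); first by rewrite /= divr_gt0.
    by move=> r /=; rewrite sub0r normrN => rd r0; rewrite r0/= (le_lt_trans _ rd)// ler_norm.
  move=> [x' r]/= [xx' /andP[r0 rd]] y x'y.
  have H1 : `|f x - f x'| < e / 2.
    by apply: Hd => /=; apply: lt_trans xx' _; rewrite ltr_pdivrMr// ltr_pMr// ltr1n.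
  have H2 : `|f x - f y| < e / 2.
    apply: Hd => /=; rewrite -(subrK x' x) -addrA (le_lt_trans (ler_normD _ _))//.
    by rewrite (splitr d) ltrD//; exact: lt_trans rd.
  rewrite -(subrK (f x) (f x')) -addrA (le_lt_trans (ler_normD _ _))//.
  by rewrite (splitr e) ltrD// distrC.
move=> d /= d0 Hd; exists (d / 2); first by rewrite divr_gt0.
move=> x y xab; apply: (Hd (d / 2)) => //=; last by rewrite divr_gt0.
by rewrite sub0r normrN gtr0_norm ?divr_gt0// ltr_pdivrMr// ltr_pMr// ltr1n.
Qed.

End real_line.

(** * Approximation of radial profiles *)

Section approximation.
Context {R : realType}.

(** With a smooth step [S], take [t S(t)]: its derivative is a smoothed unit jump located in [0, 1],
    the building block of [C1_approx]. *)
Lemma smooth_ramp : exists Q : R -> R, [/\ smooth1 Q,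
  forall t : R, t <= 0 -> Q t = 0, forall t : R, t <= 0 -> 'D_(1 : R) Q t = 0,
  forall t : R, 1 <= t -> 'D_(1 : R) Q t = 1 &
  exists2 C : R, 0 <= C & forall t : R, 0 <= t <= 1 -> `|'D_(1 : R) Q t| <= C].
Proof.
have [S [sS [S0 S1] S01 dS0 [C C0 dSC]]] := @smooth_step R.
exists (fun t => t * S t).
have dQ (t : R) : 'D_(1 : R) (fun t : R => t * S t) t = S t + t * 'D_(1 : R) S t.
  apply: is_derive1D; have H := isdM (isd_id t) (smooth1_is_derive t sS).
  by apply: (is_derive_eq H); ring.
split.
- by apply: smooth1M => //; move=> k; exact: Ck_id.
- by move=> t t0; rewrite S0// mulr0.
- by move=> t t0; rewrite dQ S0// dS0; [ring|left].
- by move=> t t1; rewrite dQ S1// dS0; [ring|right].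
exists (1 + C) => [|t /andP[t0 t1]]; first by rewrite addr_ge0.
rewrite dQ; apply: (le_trans (ler_normD _ _)); apply: lerD.
  by have /andP[a b] := S01 t; rewrite ger0_norm.
rewrite normrM (ger0_norm t0); have := dSC t; have := normr_ge0 ('D_(1 : R) S t); nra.
Qed.

Lemma mean_value_bound (f df : R -> R) (a b e : R) : a <= b -> f a = 0 ->
  (forall x : R, a <= x <= b -> is_derive x (1 : R) f (df x)) ->
  (forall x : R, a <= x <= b -> `|df x| <= e) -> `|f b| <= e * (b - a).
Proof.
move=> ab fa dfx dfe.
have [||c cab] := @MVT_segment _ f df a b ab.
- by move=> x xab; apply: dfx; rewrite !(itvP xab).
- apply: continuous_in_subspaceT => x; rewrite inE/= in_itv/= => /dfx.
  exact: is_derive_continuous.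
rewrite fa subr0 => ->; rewrite normrM (@ger0_norm _ (b - a)) ?subr_ge0//.
by rewrite ler_wpM2r ?subr_ge0// dfe// !(itvP cab).
Qed.

(** A substitute for mollification. In [V'] the cells to the left of [x] telescope to the value of
    [dU] at the last grid point, the cell of [x] contributes one small jump times a bounded factor,
    and the cells to the right contribute nothing. The estimate on [V] follows from the mean value
    theorem, as [V] and [U] both vanish at 0. *)
Lemma C1_approx (U dU : R -> R) (L e : R) :
  (forall x : R, is_derive x (1 : R) U (dU x)) -> continuous dU ->
  U 0 = 0 -> dU 0 = 0 -> 0 < L -> 0 < e ->
  exists V : R -> R, [/\ smooth1 V, forall x : R, x <= 0 -> V x = 0 &
    forall x : R, 0 <= x <= L ->
      `|V x - U x| <= e * L /\ `|'D_(1 : R) V x - dU x| <= e].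
Proof.
move=> UdU cdU U0 dU0 L0 e0.
have [Q [sQ Q0 dQ0 dQ1 [C C0 dQC]]] := smooth_ramp.
have C1 : 0 < C + 1 by lra.
(* The tolerance [e / (C + 1)] leaves room for two errors: moving from [x] to a grid point, and one
   jump of [dU] multiplied by [|Q'| <= C]. *)
have [d d0 Hd] := @uniform_continuity_itv R dU 0 L (e / (C + 1)) cdU (divr_gt0 e0 C1).
pose J := (Num.truncn (2 * L / d)).+1.
pose h := L / J%:R.
have J0 : 0 < J%:R :> R by rewrite ltr0n.
have h0 : 0 < h by rewrite divr_gt0.
have hd : h < d.
  rewrite /h ltr_pdivrMr// mulrC -ltr_pdivrMr//.
  apply: (@le_lt_trans _ _ (2 * L / d)).
    by rewrite ler_wpM2r ?invr_ge0 ?(ltW d0)//; lra.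
  have H0 : 0 <= 2 * L / d by rewrite divr_ge0 ?ltW//; lra.
  by have /andP[_] := truncn_itv H0.
have hJ : h * J%:R = L by rewrite /h divfK// gt_eqF.
(* V' is dU sampled on a grid of mesh h, with smoothed jumps. *)
pose D (j : nat) := dU (j.+1%:R * h) - dU (j%:R * h).
pose f (j : nat) x := D j * (Q (h^-1 * x + - j%:R)).
pose V x := h * \sum_(0 <= j < J) f j x.
have sf j : smooth1 (f j).
  move=> k; apply: CkZ.
  by apply: (Ck_comp (f := Q)) => //; exact: smooth1_affine.
have sV : smooth1 V by move=> k; apply/CkZ/Ck_sum => j; exact: sf.
have df j (x : R) : is_derive x (1 : R) (f j) (h^-1 * (D j * 'D_(1 : R) Q (h^-1 * x + - j%:R))).
  have H := isd_comp (isd_affine h^-1 (- j%:R) x) (smooth1_is_derive _ sQ).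
  by apply: (is_derive_eq (isdZ (D j) H)); ring.
have dV (x : R) : is_derive x (1 : R) V (\sum_(0 <= j < J) (D j * 'D_(1 : R) Q (h^-1 * x + - j%:R))).
  have H := isdZ h (isd_sum (index_iota 0 J) (df^~ x)).
  apply: (is_derive_eq H).
  by rewrite -mulr_sumr mulrA divff ?gt_eqF// mul1r.
have key (x : R) : 0 <= x <= L -> `|'D_(1 : R) V x - dU x| <= e.
  move=> /andP[x0 xL]; rewrite (is_derive1D (dV x)).
  have hx0 : 0 <= h^-1 * x by rewrite mulr_ge0 ?invr_ge0// ltW.
  pose i := Num.truncn (h^-1 * x).
  have /andP[ix xi] := truncn_itv hx0; rewrite -/i in ix xi.
  have iJ : (i <= J)%N.
    rewrite -(ler_nat R) (le_trans ix)// -ler_pdivlMl ?invr_gt0// invrK hJ//.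
  have ihx : i%:R * h <= x by move: ix; rewrite mulrC ler_pdivlMr.
  have xih : x < i.+1%:R * h by move: xi; rewrite mulrC ltr_pdivrMr.
  have near1 : `|dU (i%:R * h) - dU x| < e / (C + 1).
    rewrite distrC; apply: Hd; first by rewrite x0 xL.
    rewrite ger0_norm ?subr_ge0//; move: xih; rewrite -natr1 mulrDl mul1r; lra.
  rewrite (@big_cat_nat _ _ _ i)//=.
  have -> : \sum_(0 <= j < i) D j * 'D_(1 : R) Q (h^-1 * x + - j%:R) = dU (i%:R * h).
    rewrite (@telescope_sumr_eq _ 0 i (fun j => dU (j%:R * h)))//.
      by rewrite mul0r dU0 subr0.
    move=> j /= ji; rewrite dQ1 ?mulr1//.
    have : (j.+1%:R : R) <= i%:R by rewrite ler_nat.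
    rewrite -natr1; lra.
  (* [i = J] occurs only at [x = L]: all jumps have then been passed and there is no current
     cell. *)
  move: iJ; rewrite leq_eqVlt => /predU1P[iJ|iJ].
    rewrite iJ big_geq// addr0 (ltW (lt_le_trans (y := e / (C + 1)) _ _))//.
      by rewrite -iJ.
    by rewrite ler_pdivrMr// ler_peMr//; lra.
  rewrite big_ltn// [X in _ + (_ + X)]big_nat_cond big1 ?addr0; last first.
    move=> j /andP[/andP[ij _] _]; rewrite dQ0 ?mulr0//.
    have : (i.+1%:R : R) <= j%:R by rewrite ler_nat.
    lra.
  have near2 : `|D i| < e / (C + 1).
    rewrite /D distrC; apply: Hd.
      rewrite mulr_ge0 ?(ltW h0)//= -hJ mulrC ler_pM2l//.
      by rewrite ler_nat ltnW.
    rewrite -natr1 mulrDl mul1r distrC addrAC subrr add0r gtr0_norm//.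
  rewrite addrAC (le_trans (ler_normD _ _))//.
  have eE : e = e / (C + 1) + e / (C + 1) * C by field; rewrite gt_eqF.
  rewrite [leRHS]eE; apply: lerD; first exact: ltW.
  rewrite normrM; apply: ler_pM; rewrite ?normr_ge0//; first exact: ltW.
  by apply: dQC; rewrite subr_ge0 ix/= lerBlDr addrC natr1 ltW.
exists V; split => //.
  move=> x x0; rewrite /V big1 ?mulr0// => j _; rewrite /f Q0 ?mulr0//.
  rewrite subr_le0 (@le_trans _ _ 0)// mulr_ge0_le0// invr_ge0 ltW//.
move=> x xL; split; last exact: key.
have V0 : V 0 = 0.
  by rewrite /V big1 ?mulr0// => j _; rewrite /f Q0 ?mulr0// add0r oppr_le0.
have /andP[x0 xL'] := xL.
have := @mean_value_bound (V \- U) (fun x => 'D_(1 : R) V x - dU x) 0 x e x0.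
rewrite /= V0 U0 subrr => /(_ erefl) H.
apply: (le_trans (H _ _)).
- move=> y _; apply: is_deriveB; exact: smooth1_is_derive.
- by move=> y /andP[y0 yx]; apply: key; rewrite y0 (le_trans yx).
by rewrite subr0 ler_wpM2l// ltW.
Qed.

(** At [t = ln |x|] this is [|x|^-delta] times [min(|x|, 1/|x|)^a]: a pure power with a gain of [a]
    both at 0 and at infinity. *)
Definition weight (delta a t : R) : R := expR (- delta * t - a * `|t|).

Lemma weight_gt0 delta a t : 0 < weight delta a t.
Proof. exact: expR_gt0. Qed.

(** The exponent has slopes [-delta + a] and [-delta - a], both nonpositive when [a <= delta]. *)
Lemma weight_decreasing delta a t t' : 0 <= a <= delta -> t <= t' ->
  weight delta a t' <= weight delta a t.
Proof.
move=> /andP[a0 ad] tt'; rewrite ler_expR.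
have := ler_normD t' (t - t'); rewrite subrKC (ler0_norm (x := t - t')); last lra.
nra.
Qed.

(** Half of the decay rate [2 a] pays for the truncation: the ratio of the two weights is
    [e^(-a |t|)], hence at most [e^(-a N)] wherever the cutoff acts. *)
Lemma cutoff_approx (U dU : R -> R) (delta a C e : R) : 0 < a -> 0 <= C -> 0 < e ->
  (forall t, is_derive t (1 : R) U (dU t)) -> continuous dU ->
  (forall t, `|U t| <= C * weight delta (2 * a) t) ->
  (forall t, `|dU t| <= C * weight delta (2 * a) t) ->
  exists (U' dU' : R -> R) (N : R), [/\ 0 <= N,
    forall t, is_derive t (1 : R) U' (dU' t), continuous dU',
    forall t, N <= `|t| -> U' t = 0 /\ dU' t = 0 &
    forall t, `|U' t - U t| <= e * weight delta a t /\
              `|dU' t - dU t| <= e * weight delta a t].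
Proof.
move=> a0 C0 e0 UdU cdU UC dUC.
have [S [sS [S0 S1] S01 dS0 [K K0 dSK]]] := @smooth_step R.
(* [1 + 2 K] bounds [|1 - chi| + |chi'|], as [chi] is a product of two steps of slope at most [K].
   With [N = y / a] the truncation error is below [e] because [e^y >= y]. *)
pose y := C * (1 + 2 * K) / e.
have y0 : 0 <= y by rewrite divr_ge0 ?(ltW e0)// mulr_ge0//; lra.
pose N := y / a.
have N0 : 0 <= N by rewrite divr_ge0// ltW.
have Ne : C * (1 + 2 * K) * expR (- (a * N)) <= e.
  rewrite /N mulrCA divff ?gt_eqF// mulr1 expRN.
  rewrite ler_pdivrMr ?expR_gt0//.
  have -> : C * (1 + 2 * K) = e * y by rewrite /y [RHS]mulrC divfK ?gt_eqF.
  by rewrite ler_pM2l//; have := expR_ge1Dx y; lra.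
pose chi (t : R) : R := S (t + (N + 1)) * S (-1 * t + (N + 1)).
pose dchi (t : R) : R := 'D_(1 : R) S (t + (N + 1)) * S (-1 * t + (N + 1))
  - S (t + (N + 1)) * 'D_(1 : R) S (-1 * t + (N + 1)).
have dS (t : R) : is_derive t (1 : R) S ('D_(1 : R) S t) by exact: smooth1_is_derive.
have chiE (t : R) : is_derive t (1 : R) chi (dchi t).
  have H1 := isd_comp (isdD (isd_id t) (isd_cst (N + 1) t)) (dS _).
  have H2 := isd_comp (isd_affine (-1) (N + 1) t) (dS _).
  by apply: (is_derive_eq (isdM H1 H2)); rewrite /dchi; ring.
have cS := smooth1_continuous sS.
have cdS := smooth1_continuous (smooth1_derive sS).
have cchi (t : R) : {for t, continuous chi} by exact: is_derive_continuous (chiE t).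
have cdchi (t : R) : {for t, continuous dchi}.
  have c1 : {for t, continuous (fun t : R => t + (N + 1))}.
    exact: is_derive_continuous (isdD (isd_id t) (isd_cst (N + 1) t)).
  have c2 := @cts_affine R (-1) (N + 1) t.
  apply: ctsB; apply: ctsM.
  - exact: (cts_comp c1 (cdS _)).
  - exact: (cts_comp c2 (cS _)).
  - exact: (cts_comp c1 (cS _)).
  - exact: (cts_comp c2 (cdS _)).
have chi1 (t : R) : `|t| <= N -> chi t = 1 /\ dchi t = 0.
  rewrite ler_norml => /andP[t1 t2]; rewrite /chi /dchi.
  rewrite (S1 (t + _)) ?(S1 (-1 * t + _)) ?(dS0 (t + _)) ?(dS0 (-1 * t + _));
    do ?[by right; lra]; lra.
have chi0 (t : R) : N + 1 <= `|t| -> chi t = 0 /\ dchi t = 0.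
  have [t0|t0] := leP 0 t; rewrite /chi /dchi => Nt.
    rewrite (ger0_norm t0) in Nt; have z : -1 * t + (N + 1) <= 0 by lra.
    by rewrite (S0 _ z) (dS0 _ (or_introl z)) !mulr0 subr0.
  rewrite (ltr0_norm t0) in Nt; have z : t + (N + 1) <= 0 by lra.
  by rewrite (S0 _ z) (dS0 _ (or_introl z)) !mul0r subr0.
have chi01 t : 0 <= chi t <= 1.
  rewrite /chi; have /andP[h1 h2] := S01 (t + (N + 1)).
  by have /andP[h3 h4] := S01 (-1 * t + (N + 1)); nra.
have dchiK t : `|dchi t| <= 2 * K.
  rewrite /dchi; have /andP[h1 h2] := S01 (t + (N + 1)).
  have /andP[h3 h4] := S01 (-1 * t + (N + 1)).
  rewrite (le_trans (ler_normB _ _))// !normrM (ger0_norm h1) (ger0_norm h3).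
  have := dSK (t + (N + 1)); have := dSK (-1 * t + (N + 1)).
  have := normr_ge0 ('D_(1 : R) S (t + (N + 1))).
  have := normr_ge0 ('D_(1 : R) S (-1 * t + (N + 1))).
  nra.
have far t : N <= `|t| ->
    C * (1 + 2 * K) * weight delta (2 * a) t <= e * weight delta a t.
  move=> Nt; have -> : weight delta (2 * a) t = weight delta a t * expR (- (a * `|t|)).
    by rewrite /weight -expRD; congr expR; ring.
  rewrite mulrCA [e * _]mulrC ler_pM2l ?weight_gt0//.
  apply: le_trans Ne; rewrite ler_wpM2l//.
    by rewrite mulr_ge0//; lra.
  by rewrite ler_expR lerN2 ler_pM2l.
exists (fun t => chi t * U t), (fun t => dchi t * U t + chi t * dU t), (N + 1).
split; first lra.
- by move=> t; exact: isdM.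
- move=> t; apply: cvgD; apply: cvgM.
  + exact: cdchi.
  + exact: is_derive_continuous (UdU t).
  + exact: cchi.
  + exact: cdU.
- by move=> t /chi0[-> ->]; split; ring.
move=> t; have w0 := weight_gt0 delta (2 * a) t.
have w1 := ltW (mulr_gt0 e0 (weight_gt0 delta a t)).
have [tN|Nt] := leP `|t| N.
  have [-> ->] := chi1 _ tN.
  by rewrite !mul1r mul0r add0r !subrr normr0.
have {}far := far _ (ltW Nt).
have /andP[c0 c1] := chi01 t.
have := UC t; have := dUC t; have := dchiK t; set w := weight _ _ _ in far w0 *.
move=> hd hdU hU; split; apply: le_trans far.
  rewrite -[X in _ - X]mul1r -mulrBl normrM ler0_norm; last lra.
  have := normr_ge0 (U t); have : 0 <= C * w by rewrite mulr_ge0// ltW.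
  have : 0 <= C * w * K by rewrite mulr_ge0// mulr_ge0// ltW.
  nra.
rewrite -addrA -[X in _ + (_ - X)]mul1r -mulrBl (le_trans (ler_normD _ _))//.
rewrite !normrM (ler0_norm (x := chi t - 1)); last lra.
have hU' : `|dchi t| * `|U t| <= 2 * K * (C * w).
  by apply: ler_pM; rewrite ?normr_ge0.
have hdU' : - (chi t - 1) * `|dU t| <= 1 * (C * w).
  by apply: ler_pM; rewrite ?normr_ge0//; lra.
lra.
Qed.

(** The argument [r] stands for [|x|^2], which unlike [|x|] is smooth at the origin, so [ln r / 2]
    is [ln |x|]. The default 0 also fixes the value of radial functions at the origin. *)
Definition radial (H : R -> R) (r : R) : R := if 0 < r then H (ln r / 2) else 0.

Lemma rad_gt0 H r : 0 < r -> radial H r = H (ln r / 2).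
Proof. by rewrite /radial => ->. Qed.

Lemma rad_le0 H r : r <= 0 -> radial H r = 0.
Proof. by rewrite /radial leNgt => /negbTE ->. Qed.

Lemma is_derive_half_ln (r : R) : 0 < r ->
  is_derive r (1 : R) (fun s : R => ln s / 2) (2 * r)^-1.
Proof.
move=> r0; apply: (is_derive_eq (isdM (isd_ln r0 (isd_id r)) (isd_cst 2^-1 r))).
by field; rewrite gt_eqF.
Qed.

Lemma rad_near H (r : R) : 0 < r -> \forall s \near r, radial H s = H (ln s / 2).
Proof. by move=> r0; near=> s; apply: rad_gt0; near: s; exact: lt_nbhsr.
Unshelve. all: by end_near. Qed.

Lemma is_derive_rad H (r d : R) : 0 < r -> is_derive (ln r / 2) (1 : R) H d ->
  is_derive r (1 : R) (radial H) (d / (2 * r)).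
Proof.
move=> r0 Hd; apply: (is_derive_near (rad_near H r0)).
exact: isd_comp (is_derive_half_ln r0) Hd.
Qed.

Lemma continuous_rad H (r : R) : 0 < r -> {for ln r / 2, continuous H} ->
  {for r, continuous (radial H)}.
Proof.
move=> r0 cH; have := cts_comp (is_derive_continuous (is_derive_half_ln r0)) cH.
rewrite /prop_for /continuous_at {2}/radial r0.
apply: cvg_trans; apply: near_eq_cvg; near do rewrite -rad_gt0//.
exact: lt_nbhsr.
Unshelve. all: by end_near. Qed.

Lemma rad_flat H (T r : R) : (forall t, t <= T -> H t = 0) -> r <= 0 ->
  \forall s \near r, radial H s = 0.
Proof.
move=> HT r0; near=> s; rewrite /radial; case: ifPn => // s0; apply: HT.
have : ln s < 2 * T.
  rewrite -[ltRHS]expRK ltr_ln ?posrE ?expR_gt0//.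
  by near: s; apply: lt_nbhsl; rewrite (le_lt_trans r0)// expR_gt0.
lra.
Unshelve. all: by end_near. Qed.

(** The chain rule brings in the singular factor [1 / (2 r)]; it is harmless because vanishing for
    [t <= T] means vanishing on a neighbourhood of [r = 0]. *)
Lemma rad_C1 (H dH : R -> R) (T : R) :
  (forall t, is_derive t (1 : R) H (dH t)) -> continuous dH ->
  (forall t, t <= T -> H t = 0 /\ dH t = 0) ->
  (forall r, is_derive r (1 : R) (radial H) (radial dH r / (2 * r))) /\
  continuous (fun r => radial dH r / (2 * r)).
Proof.
move=> HdH cdH HT.
have [HT1 HT2] : (forall t, t <= T -> H t = 0) /\ (forall t, t <= T -> dH t = 0).
  by split=> t /HT[].
split=> r; have [r0|r0] := ltP 0 r.
- by rewrite rad_gt0//; exact: is_derive_rad.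
- rewrite rad_le0// mul0r.
  exact: (is_derive_near (rad_flat HT1 r0) (isd_cst 0 r)).
- apply: ctsM; first by apply: continuous_rad => //; exact: cdH.
  apply: ctsV; first by rewrite mulf_neq0// gt_eqF.
  exact: is_derive_continuous (isdZ 2 (isd_id r)).
- have : {for r, continuous (fun _ : R => 0 : R)} by exact: cvg_cst.
  rewrite /prop_for /continuous_at rad_le0// mul0r.
  apply: cvg_trans; apply: near_eq_cvg.
  by near do rewrite (_ : radial dH _ = 0) ?mul0r//; exact: (rad_flat HT2 r0).
Unshelve. all: by end_near. Qed.

(** Once cut off in [t], the profile is C^1 in [r] and vanishes for [r >= b]. [C1_approx] starts
    from a point of exact vanishing, so it is run inwards from [b], in the variable [b - r]; this
    keeps the support bounded. Near [r = 0] the approximant need not vanish: a constant error is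
    allowed there since the weight decreases in [t]. *)
Lemma radial_approx (U dU : R -> R) (delta a C e : R) :
  0 < a <= delta -> 0 <= C -> 0 < e ->
  (forall t, is_derive t (1 : R) U (dU t)) -> continuous dU ->
  (forall t, `|U t| <= C * weight delta (2 * a) t) ->
  (forall t, `|dU t| <= C * weight delta (2 * a) t) ->
  exists (V : R -> R) (b : R), [/\ smooth1 V, forall r, b <= r -> V r = 0 &
    forall r, 0 < r -> let t := ln r / 2 in
      `|V r - U t| <= e * weight delta a t /\
      `|2 * r * 'D_(1 : R) V r - dU t| <= e * weight delta a t].
Proof.
move=> /andP[a0 ad] C0 e0 UdU cdU UC dUC.
have e2 : 0 < e / 2 by lra.
have [U' [dU' [N [N0 U'dU' cdU' U'0 U'e]]]] := cutoff_approx a0 C0 e2 UdU cdU UC dUC.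
pose b := expR (2 * N).
have b0 : 0 < b := expR_gt0 _.
pose W := radial U'.
pose dW (r : R) : R := radial dU' r / (2 * r).
have lnb r : b <= r -> N <= `|ln r / 2|.
  move=> br; have : 2 * N <= ln r.
    by rewrite -[leLHS]expRK ler_ln// posrE// (lt_le_trans b0).
  by move=> H; rewrite ger0_norm; lra.
have U'N (t : R) : t <= - N -> U' t = 0 /\ dU' t = 0.
  by move=> tN; apply: U'0; rewrite ler0_norm; lra.
have [WdW cdW] := rad_C1 U'dU' cdU' U'N; rewrite -/W -/dW in WdW cdW.
(* Chosen so that [2 b e'] is half the allowed error at [t = N], where the weight is smallest on
   [r <= b]. The factor [2 r <= 2 b] appears when an [r]-derivative is turned into a
   [t]-derivative. *)
pose e' := e / 2 * weight delta a N / (2 * b).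
have e'0 : 0 < e' by apply: divr_gt0; apply: mulr_gt0 => //; exact: weight_gt0.
have dB (r : R) : is_derive r (1 : R) (fun s : R => b - s) (- 1).
  by apply: (is_derive_eq (isdB (isd_cst b r) (isd_id r))); rewrite add0r.
have [V [sV V0 Ve]] : exists V : R -> R, [/\ smooth1 V,
    forall x : R, x <= 0 -> V x = 0 & forall x : R, 0 <= x <= b ->
      `|V x - W (b - x)| <= e' * b /\ `|'D_(1 : R) V x - - dW (b - x)| <= e'].
  apply: C1_approx => //.
  - by move=> x; apply: (is_derive_eq (isd_comp (dB x) (WdW _))); rewrite mulrN1.
  - move=> x; apply: (@continuous_comp _ _ _ (fun s : R => b - s) (fun s : R => - dW s)).
      exact: is_derive_continuous (dB x).
    by apply: continuousN; exact: cdW.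
  - by rewrite subr0 /W rad_gt0//; exact: (U'0 _ (lnb _ (lexx _))).1.
  - by rewrite subr0 /dW rad_gt0// (U'0 _ (lnb _ (lexx _))).2 mul0r oppr0.
have dVb (r : R) : is_derive r (1 : R) (fun s : R => V (b - s)) (- 'D_(1 : R) V (b - r)).
  by apply: (is_derive_eq (isd_comp (dB r) (smooth1_is_derive _ sV))); rewrite mulrN1.
exists (fun s => V (b - s)), b; split.
- move=> k; have := smooth1_comp sV (smooth1_affine (-1) b) k.
  by congr Ck; apply/funext => s /=; congr V; ring.
- by move=> r br; apply: V0; rewrite subr_le0.
move=> r r0 t; rewrite (is_derive1D (dVb r)).
have [eU edU] := U'e t.
have [br|rb] := ltP b r.
  have [U't dU't] := U'0 _ (lnb _ (ltW br)).
  have -> : 'D_(1 : R) V (b - r) = 0.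
    apply: (@derive_locally_cst _ _ 0); near=> s; apply: V0.
    by apply/ltW; near: s; apply: lt_nbhsl; rewrite subr_lt0.
  rewrite V0 ?subr_le0 ?(ltW br)// oppr0 mulr0.
  move: eU edU; rewrite U't dU't; have := weight_gt0 delta a t; nra.
have rb' : 0 <= b - r <= b by rewrite subr_ge0 rb lerBlDr lerDl ltW.
have [] := Ve _ rb'; rewrite subKr opprK => eV edV.
have tN : t <= N.
  rewrite /t; have : ln r <= 2 * N by rewrite -[leRHS]expRK ler_ln// posrE.
  lra.
have wt : weight delta a N <= weight delta a t.
  by apply: weight_decreasing => //; rewrite (ltW a0).
have e'b : 2 * b * e' = e / 2 * weight delta a N.
  by rewrite /e' mulrC divfK// mulf_neq0// gt_eqF.
have ew : e / 2 * weight delta a N <= e / 2 * weight delta a t by rewrite ler_pM2l.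
have WE : W r = U' t by rewrite /W rad_gt0.
have dWE : 2 * r * dW r = dU' t.
  by rewrite /dW rad_gt0// mulrC divfK// mulf_neq0// gt_eqF.
split.
  rewrite -(subrK (U' t) (V _)) -addrA (le_trans (ler_normD _ _))//.
  rewrite -WE in eU *; nra.
rewrite -(subrK (dU' t) (2 * r * _)) -addrA (le_trans (ler_normD _ _))//.
rewrite -{1}dWE -mulrBr normrM (gtr0_norm (x := 2 * r)); last by rewrite mulr_gt0.
have -> : `|- 'D_(1 : R) V (b - r) - dW r| = `|'D_(1 : R) V (b - r) + dW r|.
  by rewrite -opprD normrN.
have : 2 * r * `|'D_(1 : R) V (b - r) + dW r| <= 2 * b * e'.
  by apply: ler_pM => //; [rewrite mulr_ge0 ?(ltW r0)|rewrite ler_pM2l].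
lra.
Unshelve. all: by end_near. Qed.

End approximation.

(** * Integration on R^n *)

Section measurability.
Context {R : realType}.

Lemma rV_norm_le n (x : 'rV[R]_n) (e : R) : 0 <= e ->
  (forall i, `|x ord0 i| <= e) -> `|x| <= e.
Proof.
move=> e0 xe; have -> : `|x| = mx_norm x by [].
rewrite mx_normrE; apply/bigmax_leP; split => //.
by move=> [i j] _ /=; rewrite (ord1 i).
Qed.

Lemma coord_norm_le n (x : 'rV[R]_n) i : `|x ord0 i| <= `|x|.
Proof.
have /mapP[j Hj ->] : `|x ord0 i| \in [seq `|x k.1 k.2| | k : 'I_1 * 'I_n].
  by apply/mapP; exists (ord0, i) => //=; rewrite mem_enum.
have -> : `|x| = mx_norm x by [].
by rewrite mx_normrE; apply/bigmax_geP; right => /=; exists j.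
Qed.

(** The sigma-algebra is generated by the coordinates, so open sets are avoided: [f] is the
    pointwise limit of its values at grid points of mesh [1 / (k + 1)]. Each approximation is
    constant on countably many cells, which are finite intersections of coordinate strips. *)
Lemma continuous_rV_measurable n (f : 'rV[R]_n -> R) : continuous f ->
  measurable_fun setT f.
Proof.
move=> cf.
pose step (k : nat) (x : 'rV[R]_n) : 'rV[int]_n :=
  \row_i Num.floor (k.+1%:R * x ord0 i).
pose emb (k : nat) (z : 'rV[int]_n) : 'rV[R]_n := \row_i ((z ord0 i)%:~R / k.+1%:R).
pose g k x := f (emb k (step k x)).
have mg k : measurable_fun setT (g k).
  move=> _ A mA; rewrite setTI.
  have -> : g k @^-1` A = \bigcup_(z in [set z : 'rV[int]_n | A (f (emb k z))])
      \bigcap_(i in [set: 'I_n]) ((fun x : 'rV[R]_n => x ord0 i) @^-1`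
        ((fun y : R => k.+1%:R * y) @^-1` [set y : R | Num.floor y = z ord0 i])).
    apply/seteqP; split=> x /=.
      by move=> Ax; exists (step k x) => // i _ /=; rewrite mxE.
    move=> [z Az] zx.
    rewrite /g (_ : step k x = z)//; apply/rowP => i; rewrite mxE.
    exact: (zx i).
  rewrite bigcup_mkcond; apply: countable_bigcupT_measurable; first exact: countableP.
  move=> z; case: ifP => // _.
  apply: fin_bigcap_measurable => // i _.
  rewrite -[X in measurable X]setTI; apply: measurable_coord => //.
  rewrite -[X in measurable X]setTI; apply: (measurable_funM _ _) => //.
  have -> : [set y : R | Num.floor y = z ord0 i] = `[(z ord0 i)%:~R, (z ord0 i + 1)%:~R[%classic.
    apply/seteqP; split => y /=; rewrite in_itv/=.
      by move=> <-; exact: floor_itv.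
    by move/floor_def.
  exact: measurable_itv.
apply: (measurable_fun_cvg mg) => x _.
rewrite /g; apply: (@cvg_comp _ _ _ (fun k => emb k (step k x)) f _ (nbhs x)); last exact: cf.
apply/cvgrPdist_le => e e0.
near=> k.
apply: rV_norm_le; first exact: ltW.
move=> i; rewrite !mxE.
have k0 : 0 < k.+1%:R :> R by rewrite ltr0n.
have /andP[h1 h2] := floor_itv (k.+1%:R * x ord0 i).
rewrite intrD in h2.
have -> : x ord0 i - (Num.floor (k.+1%:R * x ord0 i))%:~R / k.+1%:R =
  (k.+1%:R * x ord0 i - (Num.floor (k.+1%:R * x ord0 i))%:~R) / k.+1%:R.
  by rewrite mulrBl mulrAC divff ?mul1r// gt_eqF.
rewrite ger0_norm; last by rewrite divr_ge0 ?subr_ge0// ltW.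
rewrite ler_pdivrMr//.
apply: (@le_trans _ _ 1); first lra.
rewrite mulrC -ler_pdivrMr// div1r -natr1.
have : e^-1 <= k%:R by near: k; exact: nbhs_infty_ger.
lra.
Unshelve. all: by end_near. Qed.

(** A directional derivative depends only on the restriction to a line. This carries partial
    derivatives on R^(n+1) over to slices in R^n or R. *)
Lemma is_derive_line (V W : normedModType R) (f : V -> R) (f' : W -> R)
    (a v : V) (a' v' : W) (d : R) :
  (forall s : R, f (s *: v + a) = f' (s *: v' + a')) ->
  is_derive a v f d -> is_derive a' v' f' d.
Proof.
move=> ff'.
have E : (fun h : R => h^-1 *: ((f \o shift a) (h *: v) - f a)) =
         (fun h : R => h^-1 *: ((f' \o shift a') (h *: v') - f' a')).
  apply/funext => h /=; rewrite ff'; congr (_ *: (_ - _)).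
  by have := ff' 0; rewrite !scale0r !add0r.
by move=> [df dE]; split; [rewrite /derivable -E|rewrite /derive -E].
Qed.

Lemma rV_cons_slice n (a s : R) (e y : 'rV[R]_n) :
  s *: rV_cons (0, e) + rV_cons (a, y) = rV_cons (a, s *: e + y).
Proof.
apply/rowP => i; case: (unliftP ord0 i) => [j|] ->.
  by rewrite [LHS]mxE [X in X + _]mxE !rV_cons_lift/= [RHS]mxE [X in _ = X + _]mxE.
by rewrite [LHS]mxE [X in X + _]mxE !rV_cons0/= mulr0 add0r.
Qed.

Lemma rV_cons_slice0 n (a s : R) (y : 'rV[R]_n) :
  s *: rV_cons (1, 0) + rV_cons (a, y) = rV_cons (s *: (1 : R) + a, y).
Proof.
apply/rowP => i; case: (unliftP ord0 i) => [j|] ->.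
  by rewrite [LHS]mxE [X in X + _]mxE !rV_cons_lift/= mxE mulr0 add0r.
by rewrite [LHS]mxE [X in X + _]mxE !rV_cons0.
Qed.

Lemma delta_lift n (j : 'I_n) :
  delta_mx ord0 (lift ord0 j) = rV_cons (0, delta_mx ord0 j) :> 'rV[R]_n.+1.
Proof.
apply/rowP => i; rewrite mxE eqxx/=; case: (unliftP ord0 i) => [k|] ->.
  by rewrite rV_cons_lift/= mxE eqxx/= (inj_eq (@lift_inj _ ord0)).
by rewrite rV_cons0.
Qed.

Lemma delta_ord0 n : delta_mx ord0 ord0 = rV_cons (1, 0) :> 'rV[R]_n.+1.
Proof.
apply/rowP => i; rewrite mxE eqxx/=; case: (unliftP ord0 i) => [k|] ->.
  by rewrite rV_cons_lift/= mxE.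
by rewrite rV_cons0.
Qed.

Local Notation leb := (@lebesgue_measure R).

Lemma measurable_rV_cons_leb n :
  measurable_fun [set: (measurableTypeR R * 'rV[R]_n)%type] (@rV_cons R n).
Proof. exact: measurable_rV_cons. Qed.

Local Open Scope ereal_scope.

Lemma ge0_integral_rV_cons n (f : 'rV[R]_n.+1 -> \bar R) :
  measurable_fun setT f -> (forall x, 0 <= f x) ->
  \int[lebesgue_rV R n.+1]_x f x =
  \int[leb]_a \int[lebesgue_rV R n]_y f (rV_cons (a, y)).
Proof.
move=> mf f0.
have := @ge0_integral_pushforward _ _ (measurableTypeR R * 'rV[R]_n)%type 'rV[R]_n.+1 R (@rV_cons R n) (@measurable_rV_cons_leb n)
  (leb \x lebesgue_rV R n) setT f measurableT mf (fun x _ => f0 x).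
rewrite preimage_setT => H; etransitivity; first exact: H.
rewrite fubini_tonelli1//=.
exact: (measurableT_comp mf (@measurable_rV_cons_leb n)).
Qed.

Lemma integrable_rV_cons n (f : 'rV[R]_n.+1 -> \bar R) :
  (lebesgue_rV R n.+1).-integrable setT f ->
  (leb \x lebesgue_rV R n).-integrable setT (f \o @rV_cons R n).
Proof.
move=> /integrableP[mf foo]; apply/integrableP; split.
  exact: (measurableT_comp mf (@measurable_rV_cons_leb n)).
rewrite fubini_tonelli1//=; last first.
  exact: (measurableT_comp (@abse_measurable R setT) (measurableT_comp mf (@measurable_rV_cons_leb n))).
move: foo; rewrite ge0_integral_rV_cons//.
exact: (measurableT_comp (@abse_measurable R setT) mf).
Qed.

Lemma integral_rV_cons n (f : 'rV[R]_n.+1 -> \bar R) :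
  (lebesgue_rV R n.+1).-integrable setT f ->
  \int[lebesgue_rV R n.+1]_x f x =
  \int[leb \x lebesgue_rV R n]_z f (rV_cons z).
Proof.
move=> fi; have [mf _] := integrableP _ _ _ fi.
have := @integral_pushforward _ _ (measurableTypeR R * 'rV[R]_n)%type 'rV[R]_n.+1 R (@rV_cons R n) (@measurable_rV_cons_leb n)
  (leb \x lebesgue_rV R n) setT f mf.
rewrite preimage_setT => H; etransitivity; first apply: H => //.
  exact: integrable_rV_cons.
by [].
Qed.

(** Tonelli, one coordinate at a time: fixing the first coordinate [a] multiplies the constant by
    [m a], so [c] is generalised in the induction. *)
Lemma prod_dominated_integral n (m : R -> R) (K c : R)
    (f : 'rV[R]_n -> \bar R) :
  measurable_fun setT m -> (forall s, 0 <= m s)%R -> (0 <= c)%R -> (0 <= K)%R ->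
  \int[leb]_s (m s)%:E <= K%:E ->
  measurable_fun setT f -> (forall x, 0 <= f x) ->
  (forall x : 'rV[R]_n, (forall i : 'I_n, x ord0 i != 0%R) -> f x <= (c * \prod_(i < n) m (x ord0 i))%:E) ->
  \int[lebesgue_rV R n]_x f x <= (c * K ^+ n)%:E.
Proof.
move=> mm m0 + K0 mK; elim: n c f => [|n IH] c f c0 mf f0 fm.
  have -> : \int[lebesgue_rV R 0]_x f x = \int[\d_(0%R : 'rV[R]_0)]_x f x by [].
  rewrite integral_dirac// diracT mul1e expr0 mulr1.
  by apply: (le_trans (fm _ _)) => [[]//|]; rewrite big_ord0 mulr1.
rewrite ge0_integral_rV_cons//.
have mfc : measurable_fun setT (f \o @rV_cons R n).
  exact: (measurableT_comp mf (@measurable_rV_cons_leb n)).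
apply: (@le_trans _ _ (\int[leb]_a (c * K ^+ n * m a)%:E)).
  apply: ae_ge0_le_integral => //.
  - by move=> a _; apply: integral_ge0.
  - exact: (@measurable_fun_fubini_tonelli_F _ _ _ _ R (lebesgue_rV R n) (f \o @rV_cons R n) mfc (fun=> f0 _)).
  - by move=> a _; rewrite lee_fin !mulr_ge0// exprn_ge0.
  - by apply/measurable_EFinP; exact: measurable_funM.
  (* The pointwise bound says nothing when the first coordinate is 0, which is a null set of values
     [a]. *)
  exists [set 0%R]; split => //; first exact: lebesgue_measure_set1.
  move=> a /= /not_implyP[_]; apply: contra_notP => /eqP a0.
  rewrite mulrAC; apply: IH.
  - by rewrite mulr_ge0.
  - exact: (measurableT_comp mfc (measurable_pair1 a)).
  - by [].
  move=> y y0; apply: (le_trans (fm _ _)).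
    by move=> i; case: (unliftP ord0 i) => [j|] ->; rewrite ?rV_cons_lift ?rV_cons0.
  rewrite big_ord_recl rV_cons0/= mulrA.
  by under eq_bigr do rewrite rV_cons_lift.
rewrite exprSr mulrA.
under eq_integral do rewrite EFinM.
rewrite ge0_integralZl//; last 3 first.
- exact/measurable_EFinP.
- by move=> a _; rewrite lee_fin.
- by rewrite lee_fin mulr_ge0// exprn_ge0.
by rewrite [leRHS]EFinM lee_wpmul2l// lee_fin mulr_ge0// exprn_ge0.
Qed.

Lemma integral_derive_compact (h g : R -> R) (B : R) : (0 <= B)%R ->
  (forall x : R, is_derive x (1%R : R) h (g x)) -> continuous g ->
  (forall x, (B < `|x|)%R -> h x = 0%R /\ g x = 0%R) ->
  \int[leb]_x (g x)%:E = 0.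
Proof.
move=> B0 hg cg hB.
have E : \int[leb]_x (g x)%:E = \int[leb]_(x in `[(- (B + 1))%R, (B + 1)%R]) (g x)%:E.
  rewrite [RHS]integral_mkcond; apply: eq_integral => x _.
  rewrite patchE; case: ifPn => //; rewrite notin_setE/= in_itv/= => /negP xB.
  have [//|_ ->//] := hB x _.
  rewrite ltNge; apply: contra xB; rewrite ler_norml => /andP[h1 h2].
  by apply/andP; split; lra.
have ch (x : R) : {for x, continuous h} by exact: is_derive_continuous (hg x).
rewrite E (@continuous_FTC2 _ _ h) => //.
- have h1 : (B < `|B + 1|)%R by rewrite gtr0_norm; lra.
  have h2 : (B < `|- (B + 1)|)%R by rewrite normrN.
  by rewrite (hB _ h1).1 (hB _ h2).1 subee.
- lra.
- exact: continuous_subspaceT.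
- split => [x _||].
  + by have [] := hg x.
  + exact/cvg_at_right_filter/ch.
  + exact/cvg_at_left_filter/ch.
- by move=> x _; rewrite (is_derive1E (hg x)).
Qed.

End measurability.

(** * An integrable kernel on the line *)

Section majorant.
Context {R : realType}.
Local Notation leb := (@lebesgue_measure R).

(* The primitive of this kernel on the half-lines is
   -/+ 4 / c * (1 + |s|^c)^-1. *)
Definition kernel (c s : R) : R :=
  4 * expR (- ln `|s|) * expR (c * ln `|s|) * ((1 + expR (c * ln `|s|))^-1 * (1 + expR (c * ln `|s|))^-1).

Lemma kernel_gt0 c s : 0 < kernel c s.
Proof.
have H : 0 < 1 + expR (c * ln `|s|) by rewrite addr_gt0// expR_gt0.
by rewrite /kernel; apply: mulr_gt0; apply: mulr_gt0; rewrite ?invr_gt0 ?mulr_gt0 ?expR_gt0.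
Qed.

Lemma norm_sign_mul (e s : R) : 0 < e * s -> e = 1 \/ e = -1 -> `|s| = e * s.
Proof.
move=> es [E|E]; rewrite {}E in es *.
  by rewrite mul1r in es *; exact: gtr0_norm.
by rewrite mulN1r oppr_gt0 in es; rewrite mulN1r ltr0_norm.
Qed.

Lemma continuous_expR_comp (f : R -> R) : continuous f -> continuous (fun s => expR (f s)).
Proof. by move=> cf; apply: (cts_compT cf); exact: continuous_expR. Qed.

Lemma continuous_kernel_ln c : continuous (fun t : R =>
  4 * expR (- t) * expR (c * t) * ((1 + expR (c * t))^-1 * (1 + expR (c * t))^-1)).
Proof.
have c1 : continuous (fun t : R => expR (- t)).
  by apply: continuous_expR_comp => t; exact: continuousN.
have c2 : continuous (fun t : R => expR (c * t)).
  apply: continuous_expR_comp => t.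
  by have := @cts_affine R c 0 t; under eq_fun do rewrite addr0.
have c3 : continuous (fun t : R => (1 + expR (c * t))^-1).
  move=> t; apply: (@ctsV _ (fun t : R => 1 + expR (c * t))).
    by rewrite gt_eqF// addr_gt0// expR_gt0.
  by apply: ctsD; [exact: cvg_cst|exact: c2].
apply: ctsMT; last exact: ctsMT.
by apply: ctsMT => //; apply: ctsMT => //; exact: cts_cstT.
Qed.

Lemma measurable_kernel c : measurable_fun setT (kernel c).
Proof.
apply: (@measurableT_comp _ _ _ _ _ _ (fun t : R =>
  4 * expR (- t) * expR (c * t) * ((1 + expR (c * t))^-1 * (1 + expR (c * t))^-1))
  _ (fun s : R => ln `|s|)).
  by apply: continuous_measurable_fun; exact: continuous_kernel_ln.
by apply: measurableT_comp; [exact: measurable_ln|exact: normr_measurable].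
Qed.

Local Open Scope ereal_scope.

(** The sign [e] treats the two half-lines together, with [|s| = e s]. The primitive [P] takes its
    values between 0 and [-4 e / c], so its increment is bounded uniformly in [a] and [b]. *)
Lemma integral_kernel_itv (c e a b : R) : (0 < c)%R -> (a < b)%R ->
  e = 1%R \/ e = (-1)%R -> (forall s, a <= s <= b -> 0 < e * s)%R ->
  \int[leb]_(s in `[a, b]) (kernel c s)%:E <= (4 / c)%:E.
Proof.
move=> c0 ab e1 es.
have ee : (e * e = 1)%R by case: e1 => ->; ring.
pose P (s : R) : R := (- (e * (4 / c)) * (1 + expR (c * ln (e * s)))^-1)%R.
have dP (s : R) : (a <= s <= b)%R -> is_derive s (1%R : R) P (kernel c s).
  move=> sab; have es0 := es _ sab.
  have d1 := isdZ c (isd_ln (f := fun s => (e * s)%R) es0 (isdZ e (isd_id s))).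
  have d2 := isdD (isd_cst 1 s) (isd_expR d1).
  have nz : (1 + expR (c * ln (e * s)) != 0)%R by rewrite gt_eqF// addr_gt0// expR_gt0.
  have d3 := is_deriveV (f := fun s : R => (1 + expR (c * ln (e * s)))%R) nz d2.
  apply: (is_derive_eq (isdZ (- (e * (4 / c))) d3)).
  have /andP[e0 s0] : (e != 0%R) && (s != 0%R) by rewrite -negb_or -mulf_eq0 gt_eqF.
  rewrite /kernel (norm_sign_mul es0 e1) [expR (- ln _)]expRN lnK ?posrE//.
  rewrite /GRing.scale/=.
  transitivity ((e * e) * (4 * expR (c * ln (e * s)) / (e * s) * (1 + expR (c * ln (e * s))) ^- 2))%R.
    by field; do ?[apply/andP; split]; rewrite // gt_eqF.
  by rewrite ee; field; do ?[apply/andP; split].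
have P01 s : (0 <= (1 + expR (c * ln (e * s)))^-1 <= 1)%R.
  rewrite invr_ge0 invf_le1 ?addr_gt0 ?expR_gt0// lerDl expR_ge0 andbT.
  by rewrite addr_ge0// expR_ge0.
have cP (s : R) : (a <= s <= b)%R -> {for s, continuous P}.
  by move=> sab; exact: is_derive_continuous (dP _ sab).
rewrite (@continuous_FTC2 _ _ P) => //.
- rewrite -EFinB lee_fin /P.
  have /andP[h1 h2] := P01 a; have /andP[h3 h4] := P01 b.
  have c4 : (0 < 4 / c)%R by rewrite divr_gt0.
  by case: e1 => E; rewrite E in h1 h2 h3 h4 *; nra.
- apply: continuous_in_subspaceT => s; rewrite inE/= in_itv/= => /es es0.
  have s0 : (0 < `|s|)%R by rewrite (norm_sign_mul es0 e1).
  have H : {for (s : R), continuous (fun y : R => ln `|y|)}.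
    exact: (cts_comp (@norm_continuous _ R (s : R)) (continuous_ln s0)).
  exact: (cts_comp H (@continuous_kernel_ln c (ln `|s|))).
- split => [s sab||].
  + by have [] : is_derive s (1%R : R) P (kernel c s) by apply: dP; rewrite !(itvP sab).
  + by apply/cvg_at_right_filter/cP; rewrite lexx ltW.
  + by apply/cvg_at_left_filter/cP; rewrite lexx ltW.
- by move=> s sab; rewrite (is_derive1E (dP s _))// !(itvP sab).
Qed.

Lemma integral_kernel (c : R) : (0 < c)%R ->
  \int[leb]_s (kernel c s)%:E <= (8 / c)%:E.
Proof.
move=> c0.
have mk : measurable_fun [set: measurableTypeR R] (EFin \o kernel c).
  by apply/measurable_EFinP; exact: measurable_kernel.
(* [A k] and its mirror image [B k] exhaust the line minus 0. The end [k + 2] makes the interval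
   nondegenerate already for [k = 0]. *)
pose A k : set (measurableTypeR R) := `[((k.+1%:R : R)^-1)%R, (k.+2%:R : R)%R]%classic.
pose B k : set (measurableTypeR R) := `[(- (k.+2%:R : R))%R, (- (k.+1%:R : R)^-1)%R]%classic.
pose F k : set (measurableTypeR R) := A k `|` B k.
have k1 k : (0 < (k.+1%:R^-1 : R))%R by rewrite invr_gt0 ltr0n.
have k2 k : ((k.+1%:R^-1 : R) < k.+2%:R)%R.
  by rewrite (@le_lt_trans _ _ 1%R) ?ltr1n// invf_le1// ?ler1n ?ltr0n.
have mF k : measurable (F k).
  by apply: measurableU; exact: measurable_itv.
have ndF : nondecreasing_seq F.
  apply/nondecreasing_seqP => k; rewrite subsetEset => s.
  have h1 : ((k.+2%:R^-1 : R) <= k.+1%:R^-1)%R by rewrite lef_pV2 ?posrE// ler_nat.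
  have h2 : ((k.+2%:R : R) <= k.+3%:R)%R by rewrite ler_nat.
  move=> [|]; rewrite /A /B /= in_itv/= => /andP[s1 s2]; [left|right];
    rewrite /A /B /= in_itv/=.
    by rewrite (le_trans h1 s1) (le_trans s2 h2).
  by rewrite (le_trans _ s1) ?lerN2// (le_trans s2)// lerN2.
have UF : \bigcup_k F k = setT `\` [set (0%R : measurableTypeR R)].
  apply/seteqP; split => s /=.
    move=> [k _] []; rewrite /A /B /= in_itv/= => /andP[h1 h2]; split => // s0.
      by move: h1; rewrite s0 leNgt k1.
    by move: h2; rewrite s0 oppr_ge0 leNgt k1.
  move=> [_ /eqP s0].
  have ns : (0 < `|s : R|)%R by rewrite normr_gt0.
  pose k := maxn (Num.truncn `|s : R|) (Num.truncn (`|s : R|^-1)).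
  have h1 : (`|s : R| <= k.+2%:R)%R.
    have /andP[_ /ltW h] := truncn_itv (ltW ns); apply: (le_trans h).
    by rewrite ler_nat; apply: (@leq_trans k.+1) => //; rewrite ltnS leq_maxl.
  have h2 : (k.+1%:R^-1 <= `|s : R|)%R.
    rewrite -[leRHS]invrK lef_pV2 ?posrE ?invr_gt0 ?ltr0n//.
    have i0 : (0 <= `|s : R|^-1)%R by rewrite invr_ge0.
    have /andP[_ /ltW h] := truncn_itv i0; apply: (le_trans h).
    by rewrite ler_nat ltnS leq_maxr.
  exists k => //; have [s1|s1] := leP 0%R (s : R).
    by left; rewrite /A/= in_itv/=; rewrite ger0_norm// in h1 h2; rewrite h1 h2.
  by right; rewrite /B/= in_itv/=; rewrite ltr0_norm// in h1 h2; rewrite lerNl h1/= lerNr.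
rewrite (@ge0_negligible_integral _ _ _ leb setT [set 0%R])//; last 2 first.
- by move=> s _; rewrite lee_fin ltW// kernel_gt0.
- exact: lebesgue_measure_set1.
rewrite -UF.
have cvg := @ge0_nondecreasing_set_cvg_integral _ (measurableTypeR R) R F (EFin \o kernel c) leb ndF mF.
apply: (@closed_cvg _ _ \oo _ (fun k => \int[leb]_(x in F k) (kernel c x)%:E) [set y | y <= (8 / c)%:E]).
- exact: closed_ereal_ge_ereal.
- apply: nearW => k /=.
  rewrite ge0_integral_setU//=.
  + have := @integral_kernel_itv c 1 _ _ c0 (k2 k) (or_introl erefl).
    have := @integral_kernel_itv c (-1) (- k.+2%:R) (- k.+1%:R^-1) c0.
    rewrite ltrN2 => /(_ (k2 k) (or_intror erefl)) HB HA.
    have -> : ((8 / c)%:E = (4 / c)%:E + (4 / c)%:E) by rewrite -EFinD; congr EFin; field; rewrite gt_eqF.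
    apply: leeD; [apply: HA|apply: HB] => s /andP[s1 s2].
      by rewrite mul1r (lt_le_trans (k1 k)).
    by rewrite mulN1r oppr_gt0 (le_lt_trans s2)// oppr_lt0 k1.
  + exact: measurable_itv.
  + exact: measurable_itv.
  + exact: measurable_funTS.
  + by move=> s _; rewrite lee_fin ltW// kernel_gt0.
  + apply/disj_setPS => s []; rewrite /A /B /= !in_itv/= => /andP[h1 _] /andP[_ h2].
    have h : ((k.+1%:R : R)^-1 <= - (k.+1%:R : R)^-1)%R := le_trans h1 h2.
    by have := lt_le_trans (k1 k) h; rewrite oppr_gt0 ltNge (ltW (k1 k)).
- apply: cvg.
  + by move=> k; exact: measurable_funTS.
  + by move=> k s _; rewrite lee_fin ltW// kernel_gt0.
Qed.

End majorant.

(** * Integrability of radial weights and the divergence theorem *)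

Section integrability.
Context {R : realType}.

Lemma nonexpansive_continuous (V W : normedModType R) (f : V -> W) :
  (forall x y, `|f x - f y| <= `|x - y|) -> continuous f.
Proof.
move=> fL x; apply/cvgrPdist_le => e e0; near=> z; apply: (le_trans (fL x z)).
near: z; move: e e0; apply/cvgrPdist_le; exact: cvg_id.
Unshelve. all: by end_near. Qed.

Local Notation leb := (@lebesgue_measure R).

Definition logr n (x : 'rV[R]_n) : R := ln (sqn x) / 2.

(** Monotonicity of the weight reduces to [t = ln |s|]. With [E = |s|^c] the claim is then
    [min(E, 1/E) <= 4 E / (1 + E)^2], which explains the factor 4 in [kernel]. *)
Lemma weight_kernel (c t s : R) : 0 < c <= 1 -> s != 0 -> ln `|s| <= t ->
  weight 1 c t <= kernel c s.
Proof.
move=> /andP[c0 c1] s0 st.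
apply: (le_trans (y := weight 1 c (ln `|s|))).
  by apply: weight_decreasing => //; rewrite ltW.
set r := ln `|s|; rewrite /weight /kernel -/r.
have -> : expR (-1 * r - c * `|r|) = expR (- r) * expR (- (c * `|r|)).
  by rewrite -expRD mulN1r.
rewrite -!mulrA [leRHS]mulrCA ler_pM2l ?expR_gt0//.
set E := expR (c * r).
have E0 : 0 < E := expR_gt0 _.
have F0 : 0 < 1 + E by lra.
rewrite mulrA -ler_pdivrMr ?mulr_gt0 ?invr_gt0//.
rewrite -invrM ?unitfE ?gt_eqF// invrK.
have [r0|r0] := leP 0 r.
  rewrite ger0_norm// expRN -/E ler_pdivrMl//.
  have E1 : 1 <= E by rewrite -expR0 ler_expR mulr_ge0// ltW.
  nra.
rewrite ltr0_norm// mulrN opprK -/E.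
have E1 : E <= 1 by rewrite -[leRHS]expR0 ler_expR mulr_ge0_le0// ltW.
nra.
Qed.

Lemma ln_coord_le n (x : 'rV[R]_n) i : x ord0 i != 0 -> ln `|x ord0 i| <= logr x.
Proof.
move=> xi; rewrite /logr ler_pdivlMr// mulr_natr -lnXn ?normr_gt0//.
rewrite ler_ln ?posrE ?exprn_gt0 ?normr_gt0//.
  by rewrite real_normK ?num_real// coord_le_sqn.
by rewrite (lt_le_trans _ (coord_le_sqn x i))// lt_def sqrf_eq0 xi sqr_ge0.
Qed.

(** The weight of exponents [(n, c)] is the [n]-th power of that of exponents [(1, c / n)], and each
    factor can be compared with a different coordinate because [|x_i| <= |x|]. *)
Lemma weight_prod n (c : R) (x : 'rV[R]_n) : 0 < c <= n%:R ->
  (forall i, x ord0 i != 0) ->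
  weight n%:R c (logr x) <= \prod_(i < n) kernel (c / n%:R) (x ord0 i).
Proof.
move=> /andP[c0 cn] x0.
have n0 : 0 < n%:R :> R := lt_le_trans c0 cn.
have -> : weight n%:R c (logr x) = \prod_(i < n) weight 1 (c / n%:R) (logr x).
  rewrite prodr_const card_ord /weight -expRM_natl; congr expR.
  by field; rewrite gt_eqF.
apply: ler_prod => i _; rewrite ltW ?weight_gt0//=.
apply: weight_kernel => //; last exact: ln_coord_le.
by rewrite divr_gt0//= ler_pdivrMr// mul1r.
Qed.

Lemma coord_neq0 n (x : 'rV[R]_n) : (0 < n)%N -> (forall i, x ord0 i != 0) -> x != 0.
Proof.
by case: n x => // n x _ /(_ ord0); apply: contraNneq => ->; rewrite mxE.
Qed.

Local Open Scope ereal_scope.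

Lemma weight_integral n (c : R) : (0 < c <= n%:R)%R ->
  exists2 K : R, (0 <= K)%R & forall (C : R) (f : 'rV[R]_n -> \bar R),
    (0 <= C)%R -> measurable_fun setT f -> (forall x, 0 <= f x) ->
    (forall x, x != 0%R -> f x <= (C * weight n%:R c (logr x))%:E) ->
    \int[lebesgue_rV R n]_x f x <= (C * K)%:E.
Proof.
move=> cn; have /andP[c0 c1] := cn.
have n0 : (0 < n%:R :> R)%R := lt_le_trans c0 c1.
have cn0 : (0 < c / n%:R)%R by rewrite divr_gt0.
have K0 : (0 <= 8 / (c / n%:R))%R by rewrite divr_ge0// ltW.
exists ((8 / (c / n%:R)) ^+ n)%R => [|C f C0 mf f0 fC]; first exact: exprn_ge0.
apply: (@prod_dominated_integral _ n (kernel (c / n%:R))) => //.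
- exact: measurable_kernel.
- by move=> s; rewrite ltW// kernel_gt0.
- exact: integral_kernel.
move=> x x0; apply: (le_trans (fC x _)).
  by apply: coord_neq0 => //; rewrite -(ltr0n R).
by rewrite lee_fin ler_wpM2l// weight_prod.
Qed.

Lemma weight_integrable n (c C : R) (g : 'rV[R]_n -> R) : (0 < c <= n%:R)%R ->
  measurable_fun setT g ->
  (forall x, x != 0%R -> (`|g x| <= C * weight n%:R c (logr x))%R) ->
  (lebesgue_rV R n).-integrable setT (EFin \o g).
Proof.
move=> cn mg gC; have [K K0 KP] := weight_integral cn.
apply/integrableP; split; first exact/measurable_EFinP.
apply: (@le_lt_trans _ _ (`|C| * K)%:E); last exact: ltry.
apply: KP => //.
- apply: (measurableT_comp (@abse_measurable R setT)).
  exact/measurable_EFinP.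
- move=> x x0; rewrite /= lee_fin (le_trans (gC _ x0))//.
  by rewrite ler_wpM2r ?ler_norm// ltW// weight_gt0.
Qed.

Lemma sqn_norm_le n (x : 'rV[R]_n) : (sqn x <= n%:R * `|x| ^+ 2)%R.
Proof.
apply: (@le_trans _ _ (\sum_(i < n) `|x| ^+ 2)%R); last first.
  by rewrite sumr_const card_ord mulr_natl.
apply: ler_sum => i _; rewrite -expr2 -real_normK ?num_real//.
by rewrite ler_sqr ?nnegrE// coord_norm_le.
Qed.

(** On the ball containing the support, [ln |x| <= T], so the decreasing weight is at least its
    value at [T]; a multiple of it therefore dominates [g]. *)
Lemma bounded_support_integrable n (B C : R) (g : 'rV[R]_n -> R) : (0 < n)%N ->
  measurable_fun setT g -> (forall x, (`|g x| <= C)%R) ->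
  (forall x, (B < `|x|)%R -> g x = 0%R) ->
  (lebesgue_rV R n).-integrable setT (EFin \o g).
Proof.
move=> n0 mg gC gB.
have n1 : (0 < (1 : R) <= n%:R)%R by rewrite ltr01 ler1n.
have C0 : (0 <= C)%R := le_trans (normr_ge0 _) (gC 0%R).
pose T : R := (ln (n%:R * B ^+ 2 + 1) / 2)%R.
have w0 := weight_gt0 (n%:R : R) 1 T.
apply: (@weight_integrable n 1 (C / weight n%:R 1 T)%R) => // x x0.
have [Bx|xB] := ltP B `|x|%R.
  rewrite gB// normr0; apply: mulr_ge0; last by rewrite ltW// weight_gt0.
  by rewrite divr_ge0// ltW.
apply: (le_trans (gC x)); rewrite mulrAC ler_pdivlMr// ler_wpM2l//.
apply: weight_decreasing; first by rewrite ler01 ler1n.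
rewrite /logr ler_pM2r// ler_ln ?posrE ?sqn_gt0//.
  apply: (le_trans (sqn_norm_le x)); rewrite (@le_trans _ _ (n%:R * B ^+ 2)%R) ?lerDl//.
  by rewrite ler_pM2l ?ltr0n// ler_sqr ?nnegrE// (le_trans _ xB).
by rewrite ltr_wpDl// mulr_ge0// sqr_ge0.
Qed.

(** Fubini and induction on the dimension. If the derivative is in the first coordinate, that
    variable is integrated first and the one-dimensional case applies; otherwise every slice at
    fixed first coordinate falls under the induction hypothesis, with the same [B] and [C]. *)
Lemma integral_partial_compact n (i : 'I_n) (h g : 'rV[R]_n -> R) (B C : R) :
  (0 <= B)%R -> (forall x, is_derive x (delta_mx ord0 i) h (g x)) ->
  continuous g -> (forall x, (`|g x| <= C)%R) ->
  (forall x, (B < `|x|)%R -> h x = 0%R /\ g x = 0%R) ->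
  \int[lebesgue_rV R n]_x (g x)%:E = 0.
Proof.
move=> B0; elim: n i h g => [[]//|n IH] i h g hg cg gC hB.
have mg := continuous_rV_measurable cg.
have ig : (lebesgue_rV R n.+1).-integrable setT (EFin \o g).
  by apply: (@bounded_support_integrable n.+1 B C) => // x /hB[].
rewrite (@integral_rV_cons _ n (EFin \o g))//.
have igc := integrable_rV_cons ig.
have norm_cons (a : R) (y : 'rV[R]_n) : (`|a| <= `|rV_cons (a, y)|)%R /\ (`|y| <= `|rV_cons (a, y)|)%R.
  split; first by have := coord_norm_le (rV_cons (a, y)) ord0; rewrite rV_cons0.
  apply: rV_norm_le => // j.
  by have := coord_norm_le (rV_cons (a, y)) (lift ord0 j); rewrite rV_cons_lift.
have cons_cts (a b : R) (y z : 'rV[R]_n) :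
    (`|rV_cons (a, y) - rV_cons (b, z)| <= Num.max `|a - b| `|y - z|)%R.
  apply: rV_norm_le; first by rewrite le_max normr_ge0.
  move=> k; case: (unliftP ord0 k) => [j|] ->; rewrite [X in (`|X| <= _)%R]mxE [X in (`|_ + X| <= _)%R]mxE.
    rewrite !rV_cons_lift/= le_max; apply/orP; right.
    by have := coord_norm_le (y - z) j; rewrite !mxE.
  by rewrite !rV_cons0/= le_max lexx.
have cts1 (a : R) : continuous (fun y : 'rV[R]_n => rV_cons (a, y)).
  apply: nonexpansive_continuous => y z; apply: (le_trans (cons_cts _ _ _ _)).
  by rewrite subrr normr0 ge_max normr_ge0/=.
have cts2 (y : 'rV[R]_n) : continuous (fun a : R => rV_cons (a, y)).
  apply: nonexpansive_continuous => a b; apply: (le_trans (cons_cts _ _ _ _)).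
  by rewrite subrr normr0 ge_max normr_ge0 andbT.
move: (hg); case: (unliftP ord0 i) => [j|] -> hgi.
  rewrite -(integral12_prod_meas1 igc).
  transitivity (\int[leb]_a (0 : \bar R)); last exact: integral0.
  apply: eq_integral => a _.
  apply: (IH j (fun y => h (rV_cons (a : R, y))) (fun y => g (rV_cons (a : R, y)))).
  - move=> y; apply: is_derive_line (hgi (rV_cons (a, y))) => s.
    by rewrite delta_lift rV_cons_slice.
  - by move=> y; exact: (continuous_comp (@cts1 a y) (@cg _)).
  - by move=> y; exact: gC.
  - by move=> y By; apply: hB; apply: (lt_le_trans By); have [] := norm_cons a y.
rewrite -(integral21_prod_meas1 igc).
transitivity (\int[lebesgue_rV R n]_y (0 : \bar R)); last exact: integral0.
apply: eq_integral => y _.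
apply: (@integral_derive_compact _ (fun a => h (rV_cons (a, y))) (fun a => g (rV_cons (a, y))) B) => //.
- move=> a; apply: is_derive_line (hgi (rV_cons (a, y))) => s.
  by rewrite delta_ord0 rV_cons_slice0.
- by move=> a; exact: (continuous_comp (@cts2 y a) (@cg _)).
- by move=> a Ba; apply: hB; apply: (lt_le_trans Ba); have [] := norm_cons a y.
Qed.

End integrability.

(** * The homoclinic orbit *)

Section signed_power.
Context {R : realType}.
Implicit Types a b x y z : R.

Definition spow a x : R := Num.sg x * `|x| `^ a.

Lemma spow_gt0 a x : 0 < x -> spow a x = x `^ a.
Proof. by move=> x0; rewrite /spow gtr0_sg// mul1r gtr0_norm. Qed.

Lemma spow0 a : spow a 0 = 0.
Proof. by rewrite /spow sgr0 mul0r. Qed.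

Lemma spowN a x : spow a (- x) = - spow a x.
Proof. by rewrite /spow sgrN normrN mulNr. Qed.

Lemma spow_lt a : 0 < a -> {homo spow a : x y / x < y}.
Proof.
move=> a0.
have pos x : 0 < x -> 0 < spow a x by move=> x0; rewrite spow_gt0// powR_gt0.
have lt0 x y : 0 <= x -> x < y -> spow a x < spow a y.
  rewrite le_eqVlt => /predU1P[<- y0|x0 xy]; first by rewrite spow0 pos.
  rewrite !spow_gt0//; last exact: lt_trans xy.
  by apply: gt0_ltr_powR => //; rewrite nnegrE ltW// (lt_trans x0).
move=> x y xy; have [x0|x0] := leP 0 x; first exact: lt0.
have [y0|y0] := leP 0 y.
  apply: (@lt_le_trans _ _ 0).
    by rewrite -[x]opprK spowN oppr_lt0 pos// oppr_gt0.
  by move: y0; rewrite le_eqVlt => /predU1P[<-|/pos/ltW//]; rewrite spow0.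
by rewrite -[x]opprK -[y]opprK !(spowN a (- _)) ltrN2 lt0// ?oppr_ge0 ?ltrN2// ltW.
Qed.

Lemma spow_le a : 0 < a -> {homo spow a : x y / x <= y}.
Proof.
by move=> a0 x y; rewrite le_eqVlt => /predU1P[->//|/(spow_lt a0)/ltW].
Qed.

Lemma powR_cts a x : 0 < x -> {for x, continuous (fun y : R => y `^ a)}.
Proof. by move=> x0; exact: is_derive_continuous (is_derive1_powR a x0). Qed.

Lemma spow_cts a : 0 < a -> continuous (spow a).
Proof.
move=> a0.
have pos (x : R) : 0 < x -> {for x, continuous (spow a)}.
  move=> x0; have := powR_cts (a := a) x0; rewrite /prop_for /continuous_at (spow_gt0 a x0).
  apply: cvg_trans; apply: near_eq_cvg; near=> y; rewrite spow_gt0//.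
  by near: y; exact: lt_nbhsr.
move=> x; have [x0|x0|->] := ltgtP x 0; last 2 first.
- exact: pos.
- rewrite /continuous_at spow0; apply/cvgrPdist_lt => e e0; near=> y.
  rewrite sub0r normrN /spow normrM normr_sg.
  have [->|y0] := eqVneq y 0; first by rewrite mul0r.
  rewrite mul1r ger0_norm ?powR_ge0//.
  have -> : e = (e `^ a^-1) `^ a by rewrite -powRrM mulVf ?gt_eqF// powRr1// ltW.
  apply: gt0_ltr_powR; rewrite ?nnegrE ?powR_ge0//.
  near: y; have /cvgrPdist_lt /(_ (e `^ a^-1) (powR_gt0 _ e0)) := @cvg_id _ (nbhs (0 : R)).
  by apply: filterS => y /=; rewrite sub0r normrN.
have -> : spow a = (fun y : R => - spow a (- y)) by apply/funext => y; rewrite spowN opprK.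
have Nx : 0 < - x by rewrite oppr_gt0.
have cN : {for x, continuous (fun y : R => - y)} by exact: cvgN.
exact: (@continuousN _ _ _ _ _ (cts_comp cN (pos _ Nx))).
Unshelve. all: by end_near. Qed.

Lemma is_derive_normpow b x : 1 < b ->
  is_derive x (1 : R) (fun y : R => `|y| `^ b) (b * spow (b - 1) x).
Proof.
move=> b1.
have [x0|x0|->] := ltgtP x 0.
- have Nx : 0 < - x by rewrite oppr_gt0.
  apply: (is_derive_near (g := fun y : R => (- y) `^ b)).
    by near=> y; rewrite ltr0_norm//; near: y; exact: lt_nbhsl.
  have := isd_comp (isdN (isd_id x)) (is_derive1_powR b Nx).
  move=> H; apply: (is_derive_eq H).
  by rewrite -[X in spow _ X]opprK spowN spow_gt0//; ring.
- apply: (is_derive_near (g := fun y : R => y `^ b)).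
    by near=> y; rewrite gtr0_norm//; near: y; exact: lt_nbhsr.
  by apply: (is_derive_eq (is_derive1_powR b x0)); rewrite spow_gt0.
(* At 0 the slope function is [|y|^b / y], the signed power of exponent [b - 1 > 0], continuous with
   value 0. *)
apply/is_derive1_caratheodory; exists (spow (b - 1)); split.
- move=> z; rewrite normr0 powR0 ?gt_eqF//; last lra.
  have [->|z0] := eqVneq z 0; first by rewrite normr0 powR0 ?gt_eqF ?subr0 ?mulr0//; lra.
  by rewrite !subr0 /spow mulrAC -normrEsg mulr_powRB1//; lra.
- by apply: spow_cts; lra.
- by rewrite spow0 mulr0.
Unshelve. all: by end_near. Qed.

End signed_power.

(** * Scalar autonomous equations by separation of variables *)

Section autonomous.
Context {R : realType}.
Local Notation leb := (@lebesgue_measure R).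

Lemma derive_ge0_le (f df : R -> R) (a b : R) : a <= b ->
  (forall x : R, a <= x <= b -> is_derive x (1 : R) f (df x)) ->
  (forall x : R, a < x < b -> 0 <= df x) -> f a <= f b.
Proof.
rewrite le_eqVlt => /predU1P[->//|ab] fdf df0.
have [||c cab E] := @MVT _ f df a b ab.
- by move=> x xab; apply: fdf; rewrite !(itvP xab).
- by apply: continuous_in_subspaceT => x; rewrite inE/= in_itv/= => /fdf; exact: is_derive_continuous.
rewrite -subr_ge0 E mulr_ge0 ?subr_ge0 ?(ltW ab)// df0//.
Qed.

Lemma derive_gt0_lt (f df : R -> R) (a b : R) : a < b ->
  (forall x : R, a <= x <= b -> is_derive x (1 : R) f (df x)) ->
  (forall x : R, a < x < b -> 0 < df x) -> f a < f b.
Proof.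
move=> ab fdf df0.
have [||c cab E] := @MVT _ f df a b ab.
- by move=> x xab; apply: fdf; rewrite !(itvP xab).
- by apply: continuous_in_subspaceT => x; rewrite inE/= in_itv/= => /fdf; exact: is_derive_continuous.
rewrite -subr_gt0 E mulr_gt0 ?subr_gt0// df0//.
Qed.

(** [g] may be singular at both ends, so integrals start from the interior point [c], with the sign
    put by hand. Near a given [x] they are differences of integrals from some [a'] inside the
    interval, to which the fundamental theorem applies. *)
Lemma primitive_itv (g : R -> R) (a c b : R) : a < c < b ->
  (forall x : R, a < x < b -> {for x, continuous g}) ->
  exists T : R -> R, forall x : R, a < x < b -> is_derive x (1 : R) T (g x).
Proof.
move=> /andP[ac cb] cg.
pose T (x : R) : R := if c <= x then (\int[leb]_(t in `]c, x]) g t)%R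
  else (- \int[leb]_(t in `]x, c]) g t)%R.
exists T => x /andP[ax xb].
pose a' := (a + Num.min x c) / 2; pose b' := (b + Num.max x c) / 2.
have m1 : Num.min x c <= x /\ Num.min x c <= c by rewrite !ge_min !lexx orbT.
have m2 : x <= Num.max x c /\ c <= Num.max x c by rewrite !le_max !lexx orbT.
have am : a < Num.min x c by rewrite lt_min ax.
have bm : Num.max x c < b by rewrite gt_max xb.
have aa' : a < a' by rewrite /a'; lra.
have a'm : a' < Num.min x c by rewrite /a'; lra.
have bb' : b' < b by rewrite /b'; lra.
have b'm : Num.max x c < b' by rewrite /b'; lra.
have ig u : u <= b' -> leb.-integrable `[a', u] (EFin \o g).
  move=> ub; apply: continuous_compact_integrable; first exact: segment_compact.
  apply: continuous_in_subspaceT => y; rewrite inE/= in_itv/= => /andP[y1 y2].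
  by apply: cg; lra.
pose G (y : R) : R := (\int[leb]_(t in `[a', y]) g t)%R.
have TG y : a' < y -> y < b' -> T y = G y - G c.
  move=> a'y yb'; rewrite /T /G; case: ifPn => [cy|].
    rewrite (@Rintegral_itvB _ _ (BLeft a') (BRight y) c)//.
    - by apply: ig; exact: ltW.
    - by rewrite bnd_simp; lra.
  rewrite -ltNge => yc.
  rewrite -(@Rintegral_itvB _ _ (BLeft a') (BRight c) y) ?opprB//.
  - by apply: ig; lra.
  - by rewrite bnd_simp ltW.
  - by rewrite bnd_simp ltW.
have xab : a < x < b by rewrite ax xb.
have xb' : x < b' by lra.
have a'x : a' < x by lra.
have [dG GE] := @continuous_FTC1_closed _ g a' x b' xb' (ig _ (lexx _)) a'x (cg x xab).
apply: (is_derive_near (g := fun y => G y - G c)).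
  near=> y; apply: TG; near: y; [exact: lt_nbhsr|exact: lt_nbhsl].
have H : is_derive x (1 : R) G (g x) by constructor; [exact: dG|rewrite -derive1E; exact: GE].
by apply: (is_derive_eq (isdB H (isd_cst _ x))); rewrite subr0.
Unshelve. all: by end_near. Qed.

Lemma inverse_derivative (D : R -> Prop) (f df : R -> R) :
  (forall x, D x -> \forall y \near x, D y) ->
  (forall x : R, D x -> is_derive x (1 : R) f (df x) /\ df x != 0) ->
  (forall x y, D x -> D y -> f x = f y -> x = y) ->
  (forall y, exists2 x, D x & f x = y) ->
  exists g : R -> R, forall y : R,
    [/\ D (g y), f (g y) = y & is_derive y (1 : R) g (df (g y))^-1].
Proof.
move=> oD fdf injf surf.
have /choice[g gP] : forall y, exists x, D x /\ f x = y.
  by move=> y; have [x Dx fx] := surf y; exists x.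
exists g => y; have [Dg fg] := gP y; split => //.
have [fd fn0] := fdf _ Dg.
rewrite -{1}fg; apply: is_derive_inverse => //.
  near=> z; apply: injf; [by have [] := gP (f z)| |by have [] := gP (f z)].
  near: z; exact: oD.
near=> z; have Dz : D z by near: z; exact: oD.
exact: is_derive_continuous (fdf z Dz).1.
Unshelve. all: by end_near. Qed.

(** The solution is the inverse of the travel time [T], a primitive of [1 / h]. Since [h] is at most
    linear in the distance to either end, [T] diverges at least logarithmically there; hence it is
    onto R and the solution lives for all times. *)
Lemma autonomous_flow (a b C : R) (h : R -> R) : a < b ->
  (forall z : R, a < z < b -> {for z, continuous h} /\ 0 < h z) ->
  (forall z : R, a < z < b -> h z <= C * (z - a) /\ h z <= C * (b - z)) ->
  exists zeta : R -> R,
    (forall t : R, a < zeta t < b /\ is_derive t (1 : R) zeta (h (zeta t))) /\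
    (forall z : R, a < z < b -> exists t, zeta t = z).
Proof.
move=> ab hh hC.
pose c := (a + b) / 2.
have acb : a < c < b by rewrite /c; lra.
have /andP[ac cb] := acb.
have h0 z : a < z < b -> 0 < h z by move=> /hh[].
have C0 : 0 < C.
  have := h0 _ acb; have [h1 _] := hC _ acb => h2.
  by move: (lt_le_trans h2 h1); rewrite pmulr_lgt0// subr_gt0.
have [T dT] : exists T : R -> R, forall x : R, a < x < b -> is_derive x (1 : R) T (h x)^-1.
  apply: (primitive_itv acb) => x xab; apply: ctsV; first by rewrite gt_eqF// h0.
  by have [] := hh x xab.
have Tlt x y : a < x < b -> a < y < b -> x < y -> T x < T y.
  move=> /andP[ax xb] /andP[ay yb] xy.
  apply: (@derive_gt0_lt T (fun x => (h x)^-1)) => // z /andP[z1 z2].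
    by apply: dT; lra.
  by rewrite invr_gt0 h0//; lra.
have Tright z : c <= z -> z < b -> T c + (ln (b - c) - ln (b - z)) / C <= T z.
  move=> cz zb.
  have := @derive_ge0_le (fun z => T z + C^-1 * ln (- 1 * z + b))
    (fun z => (h z)^-1 + C^-1 * (-1 / (- 1 * z + b))) c z cz.
  have -> : -1 * c + b = b - c by ring.
  have -> : -1 * z + b = b - z by ring.
  have : forall x : R, c <= x <= z ->
    is_derive x (1 : R) (fun z => T z + C^-1 * ln (- 1 * z + b)) ((h x)^-1 + C^-1 * (-1 / (- 1 * x + b))).
    move=> x /andP[x1 x2]; apply: isdD; first by apply: dT; lra.
    by apply: isdZ; apply: isd_ln; [lra|exact: isd_affine].
  move=> H1 /(_ H1) H2.
  have : T c + C^-1 * ln (b - c) <= T z + C^-1 * ln (b - z).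
    apply: H2 => x /andP[x1 x2].
    have xab : a < x < b by lra.
    have [_ hb] := hC _ xab; have hx := h0 _ xab.
    have bx : 0 < b - x by lra.
    have -> : -1 * x + b = b - x by ring.
    rewrite mulN1r mulrN -invfM subr_ge0 lef_pV2 ?posrE ?mulr_gt0//.
  by rewrite !(mulrC C^-1) mulrBl; lra.
have Tleft z : a < z -> z <= c -> T z <= T c - (ln (c - a) - ln (z - a)) / C.
  move=> az zc.
  have := @derive_ge0_le (fun z => T z - C^-1 * ln (1 * z + - a))
    (fun z => (h z)^-1 - C^-1 * (1 / (1 * z + - a))) z c zc.
  have -> : 1 * c + - a = c - a by ring.
  have -> : 1 * z + - a = z - a by ring.
  have : forall x : R, z <= x <= c ->
    is_derive x (1 : R) (fun z => T z - C^-1 * ln (1 * z + - a)) ((h x)^-1 - C^-1 * (1 / (1 * x + - a))).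
    move=> x /andP[x1 x2]; apply: isdB; first by apply: dT; lra.
    by apply: isdZ; apply: isd_ln; [lra|exact: isd_affine].
  move=> H1 /(_ H1) H2.
  have : T z - C^-1 * ln (z - a) <= T c - C^-1 * ln (c - a).
    apply: H2 => x /andP[x1 x2].
    have xab : a < x < b by lra.
    have [hb _] := hC _ xab; have hx := h0 _ xab.
    have bx : 0 < x - a by lra.
    have -> : 1 * x + - a = x - a by ring.
    rewrite mul1r -invfM subr_ge0 lef_pV2 ?posrE ?mulr_gt0//.
  by rewrite !(mulrC C^-1) mulrBl; lra.
have surT y : exists2 x, a < x < b & T x = y.
  (* At points whose distance to an end is [e^(-M)] times that of [c], the logarithmic bounds move
     [T] away from [T c] by at least [M / C], more than [|y - T c|]. *)
  pose M := C * (`|y - T c| + 1).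
  have M0 : 0 < M by rewrite mulr_gt0// ltr_wpDl.
  have MC : M / C = `|y - T c| + 1 by rewrite /M mulrAC divff ?mul1r// gt_eqF.
  have e1 : expR (- M) < 1 by rewrite -[ltRHS]expR0 ltr_expR oppr_lt0.
  have e0 := expR_gt0 (- M).
  have ca : 0 < c - a by lra.
  have bc : 0 < b - c by lra.
  pose x1 := a + expR (- M) * (c - a); pose x2 := b - expR (- M) * (b - c).
  have x1a : a < x1 by rewrite /x1; nra.
  have x1c : x1 <= c by rewrite /x1; nra.
  have x2c : c <= x2 by rewrite /x2; nra.
  have x2b : x2 < b by rewrite /x2; nra.
  have yn := ler_norm (y - T c); have yn' := ler_norm (- (y - T c)); rewrite normrN in yn'.
  have T1 : T x1 <= y.
    apply: (le_trans (Tleft _ x1a x1c)).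
    have -> : ln (x1 - a) = - M + ln (c - a).
      by rewrite /x1 addrAC subrr add0r lnM ?posrE// expRK.
    have -> : ln (c - a) - (- M + ln (c - a)) = M by ring.
    by rewrite MC; lra.
  have T2 : y <= T x2.
    apply: le_trans (Tright _ x2c x2b).
    have -> : ln (b - x2) = - M + ln (b - c).
      by rewrite /x2 subKr lnM ?posrE// expRK.
    have -> : ln (b - c) - (- M + ln (b - c)) = M by ring.
    by rewrite MC; lra.
  have x12 : x1 <= x2 by lra.
  have [||x xin <-] := @IVT _ T x1 x2 y x12.
  - apply: continuous_in_subspaceT => x; rewrite inE/= in_itv/= => /andP[h1 h2].
    by apply: is_derive_continuous (dT x _); lra.
  - by rewrite ge_min T1 le_max T2 orbT.
  by exists x => //; move: xin; rewrite in_itv/= => /andP[h1 h2]; lra.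
have [||||zeta zP] := @inverse_derivative (fun x => a < x < b) T (fun x => (h x)^-1).
- move=> x /andP[ax xb]; near=> y; apply/andP; split; near: y; [exact: lt_nbhsr|exact: lt_nbhsl].
- by move=> x xab; split; [exact: dT|rewrite invr_eq0 gt_eqF// h0].
- move=> x y xab yab Txy; have [xy|yx|//] := ltgtP x y.
    by have := Tlt _ _ xab yab xy; rewrite Txy ltxx.
  by have := Tlt _ _ yab xab yx; rewrite Txy ltxx.
- by move=> y; have [x xab <-] := surT y; exists x.
exists zeta; split=> [t|z zab].
  by have [zt _ dz] := zP t; rewrite invrK in dz.
exists (T z); have [zt Tz _] := zP (T z).
have [h1|h1|//] := ltgtP (zeta (T z)) z.
  by have := Tlt _ _ zt zab h1; rewrite Tz ltxx.
by have := Tlt _ _ zab zt h1; rewrite Tz ltxx.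
Unshelve. all: by end_near. Qed.

End autonomous.

Section homoclinic.
Context {R : realType}.

Section energy.
Variables (p delta mu : R).
Definition psi (z : R) : R := spow (p - 1)^-1 z.

(* The conserved quantity is e^(p l) (energy zeta + e^((P1 - p) l) / P1
   + e^((P2 - p) l) / P2); the homoclinic orbit lies on its zero level. *)
Definition energy (z : R) : R :=
  ((p - 1) / p) * `|z| `^ (p / (p - 1)) - delta * z + mu / p.

Lemma psi_lt : 1 < p -> {homo psi : x y / x < y}.
Proof. by move=> p1; apply: spow_lt; rewrite invr_gt0 subr_gt0. Qed.

Lemma psi_continuous : 1 < p -> continuous psi.
Proof. by move=> p1; apply: spow_cts; rewrite invr_gt0 subr_gt0. Qed.

Lemma mul_psi z : 1 < p -> z * psi z = `|z| `^ (p / (p - 1)).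
Proof.
move=> p1; have p0 : 0 < p by lra.
have pm0 : 0 < p - 1 by lra.
rewrite /psi /spow mulrCA mulrA -normrEsg.
have E : (p - 1)^-1 = p / (p - 1) - 1 by field; rewrite gt_eqF.
by rewrite [in LHS]E mulr_powRB1// divr_gt0.
Qed.

Lemma psi_powR (d : R) : 1 < p -> 0 < d -> psi (d `^ (p - 1)) = d.
Proof.
move=> p1 d0; have pm0 : 0 < p - 1 by lra.
rewrite /psi spow_gt0 ?powR_gt0// -powRrM divff ?gt_eqF//.
by rewrite powRr1// ltW.
Qed.

Lemma is_derive_energy (z : R) : 1 < p ->
  is_derive z (1 : R) energy (psi z - delta).
Proof.
move=> p1; have p0 : 0 < p by lra.
have pm0 : 0 < p - 1 by lra.
have b1 : 1 < p / (p - 1) by rewrite ltr_pdivlMr//; lra.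
have H := isdD (isdB (isdZ ((p - 1) / p) (is_derive_normpow z b1)) (isdZ delta (isd_id z))) (isd_cst (mu / p) z).
apply: (is_derive_eq H); rewrite /psi.
have -> : p / (p - 1) - 1 = (p - 1)^-1 by field; rewrite gt_eqF.
by field; rewrite !gt_eqF.
Qed.

Let z0 := delta `^ (p - 1).

(** At its critical point [delta^(p-1)] the energy equals [(mu - delta^p) / p]; the Hardy threshold
    on [mu] is used here. *)
Lemma energy_center : 1 < p -> 0 < delta -> mu < delta `^ p -> energy z0 < 0.
Proof.
move=> p1 delta0 mu_lt; have p0 : 0 < p by lra.
rewrite /energy -mul_psi// psi_powR//.
have E : delta * z0 = delta `^ p.
  by rewrite /z0 mulr_powRB1//; exact: ltW.
rewrite (mulrC z0) E.
have -> : (p - 1) / p * delta `^ p - delta `^ p + mu / p = (mu - delta `^ p) / p.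
  by field; rewrite gt_eqF.
by rewrite pmulr_llt0 ?invr_gt0// subr_lt0.
Qed.

(** The derivative [psi z - delta] is negative before [z0] and positive after it. Starting from a
    negative value at [z0], the energy thus crosses 0 once on each side as soon as it is nonnegative
    somewhere on that side. *)
Lemma energy_zeros : 1 < p -> 0 < delta -> mu < delta `^ p -> exists z1 z2 : R, [/\ z1 < z0 < z2, energy z1 = 0,
  energy z2 = 0 & forall z, z1 < z < z2 -> energy z < 0].
Proof.
move=> p1 delta0 mu_lt; have p0 : 0 < p by lra.
have pm0 : 0 < p - 1 by lra.
have energy_cts (a b : R) : {within `[a, b], continuous energy}.
  by apply: continuous_subspaceT => z; exact: is_derive_continuous (is_derive_energy z p1).
have c0 := energy_center p1 delta0 mu_lt.
have z00 : 0 < z0 by rewrite powR_gt0.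
have dz0 : psi z0 = delta by exact: psi_powR.
have mun := ler_norm (- mu); rewrite normrN in mun.
have munp : 0 <= `|mu| / p by rewrite divr_ge0 ?normr_ge0// ltW.
have mup : - (`|mu| / p) <= mu / p by rewrite -mulNr ler_pM2r ?invr_gt0//; lra.
have pp : 0 < (p - 1) / p by rewrite divr_gt0.
(* At [-X] the linear term contributes [delta X = |mu| / p], which compensates [mu / p]. *)
pose X := `|mu| / p / delta.
have X0 : 0 <= X by rewrite divr_ge0// ltW.
have EX : 0 <= energy (- X).
  rewrite /energy mulrN opprK.
  have -> : delta * X = `|mu| / p by rewrite /X mulrC divfK// gt_eqF.
  have : 0 <= (p - 1) / p * `|- X| `^ (p / (p - 1)) by rewrite mulr_ge0 ?powR_ge0// ltW.
  lra.
(* The last summand makes [(p - 1) / p * m] exceed [delta + |mu| / p], which gives [energy Y >= 0]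
   once [Y >= 1]; the summand [1 + delta] gives [Y >= 1] and [Y > z0]. *)
pose m := 1 + delta + p / (p - 1) * (delta + `|mu| / p).
have pq : 0 <= p / (p - 1) * (delta + `|mu| / p).
  by rewrite mulr_ge0 ?addr_ge0 ?divr_ge0// ltW.
have m1 : 1 <= m by rewrite /m; lra.
have m0 : 0 < m by lra.
pose Y := m `^ (p - 1).
have Y1 : 1 <= Y.
  have := @ge0_ler_powR R (p - 1) (ltW pm0) 1 m.
  by rewrite powR1 !nnegrE ler01 (ltW m0) => /(_ isT isT m1).
have EY : 0 <= energy Y.
  rewrite /energy -mul_psi// psi_powR//.
  have h : (p - 1) / p * (Y * m) = Y * ((p - 1) / p * (1 + delta)) + Y * (delta + `|mu| / p).
    by rewrite /m; field; rewrite !gt_eqF.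
  have q0 : 0 <= Y * ((p - 1) / p * (1 + delta)).
    by apply: mulr_ge0; [lra|apply: mulr_ge0; lra].
  rewrite h; move: q0; set q := Y * ((p - 1) / p * _) => q0; rewrite mulrDr.
  have : `|mu| / p <= Y * (`|mu| / p) by rewrite ler_peMl.
  lra.
have z0Y : z0 < Y.
  rewrite /z0 /Y; apply: gt0_ltr_powR; rewrite ?nnegrE ?ltW//; rewrite /m; lra.
have [||z1 z1in Ez1] := @IVT _ energy (- X) z0 0 _ (energy_cts _ _).
- by lra.
- by rewrite ge_min (ltW c0) le_max EX orbT.
have [||z2 z2in Ez2] := @IVT _ energy z0 Y 0 _ (energy_cts _ _).
- exact: ltW.
- by rewrite ge_min (ltW c0) le_max EY orbT.
move: z1in z2in; rewrite !in_itv/= => /andP[_ z10] /andP[z20 _].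
have {}z10 : z1 < z0 by rewrite lt_neqAle z10 andbT; apply: contraTneq c0 => <-; rewrite Ez1 ltxx.
have {}z20 : z0 < z2 by rewrite lt_neqAle z20 andbT; apply: contraTneq c0 => ->; rewrite Ez2 ltxx.
exists z1, z2; split => //; first by rewrite z10.
move=> z /andP[z1z zz2]; have [zz0|z0z] := leP z z0.
  suff : energy z < energy z1 by rewrite Ez1.
  have := @derive_gt0_lt _ (fun z => - energy z) (fun z => - (psi z - delta)) z1 z z1z.
  rewrite ltrN2; apply => [x _|x /andP[_ xz]]; first exact/isdN/is_derive_energy.
  by rewrite oppr_gt0 subr_lt0 -dz0; apply: (psi_lt p1); exact: lt_le_trans zz0.
suff : energy z < energy z2 by rewrite Ez2.
have H := @derive_gt0_lt _ energy (fun z => psi z - delta) z z2 zz2.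
apply: H => [x _|x /andP[zx _]]; first exact: is_derive_energy.
by rewrite subr_gt0 -dz0; apply: (psi_lt p1); exact: lt_trans zx.
Qed.

End energy.

(** [K] increases from 0 to [+oo]; its logarithm is inverted rather than [K] itself, so that the
    inverse is defined on all of R. *)
Lemma exp_sum_inverse (A B P1 P2 : R) : 0 < A -> 0 < B -> 0 < P1 -> 0 < P2 ->
  let K l := expR (A * l) / P1 + expR (B * l) / P2 in
  let k l := A / P1 * expR (A * l) + B / P2 * expR (B * l) in
  exists L : R -> R, forall y : R,
    K (L y) = expR y /\ is_derive y (1 : R) L (expR y / k (L y)).
Proof.
move=> A0 B0 P10 P20 K k.
have K0 l : 0 < K l by rewrite /K addr_gt0// divr_gt0// expR_gt0.
have k0 l : 0 < k l by rewrite /k addr_gt0// mulr_gt0 ?expR_gt0// divr_gt0.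
have dA (c l : R) : is_derive l (1 : R) (fun l : R => expR (c * l)) (expR (c * l) * c).
  by apply: (is_derive_eq (isd_expR (isdZ c (isd_id l)))); rewrite mulr1.
have dK (l : R) : is_derive l (1 : R) K (k l).
  have H := isdD (isdM (dA A l) (isd_cst P1^-1 l)) (isdM (dA B l) (isd_cst P2^-1 l)).
  by apply: (is_derive_eq H); rewrite /k; ring.
have dlK (l : R) : is_derive l (1 : R) (fun l => ln (K l)) (k l / K l).
  exact: isd_ln (K0 l) (dK l).
have inc x y : x < y -> ln (K x) < ln (K y).
  move=> xy; apply: (@derive_gt0_lt _ (fun l => ln (K l)) (fun l => k l / K l)) => //.
  by move=> z _; rewrite divr_gt0.
have [||||L LP] := @inverse_derivative _ (fun=> True) (fun l => ln (K l)) (fun l => k l / K l).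
- by move=> x _; near=> y.
- by move=> x _; split; [exact: dlK|rewrite gt_eqF// divr_gt0].
- move=> x y _ _ xy; have [h|h|//] := ltgtP x y.
    by have := inc _ _ h; rewrite xy ltxx.
  by have := inc _ _ h; rewrite xy ltxx.
- move=> y.
  have e0 := expR_gt0 y.
  pose l2 := ln (expR y * P1) / A.
  pose l1 := Num.min (ln (expR y * P1 / 2) / A) (ln (expR y * P2 / 2) / B).
  have E2 : expR y <= K l2.
    rewrite /K /l2 [A * _]mulrC divfK ?gt_eqF// lnK ?posrE ?mulr_gt0// mulfK ?gt_eqF//.
    by rewrite lerDl divr_ge0 ?expR_ge0// ltW.
  have E1 : K l1 <= expR y.
    have h1 : expR (A * l1) / P1 <= expR y / 2.
      rewrite ler_pdivrMr// mulrAC -[leRHS]lnK ?posrE ?divr_gt0 ?mulr_gt0// ler_expR.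
      by rewrite mulrC -ler_pdivlMr// /l1 ge_min lexx.
    have h2 : expR (B * l1) / P2 <= expR y / 2.
      rewrite ler_pdivrMr// mulrAC -[leRHS]lnK ?posrE ?divr_gt0 ?mulr_gt0// ler_expR.
      by rewrite mulrC -ler_pdivlMr// /l1 ge_min lexx orbT.
    by rewrite /K; lra.
  have l12 : l1 <= l2.
    rewrite leNgt; apply/negP => /inc; rewrite ltr_ln ?posrE// => h.
    by have := le_lt_trans E2 (lt_le_trans h E1); rewrite ltxx.
  have [||l _ lE] := @IVT _ (fun l => ln (K l)) l1 l2 y l12.
  + by apply: continuous_subspaceT => z; exact: is_derive_continuous (dlK z).
  + rewrite ge_min le_max; apply/andP; split; apply/orP; [left|right].
      by rewrite -[leRHS]expRK ler_ln// posrE.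
    by rewrite -[leLHS]expRK ler_ln// posrE.
  + by exists l.
exists L => y; have [_ Ly dL] := LP y.
have KL : K (L y) = expR y by rewrite -[in RHS]Ly lnK// posrE.
by split=> //; rewrite -KL -invf_div.
Unshelve. all: by end_near. Qed.

(** On the zero level [K l = - F zeta], so [l = M zeta]. Differentiating this relation along
    [l' = delta - psi zeta] yields the scalar equation [zeta' = k (M zeta)]. Its solution increases
    from [z1] to [z2], and [l'] changes sign once, at [z0]. *)
Lemma homoclinic_orbit (p delta mu P1 P2 : R) : 1 < p -> 0 < delta ->
  mu < delta `^ p -> p < P1 -> p < P2 ->
  exists (l zeta : R -> R) (Z C al : R), [/\
    forall t : R, is_derive t (1 : R) l (delta - psi p (zeta t)),
    forall t : R, is_derive t (1 : R) zeta (- (p * delta) * zeta t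
      + (p - 1) * (zeta t * psi p (zeta t)) + mu
      + expR ((P1 - p) * l t) + expR ((P2 - p) * l t)),
    forall t, `|zeta t| <= Z, 0 < al & forall t, l t <= C - al * `|t|].
Proof.
move=> p1 d0 mud pP1 pP2.
have p0 : 0 < p by lra.
have [P10 P20] : 0 < P1 /\ 0 < P2 by lra.
set A := P1 - p; set B := P2 - p.
have A0 : 0 < A by rewrite /A; lra.
have B0 : 0 < B by rewrite /B; lra.
pose F := energy p delta mu.
set z0 := delta `^ (p - 1).
have [z1 [z2 [/andP[z10 z02] Fz1 Fz2 Fneg]]] := energy_zeros p1 d0 mud.
rewrite -/z0 in z10 z02.
have ps0 : psi p z0 = delta by exact: psi_powR.
have ps1 : psi p z1 < delta by rewrite -ps0; exact: psi_lt.
have ps2 : delta < psi p z2 by rewrite -ps0; exact: psi_lt.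
pose K l := expR (A * l) / P1 + expR (B * l) / P2.
pose k l := A / P1 * expR (A * l) + B / P2 * expR (B * l).
have [L LP] := exp_sum_inverse A0 B0 P10 P20.
have {}LP (y : R) : K (L y) = expR y /\ is_derive y (1 : R) L (expR y / k (L y)) := LP y.
have k0 l : 0 < k l by rewrite /k addr_gt0// mulr_gt0 ?expR_gt0// divr_gt0.
pose M z := L (ln (- F z)).
have KM z : z1 < z < z2 -> K (M z) = - F z.
  by move=> /Fneg h; rewrite /M (LP _).1 lnK// posrE oppr_gt0.
have dF (z : R) : is_derive z (1 : R) F (psi p z - delta) by exact: is_derive_energy.
have dM (z : R) : z1 < z < z2 -> is_derive z (1 : R) M ((delta - psi p z) / k (M z)).
  move=> zz; have h : 0 < - F z by rewrite oppr_gt0; exact: Fneg.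
  have H := isd_comp (isd_ln (f := fun z : R => - F z) h (isdN (dF z))) (LP _).2.
  apply: (is_derive_eq H); rewrite -/(M z) lnK ?posrE//.
  have nF : F z != 0 by rewrite -oppr_eq0 gt_eqF.
  have nk : k (M z) != 0 by rewrite gt_eqF.
  by field; rewrite nF nk.
pose h z := k (M z).
have kcts : continuous k.
  move=> l; have dA (c : R) : is_derive l (1 : R) (fun l : R => expR (c * l)) (expR (c * l) * c).
    by apply: (is_derive_eq (isd_expR (isdZ c (isd_id l)))); rewrite mulr1.
  exact: is_derive_continuous (isdD (isdZ (A / P1) (dA A)) (isdZ (B / P2) (dA B))).
(* Hence [zeta' <= - (A + B) F zeta], and [F] vanishes at most linearly at [z1] and [z2]: the
   hypothesis of [autonomous_flow]. *)
have kK l : k l <= (A + B) * K l.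
  rewrite /k /K.
  have : 0 <= expR (A * l) / P1 by rewrite divr_ge0 ?expR_ge0// ltW.
  have : 0 <= expR (B * l) / P2 by rewrite divr_ge0 ?expR_ge0// ltW.
  have -> : A / P1 * expR (A * l) = A * (expR (A * l) / P1) by ring.
  have -> : B / P2 * expR (B * l) = B * (expR (B * l) / P2) by ring.
  by nra.
have pslt := psi_lt p1.
have psle x y : x <= y -> psi p x <= psi p y.
  by rewrite le_eqVlt => /predU1P[->//|/pslt/ltW].
(* As [psi z1 < delta < psi z2], this bounds [|F'|] between the two zeros. *)
set D := psi p z2 - psi p z1.
have F1 z : z1 < z < z2 -> - F z <= D * (z - z1).
  move=> /andP[zz1 zz2].
  have := @derive_ge0_le _ (fun z => F z + D * z) (fun z => psi p z - delta + D * 1) z1 z (ltW zz1).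
  have E : forall x : R, z1 <= x <= z -> is_derive x (1 : R) (fun z => F z + D * z) (psi p x - delta + D * 1).
    by move=> x _; apply: isdD => //; apply: isdZ; exact: isd_id.
  move=> /(_ E) {}E; have : F z1 + D * z1 <= F z + D * z.
    apply: E => x /andP[x1 x2]; have := psle z1 x (ltW x1); rewrite /D; lra.
  by rewrite {1}/F Fz1; lra.
have F2 z : z1 < z < z2 -> - F z <= D * (z2 - z).
  move=> /andP[zz1 zz2].
  have := @derive_ge0_le _ (fun z => D * z - F z) (fun z => D * 1 - (psi p z - delta)) z z2 (ltW zz2).
  have E : forall x : R, z <= x <= z2 -> is_derive x (1 : R) (fun z => D * z - F z) (D * 1 - (psi p x - delta)).
    by move=> x _; apply: isdB => //; apply: isdZ; exact: isd_id.
  move=> /(_ E) {}E; have : D * z - F z <= D * z2 - F z2.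
    apply: E => x /andP[x1 x2]; have := psle x z2 (ltW x2); rewrite /D; lra.
  by rewrite {2}/F Fz2; lra.
have AB : 0 < A + B by rewrite addr_gt0.
have z12 : z1 < z2 by lra.
have [||zeta [zetaP zetaS]] := @autonomous_flow _ z1 z2 ((A + B) * D) h z12.
- move=> z zz; split; last exact: k0.
  exact: (cts_comp (is_derive_continuous (dM z zz)) (kcts _)).
- move=> z zz; rewrite -!mulrA; split; apply: (le_trans (kK _)); rewrite ler_pM2l// KM//.
    exact: F1.
  exact: F2.
have zin t : z1 < zeta t < z2 by have [] := zetaP t.
have dzeta (t : R) : is_derive t (1 : R) zeta (h (zeta t)) by have [] := zetaP t.
pose l t := M (zeta t).
have dl (t : R) : is_derive t (1 : R) l (delta - psi p (zeta t)).
  apply: (is_derive_eq (isd_comp (dzeta t) (dM _ (zin t)))).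
  by rewrite /h divfK// gt_eqF.
have zinc x y : x <= y -> zeta x <= zeta y.
  move=> xy; apply: (@derive_ge0_le _ zeta (fun t => h (zeta t))) => // t _.
  by rewrite ltW// /h.
(* Any value strictly between [z1] and [z0], or [z0] and [z2], would do: before [tm] the slope of
   [l] is at least [al], after [tp] at most [- al], by monotonicity of [zeta] and [psi]. *)
have [tm tmE] := zetaS ((z1 + z0) / 2) ltac:(lra).
have [tp tpE] := zetaS ((z0 + z2) / 2) ltac:(lra).
have am : 0 < delta - psi p (zeta tm) by rewrite subr_gt0 -ps0 tmE; apply: pslt; lra.
have ap : 0 < psi p (zeta tp) - delta by rewrite subr_gt0 -ps0 tpE; apply: pslt; lra.
pose al := Num.min (delta - psi p (zeta tm)) (psi p (zeta tp) - delta).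
have al0 : 0 < al by rewrite /al lt_min am ap.
have alm : al <= delta - psi p (zeta tm) by rewrite /al ge_min lexx.
have alp : al <= psi p (zeta tp) - delta by rewrite /al ge_min lexx orbT.
have D0 : 0 < D by rewrite /D; lra.
(* Read off from [e^(A l) / P1 <= K l = - F zeta <= D (z2 - z1)]. *)
pose M0 := ln (D * (z2 - z1) * P1) / A.
have lM0 t : l t <= M0.
  have := KM _ (zin t); have := F1 _ (zin t); rewrite -/(l t) => h1 h2.
  have h3 : D * (zeta t - z1) <= D * (z2 - z1).
    by rewrite ler_pM2l// lerD2r; have /andP[_ /ltW] := zin t.
  have h4 : 0 <= expR (B * l t) / P2 by rewrite divr_ge0 ?expR_ge0// ltW.
  have : expR (A * l t) / P1 <= D * (z2 - z1) by move: h2; rewrite /K; lra.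
  rewrite ler_pdivrMr// => h5.
  rewrite /M0 ler_pdivlMr// mulrC -ler_expR lnK//.
  by rewrite posrE !mulr_gt0// subr_gt0.
have rightb t : tp <= t -> l t <= M0 - al * (t - tp).
  move=> tpt.
  have := @derive_ge0_le _ (fun t => - l t - al * t) (fun t => - (delta - psi p (zeta t)) - al * 1) tp t tpt.
  have E : forall x : R, tp <= x <= t -> is_derive x (1 : R) (fun t => - l t - al * t) (- (delta - psi p (zeta x)) - al * 1).
    by move=> x _; exact: (isdB (isdN (dl x)) (isdZ al (isd_id x))).
  move=> /(_ E) {}E; have : - l tp - al * tp <= - l t - al * t.
    apply: E => x /andP[x1 x2].
    by have := psle _ _ (zinc _ _ (ltW x1)); move: alp; clear; lra.
  by have := lM0 tp; rewrite mulrBr; clear; lra.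
have leftb t : t <= tm -> l t <= M0 - al * (tm - t).
  move=> tmt.
  have := @derive_ge0_le _ (fun t => l t - al * t) (fun t => (delta - psi p (zeta t)) - al * 1) t tm tmt.
  have E : forall x : R, t <= x <= tm -> is_derive x (1 : R) (fun t => l t - al * t) ((delta - psi p (zeta x)) - al * 1).
    by move=> x _; exact: (isdB (dl x) (isdZ al (isd_id x))).
  move=> /(_ E) {}E; have : l t - al * t <= l tm - al * tm.
    apply: E => x /andP[x1 x2].
    by have := psle _ _ (zinc _ _ (ltW x2)); move: alm; clear; lra.
  by have := lM0 tm; rewrite mulrBr; clear; lra.
exists l, zeta, (`|z1| + `|z2|), (M0 + al * (`|tp| + `|tm|)), al; split => //.
- move=> t; apply: (is_derive_eq (dzeta t)).
  have E := KM _ (zin t); rewrite -/(l t) /K /F /energy -mul_psi// in E.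
  rewrite mul_psi// -mul_psi// /h /k -/(l t).
  (* Since [A / P1 = 1 - p / P1], and likewise for [B], [k l] is the sum of the two exponentials
     minus [p K l]; replacing [p K l] by [- p F zeta] gives the stated equation. *)
  have : p * (expR (A * l t) / P1 + expR (B * l t) / P2) =
    p * (- ((p - 1) / p * (zeta t * psi p (zeta t)) - delta * zeta t + mu / p)) by rewrite E.
  have -> : p * (- ((p - 1) / p * (zeta t * psi p (zeta t)) - delta * zeta t + mu / p)) =
    p * delta * zeta t - (p - 1) * (zeta t * psi p (zeta t)) - mu by field; rewrite gt_eqF.
  have -> : A / P1 * expR (A * l t) = expR (A * l t) - p * (expR (A * l t) / P1).
    by rewrite /A; field; rewrite gt_eqF.
  have -> : B / P2 * expR (B * l t) = expR (B * l t) - p * (expR (B * l t) / P2).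
    by rewrite /B; field; rewrite gt_eqF.
  by clear; lra.
- move=> t; have /andP[h1 h2] := zin t; rewrite ler_norml.
  have := ler_norm (- z1); have := ler_norm z2; rewrite normrN.
  have := normr_ge0 z1; have := normr_ge0 z2; move: h1 h2; clear; lra.
move=> t.
have n1 := ler_norm tp; have n2 := ler_norm (- tp); rewrite normrN in n2.
have n3 := ler_norm tm; have n4 := ler_norm (- tm); rewrite normrN in n4.
(* The shift by [|tp| + |tm|] makes one bound cover the three ranges of [t]; between [tm] and [tp],
   [|t|] is at most this shift. *)
have fin X : l t <= M0 - al * X -> `|t| - (`|tp| + `|tm|) <= X -> l t <= M0 + al * (`|tp| + `|tm|) - al * `|t|.
  move=> h1 h2; have : al * (`|t| - (`|tp| + `|tm|)) <= al * X by rewrite ler_pM2l.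
  by move: h1; clear; rewrite mulrBr; lra.
have [t1|t1] := leP tp t.
  apply: (fin _ (rightb _ t1)); have [t0|t0] := leP 0 t.
    by rewrite ger0_norm//; have := normr_ge0 tm; move: n1; clear; lra.
  by rewrite ltr0_norm//; have := normr_ge0 tm; move: n2 t1; clear; lra.
have [t2|t2] := leP t tm.
  apply: (fin _ (leftb _ t2)); have [t0|t0] := leP 0 t.
    by rewrite ger0_norm//; have := normr_ge0 tp; move: n3 t2; clear; lra.
  by rewrite ltr0_norm//; have := normr_ge0 tp; move: n4; clear; lra.
apply: (fin 0); first by rewrite mulr0 subr0.
have : `|t| <= `|tp| + `|tm|.
  rewrite ler_norml; have := normr_ge0 tp; have := normr_ge0 tm.
  by move: n1 n4 t1 t2; clear; lra.
by clear; lra.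
Qed.

End homoclinic.

(** * Radial functions *)

Section radial_functions.
Context {R : realType}.

Lemma rad_logr n H (x : 'rV[R]_n) : x != 0 -> radial H (sqn x) = H (logr x).
Proof. by rewrite -sqn_gt0 => /rad_gt0. Qed.

Lemma rad_sqn0 n H : radial H (sqn (0 : 'rV[R]_n)) = 0.
Proof. by rewrite rad_le0// leNgt sqn_gt0 eqxx. Qed.

Lemma sqn_logr n (x : 'rV[R]_n) : x != 0 -> sqn x = expR (2 * logr x).
Proof. by move=> x0; rewrite /logr mulrC divfK// lnK// posrE sqn_gt0. Qed.

Lemma enorm_logr n (x : 'rV[R]_n) : x != 0 -> enorm x = expR (logr x).
Proof.
move=> x0; rewrite enorm_sqn sqn_logr// mulr2n mulrDl !mul1r expRD.
by rewrite -expr2 sqrtr_sqr gtr0_norm// expR_gt0.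
Qed.

Lemma continuous_sqn n : continuous (@sqn R n).
Proof. by move=> x; apply: differentiable_continuous; exact: differentiable_sqn. Qed.

Lemma continuous_comp_sqn n (f : R -> R) (x : 'rV[R]_n) :
  {for sqn x, continuous f} -> {for x, continuous (fun y : 'rV[R]_n => f (sqn y))}.
Proof. by move=> cf; apply: (@continuous_comp _ _ _ (@sqn R n) f) => //; exact: continuous_sqn. Qed.

Lemma measurable_comp_sqn n (f : R -> R) : continuous f ->
  measurable_fun setT (fun x : 'rV[R]_n => f (sqn x)).
Proof.
by move=> cf; apply: continuous_rV_measurable => x; apply: continuous_comp_sqn; exact: cf.
Qed.

Lemma measurable_radial n (H : R -> R) : continuous H ->
  measurable_fun setT (fun x : 'rV[R]_n => radial H (sqn x)).
Proof.
move=> cH; apply: (@measurableT_comp _ _ _ _ _ _ (radial H)); last first.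
  exact: continuous_rV_measurable (@continuous_sqn n).
apply: measurable_fun_ifT.
- exact: measurable_fun_ltr.
- apply: (@measurableT_comp _ _ _ _ _ _ H); first exact: continuous_measurable_fun.
  by apply: measurable_funM => //; exact: measurable_ln.
- exact: measurable_cst.
Qed.

Lemma weight_powR (d a t q : R) : weight d a t `^ q = weight (d * q) (a * q) t.
Proof. by rewrite /weight -expRM; congr expR; ring. Qed.

(** Homogeneity in [e] is the point: one constant [A] turns pointwise errors tending to 0 into norms
    tending to 0. *)
Lemma Lp_norm_le n (q c : R) : 0 < q -> 0 < c <= n%:R ->
  exists2 A, 0 <= A & forall e (g : 'rV[R]_n -> R), 0 <= e ->
    measurable_fun setT g ->
    (forall x, x != 0 -> `|g x| `^ q <= e `^ q * weight n%:R c (logr x)) ->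
    (Lp_norm q g <= (e * A)%:E)%E.
Proof.
move=> q0 cn; have [K K0 KP] := weight_integral cn.
exists (K `^ q^-1); first exact: powR_ge0.
move=> e g e0 mg gW; rewrite /Lp_norm unlock /Lnorm.
have H : (\int[lebesgue_rV R n]_x (`|(EFin \o g) x| `^ q) <= (e `^ q * K)%:E)%E.
  apply: KP => //; first exact: powR_ge0.
  - apply/measurable_EFinP; apply: (@measurableT_comp _ _ _ _ _ _ (fun y : R => y `^ q)).
      exact: measurable_powR.
    exact: (measurableT_comp (@normr_measurable R setT)).
  - by move=> x; rewrite poweR_ge0.
have -> : ((e * K `^ q^-1)%:E = (e `^ q * K)%:E `^ q^-1)%E.
  by rewrite poweR_EFin powRM ?powR_ge0// -powRrM mulfV ?gt_eqF// powRr1.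
apply: gt0_ler_poweR => //; first by rewrite invr_ge0 ltW.
- by rewrite in_itv/= leey andbT; apply: integral_ge0.
- by rewrite in_itv/= leey andbT lee_fin mulr_ge0// powR_ge0.
Qed.

Lemma closed_norm_le n (M : R) : closed [set x : 'rV[R]_n | `|x| <= M].
Proof.
have -> : [set x : 'rV[R]_n | `|x| <= M] = (fun x => `|x|) @^-1` [set y | y <= M] by [].
apply: (closed_comp _ (@closed_le R M)) => x _; exact: norm_continuous.
Qed.

Lemma test_function_radial n (V : R -> R) (b : R) : smooth1 V ->
  (forall r, b <= r -> V r = 0) -> test_function (V \o @sqn R n).
Proof.
move=> sV V0; split; first exact: smooth_radial.
apply: bounded_closed_compact; last exact: closed_closure.
exists (`|b| + 1); split; first exact: num_real.
move=> M bM x xV; apply: (@le_trans _ _ (`|b| + 1)); last exact: ltW.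
suff : closure [set y : 'rV[R]_n | `|y| <= `|b| + 1] x.
  by rewrite -(closure_id _).1//; exact: closed_norm_le.
apply: closureS xV => y /= Vy; apply: rV_norm_le; first by rewrite addr_ge0.
move=> i; have : sqn y < b by rewrite ltNge; apply: contra_neqN Vy => /V0.
have := coord_le_sqn y i; rewrite -real_normK ?num_real//.
have := ler_norm b; have := normr_ge0 (y ord0 i); nra.
Qed.

Lemma cvge_squeeze0 (f : nat -> \bar R) (A : R) : (forall k, 0%E <= f k)%E ->
  (forall k, (f k <= (k.+1%:R^-1 * A)%:E)%E) -> f k @[k --> \oo] --> 0%E.
Proof.
move=> f0 fA; apply: (@squeeze_cvge _ _ _ _ (cst 0%E) _ (fun k => (k.+1%:R^-1 * A)%:E)).
- by apply: nearW => k; rewrite f0 fA.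
- exact: cvg_cst.
apply: cvg_EFin; first exact: nearW.
rewrite -[X in _ --> X](mul0r A); apply: cvgM; last exact: cvg_cst.
exact: cvg_harmonic.
Qed.

End radial_functions.

(** * Radial profiles as elements of the energy space *)

Section energy_space.
Context {R : realType}.

Section radial_element.
Variables (n : nat) (p a C : R) (U dU : R -> R).
Hypotheses (p1 : 1 < p) (pn : p < n%:R).
Let delta := (n%:R - p) / p.
Hypotheses (a0 : 0 < a <= delta) (C0 : 0 <= C).
Hypotheses (UdU : forall t, is_derive t (1 : R) U (dU t)) (cdU : continuous dU).
Hypotheses (UC : forall t, `|U t| <= C * weight delta (2 * a) t)
  (dUC : forall t, `|dU t| <= C * weight delta (2 * a) t).

(** The gradient of [U (ln |x|)] is [U' (ln |x|) x / |x|^2]; this is the scalar factor in front of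
    [x]. *)
Let dG (t : R) : R := dU t * expR (- (2 * t)).

(** Every gradient involved is a scalar function times [x], so the errors reduce to the scalars
    [c k]. The bounds of [radial_approx] become integrable ones after taking powers, with
    [1 / (k + 1)] in front. *)
Lemma D1p_grad_radial : D1p_grad p (fun x : 'rV[R]_n => radial U (sqn x))
  (fun x => radial dG (sqn x) *: x).
Proof.
have /andP[agt0 ad] := a0.
have p0 : 0 < p by exact: lt_trans p1.
have np0 : 0 < n%:R - p by rewrite subr_gt0.
have n0 : 0 < n%:R :> R by exact: lt_trans pn.
have cU : continuous U by move=> t; exact: is_derive_continuous (UdU t).
have cdG : continuous dG.
  apply: ctsMT => // t; exact: is_derive_continuous (isd_expR (isdN (isdZ 2 (isd_id t)))).
pose e k : R := k.+1%:R^-1.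
have e0 k : 0 < e k by rewrite invr_gt0.
have /choice[V HV] : forall k, exists V : R -> R, [/\ smooth1 V,
    exists b, forall r, b <= r -> V r = 0 & forall r, 0 < r -> let t := ln r / 2 in
      `|V r - U t| <= e k * weight delta a t /\
      `|2 * r * 'D_(1 : R) V r - dU t| <= e k * weight delta a t].
  move=> k; have [V [b [sV Vb VE]]] := radial_approx a0 C0 (e0 k) UdU cdU UC dUC.
  by exists V; split => //; exists b.
pose u (x : 'rV[R]_n) := radial U (sqn x).
pose G (x : 'rV[R]_n) := radial dG (sqn x) *: x.
pose phi k : 'rV[R]_n -> R := V k \o @sqn R n.
pose c k (x : 'rV[R]_n) : R := 2 * 'D_(1 : R) (V k) (sqn x) - radial dG (sqn x).
have sV k : smooth1 (V k) by have [] := HV k.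
have tphi k : test_function (phi k).
  by have [_ [b Vb] _] := HV k; exact: test_function_radial Vb.
have gphi k x : grad (phi k) x = (2 * 'D_(1 : R) (V k) (sqn x)) *: x.
  exact/grad_radial/(Ck_differentiable (sV k 0%N)).
have gphiG k x : grad (phi k) x - G x = c k x *: x by rewrite gphi -scalerBl.
have gphiB k l x : grad (phi k \- phi l) x = (c k x - c l x) *: x.
  rewrite gradB; try exact: ((tphi _).1 [::]).
  by rewrite !gphi -scalerBl; congr (_ *: x); rewrite /c; ring.
have mu_ : measurable_fun setT u by exact: measurable_radial.
have mV k : measurable_fun setT (fun x : 'rV[R]_n => V k (sqn x)).
  exact: measurable_comp_sqn (smooth1_continuous (sV k)).
have mc k : measurable_fun setT (c k).
  apply: measurable_funB; last exact: measurable_radial.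
  apply: measurable_funM => //.
  exact: measurable_comp_sqn (smooth1_continuous (smooth1_derive (sV k))).
have mnorm : measurable_fun setT (@enorm R n).
  exact: measurable_comp_sqn (@sqrt_continuous R).
have phiu k x : x != 0 -> `|phi k x - u x| <= e k * weight delta a (logr x).
  move=> x0; have [_ _ /(_ (sqn x))] := HV k; rewrite sqn_gt0 => /(_ x0)[+ _].
  by rewrite /u rad_logr.
have cE k x : x != 0 -> `|c k x| <= e k * weight delta a (logr x) * expR (- (2 * logr x)).
  move=> x0; have [_ _ /(_ (sqn x))] := HV k; rewrite sqn_gt0 => /(_ x0)[_].
  rewrite -/(logr x) => H.
  have -> : c k x = (2 * sqn x * 'D_(1 : R) (V k) (sqn x) - dU (logr x)) * expR (- (2 * logr x)).
    rewrite /c rad_logr// /dG mulrBl {2}sqn_logr// expRN.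
    by congr (_ - _); field; rewrite gt_eqF ?expR_gt0.
  by rewrite normrM (gtr0_norm (expR_gt0 _)) ler_pM2r ?expR_gt0.
pose q := sobolev_exp n p.
have q0 : 0 < q by rewrite divr_gt0// mulr_gt0.
(* Both norms are scale invariant: raising [|x|^-delta] to the Sobolev exponent, or [|x|^-(delta+1)]
   to the power [p], gives exactly [|x|^-n], and the gain [a] makes it integrable at both ends. *)
have dq : delta * q = n%:R by rewrite /delta /q /sobolev_exp; field; rewrite !gt_eqF.
have dp : (delta + 1) * p = n%:R by rewrite /delta; field; rewrite gt_eqF.
have [A A0 AP] : exists2 A, 0 <= A & forall eta (g : 'rV[R]_n -> R), 0 <= eta ->
    measurable_fun setT g ->
    (forall x, x != 0 -> `|g x| <= eta * weight delta a (logr x)) ->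
    (Lp_norm q g <= (eta * A)%:E)%E.
  have [|A A0 AP] := @Lp_norm_le R n q (a * q) q0.
    by rewrite mulr_gt0//= -dq ler_pM2r.
  exists A => // eta g eta0 mg gW; apply: AP => // x /gW H.
  rewrite -dq -weight_powR -powRM//; last exact/ltW/weight_gt0.
  by rewrite ge0_ler_powR ?nnegrE// ?(ltW q0)// mulr_ge0// ltW// weight_gt0.
have [B B0 BP] : exists2 B, 0 <= B & forall eta (d : 'rV[R]_n -> R), 0 <= eta ->
    measurable_fun setT d ->
    (forall x, x != 0 -> `|d x| <= eta * weight delta a (logr x) * expR (- (2 * logr x))) ->
    (Lp_norm p (fun x => enorm (d x *: x)) <= (eta * B)%:E)%E.
  have [|B B0 BP] := @Lp_norm_le R n p (a * p) p0.
    rewrite mulr_gt0//= -dp ler_pM2r//; lra.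
  exists B => // eta d eta0 md dW; apply: BP => //.
    under eq_fun do rewrite enormZ; apply: measurable_funM => //.
    exact: (measurableT_comp (@normr_measurable R setT)).
  move=> x x0; rewrite -dp -weight_powR -powRM//; last exact/ltW/weight_gt0.
  have H : `|enorm (d x *: x)| <= eta * weight (delta + 1) a (logr x).
    rewrite enormZ enorm_logr// ger0_norm; last by rewrite mulr_ge0// expR_ge0.
    rewrite -ler_pdivlMr ?expR_gt0// (le_trans (dW _ x0))// -!mulrA ler_wpM2l//.
    by rewrite /weight -expRN -!expRD ler_expR; lra.
  by rewrite ge0_ler_powR ?nnegrE// ?(ltW p0)// mulr_ge0// ltW// weight_gt0.
split.
  apply: measurable_fun_rVP => i; under eq_fun do rewrite mxE.
  by apply: measurable_funM; [exact: measurable_radial|exact: measurable_coord].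
exists phi; split; last first.
  apply: (cvge_squeeze0 (A := B)) => k; first exact: Lnorm_ge0.
  rewrite (_ : (fun x => _) = (fun x => enorm (c k x *: x))); last first.
    by apply/funext => x; rewrite gphiG.
  by apply: BP => // x; exact: cE.
split => //; last first.
  apply: (cvge_squeeze0 (A := A)) => k; first exact: Lnorm_ge0.
  apply: AP; [by []|exact: measurable_funB (mV k) mu_|].
  by move=> x; exact: phiu.
move=> eta eta0.
have [N NE] : exists N : nat, 2 * (B + 1) / eta < N%:R.
  by exists (Num.truncn (2 * (B + 1) / eta)).+1; rewrite truncnS_gt.
have small k : (N <= k)%N -> e k * (2 * (B + 1)) < eta.
  move=> Nk; rewrite [e k * _]mulrC ltr_pdivrMr// [eta * _]mulrC -ltr_pdivrMr//.
  by apply: (lt_le_trans NE); rewrite ler_nat leqW.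
exists N => k l Nk Nl; apply: (@le_lt_trans _ _ ((e k + e l) * B)%:E); last first.
  rewrite lte_fin; have := small _ Nk; have := small _ Nl.
  by have := e0 k; have := e0 l; nra.
rewrite (_ : (fun x => _) = (fun x => enorm ((c k x - c l x) *: x))); last first.
  by apply/funext => x; rewrite gphiB.
apply: BP; [by rewrite addr_ge0 ?ltW|exact: measurable_funB (mc k) (mc l)|] => x x0.
 apply: (le_trans (ler_normB _ _)).
have -> : forall b c d : R, (e k + b) * c * d = e k * c * d + b * c * d by move=> *; ring.
exact: lerD (cE k x x0) (cE l x x0).
Qed.

End radial_element.

End energy_space.

(** * Integration by parts for singular radial fields *)

Section radial_calculus.
Context {R : realType}.

Lemma neq0_near n (x : 'rV[R]_n) : x != 0 -> \forall y \near x, y != 0.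
Proof.
rewrite -sqn_gt0 => x0; near=> y; rewrite -sqn_gt0; near: y.
exact: (cvgr_gt (f := @sqn R n)) (@continuous_sqn R n x) _ x0.
Unshelve. all: by end_near. Qed.

Lemma is_derive_coord n (i : 'I_n) (x e : 'rV[R]_n) :
  is_derive x e (fun y : 'rV[R]_n => y ord0 i) (e ord0 i).
Proof.
rewrite -[X in is_derive _ _ _ X](derive_coord i x e).
exact/derivableP/diff_derivable/differentiable_coord_rV.
Qed.

Lemma is_derive_comp_sqn n (f : R -> R) (d : R) (x : 'rV[R]_n) i :
  is_derive (sqn x) (1 : R) f d ->
  is_derive x (delta_mx ord0 i) (fun y => f (sqn y)) (d * (2 * x ord0 i)).
Proof.
move=> fd; have df := is_derive_differentiable fd.
have H := derive_comp (delta_mx ord0 i) df (differentiable_sqn x).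
rewrite derive_sqn dot_delta (is_derive1D fd) in H; rewrite -H.
apply/derivableP/diff_derivable; apply: (@differentiable_comp _ _ _ _ (@sqn R n) f) => //.
exact: differentiable_sqn.
Qed.

Lemma continuous_coord n (i : 'I_n) : continuous (fun y : 'rV[R]_n => y ord0 i).
Proof.
move=> x; apply: differentiable_continuous; exact: differentiable_coord_rV.
Qed.

Lemma isdM_rV n (f g : 'rV[R]_n -> R) x e (a b : R) : is_derive x e f a ->
  is_derive x e g b -> is_derive x e (fun y => f y * g y) (a * g x + f x * b).
Proof.
move=> df dg; apply: (is_derive_eq (is_deriveM df dg)).
by rewrite /GRing.scale/=; ring.
Qed.

Lemma ctsM_rV n (f g : 'rV[R]_n -> R) x : {for x, continuous f} ->
  {for x, continuous g} -> {for x, continuous (fun y => f y * g y)}.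
Proof. exact: continuousM. Qed.

Lemma ctsD_rV n (f g : 'rV[R]_n -> R) x : {for x, continuous f} ->
  {for x, continuous g} -> {for x, continuous (fun y => f y + g y)}.
Proof. exact: continuousD. Qed.

Lemma C1_on_radial n (U dU : R -> R) :
  (forall t, is_derive t (1 : R) U (dU t)) -> continuous dU ->
  C1_on (~` [set 0]) (fun x : 'rV[R]_n => radial U (sqn x)).
Proof.
move=> UdU cdU x /eqP x0.
have dU' (y : 'rV[R]_n) : y != 0 ->
    is_derive (sqn y) (1 : R) (radial U) (dU (logr y) / (2 * sqn y)).
  by rewrite -sqn_gt0 => y0; apply: is_derive_rad.
split.
  apply: (@differentiable_comp _ _ _ _ (@sqn R n) (radial U)).
    exact: differentiable_sqn.
  exact: is_derive_differentiable (dU' _ x0).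
move=> i; pose g (y : 'rV[R]_n) := radial dU (sqn y) * (2 * sqn y)^-1 * (2 * y ord0 i).
have E (y : 'rV[R]_n) : y != 0 -> partial i (fun x => radial U (sqn x)) y = g y.
  move=> y0; rewrite /partial /g rad_logr//.
  by have [_ ->] := is_derive_comp_sqn i (dU' _ y0).
have sx : 0 < sqn x by rewrite sqn_gt0.
have cg : {for x, continuous g}.
  have c1 : {for x, continuous (fun y : 'rV[R]_n => radial dU (sqn y))}.
    by apply: (continuous_comp_sqn (f := radial dU)); apply: continuous_rad => //; exact: cdU.
  have c2 : {for x, continuous (fun y : 'rV[R]_n => (2 * sqn y)^-1)}.
    apply: (continuous_comp_sqn (f := fun r : R => (2 * r)^-1)).
    apply: ctsV; first by rewrite mulf_neq0// gt_eqF.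
    exact: is_derive_continuous (isdZ 2 (isd_id _)).
  have c3 : {for x, continuous (fun y : 'rV[R]_n => 2 * y ord0 i)}.
    by apply: ctsM_rV; [exact: cst_continuous|exact: continuous_coord].
  exact: ctsM_rV (ctsM_rV c1 c2) c3.
have H : \forall y \near x, g y = partial i (fun x => radial U (sqn x)) y.
  by apply: filterS (neq0_near x0) => y y0; rewrite E.
by rewrite /prop_for /continuous_at E//; exact: cvg_trans (near_eq_cvg H) cg.
Qed.

Lemma compact_support_bounded n (g : 'rV[R]_n -> R) (B : R) : continuous g ->
  (forall x, B < `|x| -> g x = 0) -> exists2 C, 0 <= C & forall x, `|g x| <= C.
Proof.
move=> cg gB; pose A := [set x : 'rV[R]_n | `|x| <= B].
have cA : compact A.
  apply: bounded_closed_compact; last exact: closed_norm_le.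
  by exists B; split; [exact: num_real|move=> M BM x /= xB; exact: le_trans (ltW BM)].
have [M [_ HM]] : bounded_set (g @` A).
  by apply/compact_bounded/continuous_compact => //; exact: continuous_subspaceT.
have HM' : forall y, (g @` A) y -> `|y| <= `|M| + 1.
  by apply: HM; rewrite ltr_pwDr// ler_norm.
exists (`|M| + 1) => [|x]; first by rewrite addr_ge0.
have [xB|/gB ->] := leP `|x| B; first by apply: HM'; exists x.
by rewrite normr0 addr_ge0.
Qed.

Lemma test_function_bounds n (v : 'rV[R]_n -> R) : test_function v ->
  exists B C : R, [/\ 0 <= B, 0 <= C,
    forall x, B < `|x| -> v x = 0 /\ forall i, partial i v x = 0,
    forall x, `|v x| <= C & forall x i, `|partial i v x| <= C].
Proof.
move=> [sv /compact_bounded[M [_ HM]]].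
pose B := `|M| + 1.
have B0 : 0 <= B by rewrite addr_ge0.
have HB : forall y, closure [set x | v x != 0] y -> `|y| <= B.
  by apply: HM; rewrite ltr_pwDr// ler_norm.
have v0 x : B < `|x| -> v x = 0.
  move=> Bx; apply/eqP; apply/negPn/negP => vx.
  have : `|x| <= B by apply: HB; exact: subset_closure.
  by rewrite leNgt Bx.
have dv0 x i : B < `|x| -> partial i v x = 0.
  move=> Bx; transitivity ('D_(delta_mx ord0 i) (fun _ : 'rV[R]_n => 0 : R) x); last exact: derive_cst.
  apply: near_eq_derive.
  have oB : open (~` [set y : 'rV[R]_n | `|y| <= B]) by exact/closed_openC/closed_norm_le.
  have nB : nbhs (x : 'rV[R]_n) (~` [set y : 'rV[R]_n | `|y| <= B]).
    by apply: open_nbhs_nbhs; split => //; apply/negP; rewrite -ltNge.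
  by apply: filterS nB => y /negP; rewrite -ltNge => /v0.
have cv : continuous v by move=> x; apply: differentiable_continuous; exact: (sv [::]).
have cdv i : continuous (partial i v).
  by move=> x; apply: differentiable_continuous; exact: (sv [:: i]).
have [C C0 vC] := compact_support_bounded cv v0.
have /choice[D HD] : forall i, exists D : R, 0 <= D /\ forall x, `|partial i v x| <= D.
  by move=> i; have [D D0 DP] := compact_support_bounded (cdv i) (fun x => @dv0 x i); exists D.
have D0 i : 0 <= D i by have [] := HD i.
exists B, (C + \sum_i D i); split => //.
- by rewrite addr_ge0// sumr_ge0.
- by move=> x Bx; split; [exact: v0|move=> i; exact: dv0].
- by move=> x; rewrite (le_trans (vC x))// lerDl sumr_ge0.
move=> x i; apply: (le_trans ((HD i).2 x)); rewrite (bigD1 i)//= addrCA lerDl.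
by rewrite addr_ge0// sumr_ge0.
Qed.

(** For [|x| <= 1] in the Euclidean norm the two sides without [K] agree; beyond, they differ by
    [|x|^(2 delta)], bounded on bounded sets. *)
Lemma expR_local_weight n (delta B : R) : 0 < delta <= n%:R ->
  exists2 K : R, 0 <= K & forall x : 'rV[R]_n, x != 0 -> `|x| <= B ->
    expR (- (n%:R - delta) * logr x) <= K * weight n%:R delta (logr x).
Proof.
move=> /andP[d0 dn]; pose T := ln (n%:R * B ^+ 2 + 1) / 2.
exists (expR (2 * delta * `|T|)) => [|x x0 xB]; first exact: expR_ge0.
set N : R := n%:R in dn *; rewrite /weight -expRD ler_expR.
have B0 : 0 <= B := le_trans (normr_ge0 x) xB.
have xT : logr x <= T; first (rewrite /T /N).
  rewrite /logr ler_pM2r// ler_ln ?posrE ?sqn_gt0//.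
    apply: (le_trans (sqn_norm_le x)); rewrite (@le_trans _ _ (n%:R * B ^+ 2))//.
      by rewrite ler_wpM2l// ler_sqr ?nnegrE.
    by rewrite lerDl.
  by rewrite ltr_wpDl// mulr_ge0// sqr_ge0.
have := ler_norm T; have := normr_ge0 T.
have [t0|t0] := leP 0 (logr x).
  by rewrite (ger0_norm t0); nra.
by rewrite (ltr0_norm t0); nra.
Qed.

Lemma continuous_weight (delta a : R) : continuous (weight delta a).
Proof.
apply: continuous_expR_comp => t; apply: cvgB.
  exact: is_derive_continuous (isdZ (- delta) (isd_id t)).
by apply: cvgM; [exact: cvg_cst|exact: norm_continuous].
Qed.

(** With [t = ln |x|], the field [m(t) x] has divergence [n m + m' = F]. It is
    [O(|x|^(1 - n + delta))], too weak to carry flux into the origin: a cutoff there has bounded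
    [t]-derivative, so all the cut-off integrands share one integrable bound and the cutoff
    disappears in the limit. *)
Lemma radial_field_ibp n (delta C0 : R) (m F : R -> R) (v : 'rV[R]_n -> R) : (0 < n)%N ->
  0 < delta <= n%:R -> 0 <= C0 ->
  (forall t, is_derive t (1 : R) m (F t - n%:R * m t)) -> continuous F ->
  (forall t, `|m t| <= C0 * expR (- (n%:R - delta) * t)) ->
  (forall t, `|F t| <= C0 * expR (- (n%:R - delta) * t)) ->
  test_function v ->
  (\int[lebesgue_rV R n]_x (- radial m (sqn x) * dot x (grad v x))%:E
   = \int[lebesgue_rV R n]_x (radial F (sqn x) * v x)%:E)%E.
Proof.
move=> n0 d0n C00 mF cF mC FC tv.
have [S [sS [S0 S1] S01 dS0 [K K0 dSK]]] := @smooth_step R.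
have [B [C [B0 C1 vB vC dvC]]] := test_function_bounds tv.
have [L L0 HL] := @expR_local_weight n delta B d0n.
have cm : continuous m by move=> t; exact: is_derive_continuous (mF t).
have cS := smooth1_continuous sS.
have cdS := smooth1_continuous (smooth1_derive sS).
(* The factor S (t + k) cuts off the singularity at the origin. *)
pose sh k (t : R) : R := 1 * t + k%:R.
have csh k : continuous (sh k) by exact: cts_affine.
pose Sm k (t : R) : R := S (sh k t) * m t.
pose dSm k (t : R) : R := 'D_(1 : R) S (sh k t) * m t + S (sh k t) * (F t - n%:R * m t).
(* The divergence of the cut-off field, that is [n Sm k + dSm k]. *)
pose SF k (t : R) : R := 'D_(1 : R) S (sh k t) * m t + S (sh k t) * F t.
have cS' k : continuous (fun t : R => S (sh k t)) := cts_compT (csh k) cS.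
have cdS' k : continuous (fun t : R => 'D_(1 : R) S (sh k t)) := cts_compT (csh k) cdS.
have cSm k : continuous (Sm k) := ctsMT (cS' k) cm.
have cSF k : continuous (SF k) := ctsDT (ctsMT (cdS' k) cm) (ctsMT (cS' k) cF).
have cnm : continuous (fun t : R => n%:R * m t) := ctsMT (@cts_cstT R n%:R) cm.
have cdm : continuous (fun t : R => F t - n%:R * m t).
  by move=> t; apply: cvgB; [exact: cF|exact: cnm].
have cdSm k : continuous (dSm k) := ctsDT (ctsMT (cdS' k) cm) (ctsMT (cS' k) cdm).
have dSmE k (t : R) : is_derive t (1 : R) (Sm k) (dSm k t).
  have H := isd_comp (isd_affine 1 k%:R t) (smooth1_is_derive (sh k t) sS).
  by apply: (is_derive_eq (isdM H (mF t))); rewrite /dSm; ring.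
have Sm0 k t : t <= - k%:R -> Sm k t = 0 /\ dSm k t = 0.
  move=> tk; have z : sh k t <= 0 by rewrite /sh; lra.
  by rewrite /Sm /dSm S0// dS0; [split; ring|left].
pose Phi k := radial (Sm k).
pose dPhi k (r : R) : R := radial (dSm k) r / (2 * r).
have PhiE k := (rad_C1 (dSmE k) (cdSm k) (Sm0 k)).1.
have cdPhi k := (rad_C1 (dSmE k) (cdSm k) (Sm0 k)).2.
have cPhi k : continuous (Phi k) by move=> r; exact: is_derive_continuous (PhiE k r).
have dv x i : is_derive x (delta_mx ord0 i) v (partial i v x).
  exact/derivableP/diff_derivable/(tv.1 [::]).
have cv : continuous v by move=> x; apply: differentiable_continuous; exact: (tv.1 [::]).
have cdv i : continuous (partial i v).
  by move=> x; apply: differentiable_continuous; exact: (tv.1 [:: i]).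
pose h k (i : 'I_n) (x : 'rV[R]_n) := x ord0 i * v x * Phi k (sqn x).
pose g k (i : 'I_n) (x : 'rV[R]_n) := (v x + x ord0 i * partial i v x) * Phi k (sqn x)
  + x ord0 i * v x * (dPhi k (sqn x) * (2 * x ord0 i)).
have hg k i x : is_derive x (delta_mx ord0 i) (h k i) (g k i x).
  have H1 := isdM_rV (is_derive_coord i x (delta_mx ord0 i)) (dv x i).
  apply: (is_derive_eq (isdM_rV H1 (is_derive_comp_sqn i (PhiE k (sqn x))))).
  by rewrite mxE !eqxx /g /dPhi /Phi /=; ring.
have cg k i : continuous (g k i).
  move=> x; have c1 := continuous_comp_sqn (cPhi k (sqn x)).
  have c2 := continuous_comp_sqn (cdPhi k (sqn x)).
  have c3 := @continuous_coord n i x.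
  apply: ctsD_rV; apply: ctsM_rV => //.
  - by apply: ctsD_rV; [exact: cv|apply: ctsM_rV => //; exact: cdv].
  - by apply: ctsM_rV => //; exact: cv.
  - by apply: ctsM_rV => //; apply: ctsM_rV => //; exact: cst_continuous.
have g0 k i x : B < `|x| -> h k i x = 0 /\ g k i x = 0.
  by move=> /vB[v0 dv0]; rewrite /h /g v0 dv0; split; ring.
have intg k : (\int[lebesgue_rV R n]_x (\sum_i g k i x)%:E = 0)%E.
  under eq_integral do rewrite -sumEFin.
  rewrite integral_sum//=; last first.
    move=> i; have [M M0 gM] := compact_support_bounded (cg k i) (fun x Bx => (g0 k i x Bx).2).
    apply: (bounded_support_integrable (B := B) n0 _ gM) => [|x /(g0 k i)[]//].
    exact: continuous_rV_measurable (cg k i).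
  apply: big1 => i _.
  have [M M0 gM] := compact_support_bounded (cg k i) (fun x Bx => (g0 k i x Bx).2).
  exact: (integral_partial_compact B0 (hg k i) (cg k i) gM (g0 k i)).
pose f k (x : 'rV[R]_n) := radial (Sm k) (sqn x) * dot x (grad v x) + radial (SF k) (sqn x) * v x.
have fE k x : \sum_i g k i x = f k x.
  rewrite /g big_split/= -big_distrl/= big_split/= sumr_const card_ord.
  have -> : \sum_i x ord0 i * partial i v x = dot x (grad v x).
    by apply: eq_bigr => i _; rewrite mxE.
  have -> : \sum_i x ord0 i * v x * (dPhi k (sqn x) * (2 * x ord0 i))
      = v x * (2 * sqn x * dPhi k (sqn x)).
    rewrite /sqn /dot -/(sqn x) mulr_sumr mulr_suml mulr_sumr.
    by apply: eq_bigr => i _; ring.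
  have [->|x0] := eqVneq x 0.
    by rewrite /f /Phi !rad_sqn0 /dPhi rad_sqn0; ring.
  have sx : sqn x != 0 by rewrite sqn_eq0.
  rewrite /f /Phi /dPhi !rad_logr// /dSm /SF /Sm -mulr_natl.
  by field.
pose W (x : 'rV[R]_n) := radial (fun t => (C0 * (n%:R * (B * C) + (K + 1) * C) * L) * weight n%:R delta t) (sqn x).
pose f0 (x : 'rV[R]_n) := radial m (sqn x) * dot x (grad v x).
pose f1 (x : 'rV[R]_n) := radial F (sqn x) * v x.
have mv : measurable_fun setT v := continuous_rV_measurable cv.
have mdot : measurable_fun setT (fun x : 'rV[R]_n => dot x (grad v x)).
  apply: measurable_sum => i; apply: measurable_funM; first exact: measurable_coord.
  by under eq_fun do rewrite mxE; exact: continuous_rV_measurable (cdv i).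
have wpos t : 0 <= weight (n%:R : R) delta t by exact/ltW/weight_gt0.
have C2 : 0 <= C0 * (n%:R * (B * C) + (K + 1) * C) * L.
  by rewrite !mulr_ge0// addr_ge0// !mulr_ge0// addr_ge0.
have WE x : x != 0 -> W x = C0 * (n%:R * (B * C) + (K + 1) * C) * L * weight n%:R delta (logr x).
  by move=> x0; rewrite /W rad_logr.
have W0 x : 0 <= W x.
  have [->|x0] := eqVneq x 0; first by rewrite /W rad_sqn0.
  by rewrite WE// mulr_ge0.
have dotC x : `|x| <= B -> `|dot x (grad v x)| <= n%:R * (B * C).
  move=> xB; apply: (le_trans (ler_norm_sum _ _ _)).
  apply: (@le_trans _ _ (\sum_(i < n) B * C)).
    apply: ler_sum => i _; rewrite mxE normrM ler_pM//.
    exact: le_trans (coord_norm_le x i) xB.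
  by rewrite sumr_const card_ord mulr_natl.
(* One bound for the cut-off integrands and their limits: [n B C] controls [x . grad v] on the
   support, and [K + 1] accounts for the slope of the cutoff. *)
have key (al be : R -> R) x :
    (forall t, `|al t| <= C0 * expR (- (n%:R - delta) * t)) ->
    (forall t, `|be t| <= (K + 1) * (C0 * expR (- (n%:R - delta) * t))) ->
    `|radial al (sqn x) * dot x (grad v x) + radial be (sqn x) * v x| <= W x.
  move=> alC beC; have [->|x0] := eqVneq x 0.
    by rewrite !rad_sqn0 !mul0r addr0 normr0.
  have [xB|Bx] := leP `|x| B; last first.
    have [v0 dv0] := vB x Bx; rewrite v0 mulr0 addr0.
    have -> : dot x (grad v x) = 0 by apply: big1 => i _; rewrite mxE dv0 mulr0.
    by rewrite mulr0 normr0.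
  rewrite WE// !rad_logr//; apply: (le_trans (ler_normD _ _)); rewrite !normrM.
  have h1 := ler_pM (normr_ge0 _) (normr_ge0 _) (alC (logr x)) (dotC x xB).
  have h2 := ler_pM (normr_ge0 _) (normr_ge0 _) (beC (logr x)) (vC x).
  apply: (le_trans (lerD h1 h2)).
  have -> : forall E a b : R, C0 * E * a + (K + 1) * (C0 * E) * b = C0 * (a + (K + 1) * b) * E.
    by move=> *; ring.
  rewrite -[leRHS]mulrA; apply: ler_wpM2l; last exact: HL.
  by rewrite mulr_ge0// addr_ge0// !mulr_ge0// addr_ge0.
have mW : measurable_fun setT W.
  by apply: measurable_radial; apply: ctsMT; [exact: cts_cstT|exact: continuous_weight].
have EC t : 0 <= C0 * expR (- (n%:R - delta) * t) by rewrite mulr_ge0// expR_ge0.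
have SmC k t : `|Sm k t| <= C0 * expR (- (n%:R - delta) * t).
  have /andP[s0 s1] := S01 (sh k t).
  by rewrite normrM (ger0_norm s0) (le_trans _ (mC t))// ler_piMl.
have SFC k t : `|SF k t| <= (K + 1) * (C0 * expR (- (n%:R - delta) * t)).
  have /andP[s0 s1] := S01 (sh k t).
  rewrite (le_trans (ler_normD _ _))// !normrM (ger0_norm s0) mulrDl mul1r.
  apply: lerD; first by apply: ler_pM.
  by rewrite (le_trans _ (FC t))// ler_piMl.
have fW k x : `|f k x| <= W x by exact: key.
have K1 t : C0 * expR (- (n%:R - delta) * t) <= (K + 1) * (C0 * expR (- (n%:R - delta) * t)).
  by rewrite ler_peMl// lerDr.
have rad0 x : radial (fun _ : R => 0) (sqn (x : 'rV[R]_n)) = 0 by rewrite /radial if_same.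
have f0W x : `|f0 x| <= W x.
  rewrite -[f0 x]addr0 -[X in _ + X](mul0r (v x)) -(rad0 x); apply: key => // t.
  by rewrite normr0 mulr_ge0// addr_ge0.
have f1W x : `|f1 x| <= W x.
  rewrite -[f1 x]add0r -[X in X + _](mul0r (dot x (grad v x))) -(rad0 x); apply: key => t.
    by rewrite normr0.
  exact: le_trans (FC t) (K1 t).
have mf0 : measurable_fun setT f0 by apply: measurable_funM => //; exact: measurable_radial.
have mf1 : measurable_fun setT f1 by apply: measurable_funM => //; exact: measurable_radial.
have dominated (w : 'rV[R]_n -> R) : measurable_fun setT w -> (forall x, `|w x| <= W x) ->
    (lebesgue_rV R n).-integrable setT (EFin \o w).
  by move=> mw wW; apply: (weight_integrable d0n mw) => x x0; rewrite (le_trans (wW x))// WE.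
have iW : (lebesgue_rV R n).-integrable setT (EFin \o W).
  by apply: dominated => // x; rewrite ger0_norm.
have if0 := dominated _ mf0 f0W.
have if1 := dominated _ mf1 f1W.
have mf k : measurable_fun setT (f k).
  by apply: measurable_funD; apply: measurable_funM => //; exact: measurable_radial.
(* For fixed [x] the sequence is eventually constant: once [ln |x| + k >= 1] the cutoff is 1 and its
   derivative 0. *)
have cvf x : f k x @[k --> \oo] --> f0 x + f1 x.
  apply: cvg_near_cst; near=> k.
  have [->|x0] := eqVneq x 0; first by rewrite /f /f0 /f1 !rad_sqn0 !mul0r.
  rewrite /f /f0 /f1 !rad_logr// /Sm /SF.
  have z : 1 <= sh k (logr x).
    have : 1 - logr x <= k%:R by near: k; exact: nbhs_infty_ger.
    by rewrite /sh; lra.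
  by rewrite S1// dS0; [ring|right].
have [] := @dominated_convergence _ _ R (lebesgue_rV R n) setT measurableT
  (fun k x => (f k x)%:E) (fun x => (f0 x + f1 x)%:E) (fun x => (W x)%:E).
- by move=> k; apply/measurable_EFinP.
- by apply/measurable_EFinP; exact: measurable_funD.
- by apply: aeW => x _; apply: cvg_EFin; [exact: nearW|exact: cvf].
- exact: iW.
- by apply: aeW => x k _; rewrite lee_fin.
move=> if01 _ cvI.
have I0 : (\int[lebesgue_rV R n]_x (f0 x + f1 x)%:E = 0)%E.
  have E0 : (fun k => \int[lebesgue_rV R n]_x (f k x)%:E)%E = (fun _ => 0%E).
    by apply/funext => k; rewrite -(intg k); apply: eq_integral => x _; rewrite fE.
  have {}cvI : (fun _ : nat => 0%E : \bar R) @ \oo -->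
    (\int[lebesgue_rV R n]_x (f0 x + f1 x)%:E)%E by rewrite -E0; exact: cvI.
  exact: (cvg_unique _ cvI (cvg_cst _)).
have iNf0 : (lebesgue_rV R n).-integrable setT (fun x => (- f0 x)%:E).
  exact: (integrableN if0).
transitivity (\int[lebesgue_rV R n]_x ((f0 x + f1 x)%:E + (- f0 x)%:E))%E; last first.
  by apply: eq_integral => x _; rewrite -EFinD addrAC subrr add0r.
rewrite integralD// I0 add0e; apply: eq_integral => x _.
by rewrite mulNr.
Unshelve. all: by end_near. Qed.

End radial_calculus.

(** * The weak solution *)

Section weak_solution.
Context {R : realType}.

(** The comparison is made between the suprema over simple functions, so it applies to a compact [K]
    without passing through measurability of [K]. *)
Lemma ge0_subset_le_integral d (T : measurableType d) (mu : {measure set T -> \bar R})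
    (K : set T) (f g : T -> \bar R) : (forall x, 0 <= f x)%E -> (forall x, 0 <= g x)%E ->
  (forall x, K x -> (f x <= g x)%E) ->
  (\int[mu]_(x in K) f x <= \int[mu]_x g x)%E.
Proof.
move=> f0 g0 fg; rewrite ge0_integralTE// ge0_integralE//.
apply: ereal_sup_le => _ [h /= hf <-]; exists h => // x /=.
apply: (le_trans (hf x)); rewrite patchE; case: ifPn => [|_]; last exact: g0.
by rewrite inE => /fg.
Qed.

Lemma loc_integrable_radial n (delta C : R) (F : R -> R) : 0 < delta <= n%:R -> 0 <= C ->
  continuous F -> (forall t, `|F t| <= C * expR (- (n%:R - delta) * t)) ->
  loc_integrable (fun x : 'rV[R]_n => radial F (sqn x)).
Proof.
move=> d0n C0 cF FC; have mF := @measurable_radial R n F cF; split => // K.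
move=> /compact_bounded[M [_ HM]]; pose B := `|M| + 1.
have HB : forall x, K x -> `|x| <= B by apply: HM; rewrite ltr_pwDr// ler_norm.
have [L L0 HL] := @expR_local_weight R n delta B d0n.
have [A A0 HA] := @weight_integral R n delta d0n.
pose g (x : 'rV[R]_n) : R := if `|x| <= B then `|radial F (sqn x)| else 0.
apply: (@le_lt_trans _ _ (\int[lebesgue_rV R n]_x (g x)%:E)%E).
  apply: ge0_subset_le_integral => x; rewrite ?lee_fin//.
  - by rewrite /g; case: ifP.
  - by move=> /HB xB; rewrite /g xB.
apply: (@le_lt_trans _ _ (C * L * A)%:E); last exact: ltry.
apply: HA.
- by rewrite mulr_ge0.
- apply/measurable_EFinP; apply: measurable_fun_ifT.
  + apply: measurable_fun_ler; last exact: measurable_cst.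
    exact: continuous_rV_measurable (@norm_continuous _ 'rV[R]_n).
  + exact: (measurableT_comp (@normr_measurable R setT)).
  + exact: measurable_cst.
- by move=> x; rewrite lee_fin /g; case: ifP.
move=> x x0; rewrite lee_fin /g; case: ifPn => [xB|_]; last first.
  by rewrite !mulr_ge0// ltW// weight_gt0.
rewrite rad_logr// (le_trans (FC _))// -mulrA ler_wpM2l//.
exact: HL.
Qed.

Lemma psiK (p z : R) : 1 < p -> `|psi p z| `^ (p - 2) * psi p z = z.
Proof.
move=> p1; have [->|z0] := eqVneq z 0; first by rewrite /psi spow0 mulr0.
have z0' : 0 < `|z| by rewrite normr_gt0.
have -> : `|psi p z| = `|z| `^ (p - 1)^-1.
  by rewrite /psi /spow normrM normr_sg z0 mul1r ger0_norm// powR_ge0.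
rewrite /psi /spow mulrCA -powRrM -powRD; last by rewrite normr_eq0 z0 implybT.
have -> : (p - 1)^-1 * (p - 2) + (p - 1)^-1 = 1 by field; rewrite subr_eq0 gt_eqF.
by rewrite powRr1// -numEsg.
Qed.

Lemma psi_bound (p z Z : R) : 1 < p -> `|z| <= Z -> `|psi p z| <= psi p Z.
Proof.
move=> p1; have le : {homo psi p : x y / x <= y} by apply: spow_le; rewrite invr_gt0 subr_gt0.
rewrite !ler_norml => /andP[/le + /le ->].
by rewrite /psi spowN => ->.
Qed.


End weak_solution.

Theorem theorem1 (R : realType) (n : nat) (p mu s : R)
    (hn : (2 <= n)%N) (hp1 : 1 < p) (hpn : p < n%:R)
    (hmu : mu < ((n%:R - p) / p) `^ p) (hs0 : 0 < s) (hsp : s < p) :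
  exists u : 'rV[R]_n -> R,
    [/\ D1p p u,
        C1_on (~` [set 0]) u,
        forall x, x != 0 -> 0 < u x &
        p_laplace_weak_solution p u (fun x =>
          mu * (u x `^ (p - 1) / enorm x `^ p)
          + u x `^ (sobolev_exp n p - 1)
          + u x `^ (hardy_sobolev_exp n p s - 1) / enorm x `^ s)].
Proof.
set P1 := sobolev_exp n p; set P2 := hardy_sobolev_exp n p s.
pose delta : R := (n%:R - p) / p.
have p0 : 0 < p by exact: lt_trans hp1.
have np0 : 0 < n%:R - p by rewrite subr_gt0.
have delta0 : 0 < delta by rewrite divr_gt0.
(* These three identities make the equation autonomous in [t]: multiplied by [|x|^p / u^(p-1)], the
   last two terms lose their powers of [|x|] and become exponentials of [l]. *)
have dp : delta * p = n%:R - p by rewrite /delta divfK// gt_eqF.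
have dP1 : delta * P1 = n%:R by rewrite /delta /P1 /sobolev_exp; field; rewrite !gt_eqF.
have dP2 : delta * P2 = n%:R - s by rewrite /delta /P2 /hardy_sobolev_exp; field; rewrite !gt_eqF.
have deltan : delta <= n%:R.
  by rewrite ler_pdivrMr// (le_trans (y := n%:R))//; [lra|rewrite ler_peMr// ltW].
have pP1 : p < P1 by rewrite -(ltr_pM2l delta0) dp dP1; lra.
have pP2 : p < P2 by rewrite -(ltr_pM2l delta0) dp dP2; lra.
have [l [zeta [Z [C [al [dl dzeta zetaZ [al0 lC]]]]]]] :=
  homoclinic_orbit hp1 delta0 hmu pP1 pP2.
have lC0 t : l t <= C by apply: (le_trans (lC t)); rewrite gerBl mulr_ge0// ltW.
pose M := psi p Z.
have psiM t : `|psi p (zeta t)| <= M by exact: psi_bound.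
have M0 : 0 <= M := le_trans (normr_ge0 _) (psiM 0).
have Z0 : 0 <= Z := le_trans (normr_ge0 _) (zetaZ 0).
pose w t : R := - delta * t + l t.
have dw (t : R) : is_derive t (1 : R) w (- psi p (zeta t)).
  by apply: (is_derive_eq (isdD (isdZ (- delta) (isd_id t)) (dl t))); ring.
pose U t := expR (w t); pose dU t := - psi p (zeta t) * U t.
have UdU (t : R) : is_derive t (1 : R) U (dU t).
  by apply: (is_derive_eq (isd_expR (dw t))); rewrite /dU mulrC.
have czeta : continuous zeta by move=> t; exact: is_derive_continuous (dzeta t).
have cl : continuous l by move=> t; exact: is_derive_continuous (dl t).
have cdU : continuous dU.
  apply: ctsMT; last by move=> t; exact: is_derive_continuous (UdU t).
  by move=> t; apply: cvgN; exact: cts_comp (czeta t) (@psi_continuous R p hp1 _).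
(* Half of [al] since the approximation starts from decay rate [2 a]; capped by [delta] so that the
   weight is decreasing. *)
pose a := Num.min (al / 2) delta.
have a0 : 0 < a <= delta by rewrite lt_min divr_gt0//= delta0 ge_min lexx orbT.
have aal : 2 * a <= al by rewrite mulrC -ler_pdivlMr// ge_min lexx.
have UC t : U t <= expR C * weight delta (2 * a) t.
  rewrite /weight -expRD ler_expR /w; have := lC t; have := normr_ge0 t; nra.
pose C1 := expR C * (1 + M).
have C10 : 0 <= C1 by rewrite mulr_ge0 ?expR_ge0// addr_ge0.
have UC1 t : `|U t| <= C1 * weight delta (2 * a) t.
  rewrite gtr0_norm ?expR_gt0// (le_trans (UC t))// ler_wpM2r ?(ltW (weight_gt0 _ _ _))//.
  by rewrite ler_peMr ?expR_ge0// lerDl.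
have dUC1 t : `|dU t| <= C1 * weight delta (2 * a) t.
  rewrite normrM normrN gtr0_norm ?expR_gt0// -/(U t).
  apply: (@le_trans _ _ (M * (expR C * weight delta (2 * a) t))).
    by apply: ler_pM; rewrite ?expR_ge0.
  rewrite mulrA ler_wpM2r ?(ltW (weight_gt0 _ _ _))// mulrC ler_wpM2l ?expR_ge0//.
  by rewrite lerDr.
pose u (x : 'rV[R]_n) := radial U (sqn x).
have gradu := @D1p_grad_radial R n p a C1 U dU hp1 hpn a0 C10 UdU cdU UC1 dUC1.
rewrite -/u in gradu.
have D1pu : D1p p u by have [_ [phi [uphi _]]] := gradu; exists phi.
(* [E] is [u^(p-1) / |x|^p], by [delta p = n - p]. Thus [m x] is the field
   [- |grad u|^(p-2) grad u], and [F] is the right-hand side of the equation. *)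
pose E t := expR (- (n%:R - delta) * t + (p - 1) * l t).
pose m t := E t * zeta t.
pose F t := E t * (mu + expR ((P1 - p) * l t) + expR ((P2 - p) * l t)).
have dE (t : R) : is_derive t (1 : R) E
    (E t * (- (n%:R - delta) + (p - 1) * (delta - psi p (zeta t)))).
  apply: (is_derive_eq (isd_expR (isdD (isdZ (- (n%:R - delta)) (isd_id t)) (isdZ (p - 1) (dl t))))).
  by rewrite mulr1.
(* The equation for [zeta] turns into the statement that [m x] has divergence [F]. *)
have dm (t : R) : is_derive t (1 : R) m (F t - n%:R * m t).
  apply: (is_derive_eq (isdM (dE t) (dzeta t))); rewrite /m /F.
  by ring.
have cE : continuous E by move=> t; exact: is_derive_continuous (dE t).
have cexp (b : R) : continuous (fun t : R => expR (b * l t)).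
  by apply: continuous_expR_comp; exact: ctsMT (@cts_cstT R b) cl.
have cF : continuous F.
  exact: ctsMT cE (ctsDT (ctsDT (@cts_cstT R mu) (cexp _)) (cexp _)).
have EC t : E t <= expR ((p - 1) * C) * expR (- (n%:R - delta) * t).
  by rewrite /E -expRD ler_expR addrC lerD2r ler_pM2l ?subr_gt0.
pose C2 := expR ((p - 1) * C) * (Z + `|mu| + expR ((P1 - p) * C) + expR ((P2 - p) * C)).
have e0 := @expR_ge0 R.
have E0 t : 0 <= E t := e0 _.
have C20 : 0 <= C2 by rewrite mulr_ge0// !addr_ge0.
have mC t : `|m t| <= C2 * expR (- (n%:R - delta) * t).
  rewrite normrM gtr0_norm ?expR_gt0// mulrAC; apply: ler_pM => //.
  rewrite (le_trans (zetaZ t))//; have := e0 ((P1 - p) * C); have := e0 ((P2 - p) * C).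
  by have := normr_ge0 mu; lra.
have FC t : `|F t| <= C2 * expR (- (n%:R - delta) * t).
  rewrite normrM gtr0_norm ?expR_gt0// mulrAC; apply: ler_pM => //.
  apply: (le_trans (ler_normD _ _)); apply: lerD; last first.
    by rewrite ger0_norm// ler_expR ler_wpM2l// subr_ge0 ltW.
  apply: (le_trans (ler_normD _ _)); apply: lerD; first by rewrite lerDr.
  by rewrite ger0_norm// ler_expR ler_wpM2l// subr_ge0 ltW.
have d0n : 0 < delta <= n%:R by rewrite delta0.
have u0 : u 0 = 0 by rewrite /u rad_sqn0.
have uE x : x != 0 -> u x = expR (w (logr x)) by move=> x0; rewrite /u rad_logr.
have fE : (fun x : 'rV[R]_n => mu * (u x `^ (p - 1) / enorm x `^ p) + u x `^ (P1 - 1)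
    + u x `^ (P2 - 1) / enorm x `^ s) = (fun x => radial F (sqn x)).
  (* At the origin both sides are 0: [u 0 = 0], and 0 raised to a nonzero power is 0, whatever the
     divisors there. *)
  apply/funext => x; have [->|x0] := eqVneq x 0.
    have p1 : p - 1 != 0 by rewrite subr_eq0 gt_eqF.
    have p2 : P1 - 1 != 0 by rewrite subr_eq0 gt_eqF// (lt_trans hp1).
    have p3 : P2 - 1 != 0 by rewrite subr_eq0 gt_eqF// (lt_trans hp1).
    by rewrite u0 rad_sqn0 !powR0// !mul0r mulr0 !addr0.
  rewrite uE// enorm_logr// rad_logr// -!expRM -!expRN -!expRD /F.
  have -> : forall e a b : R, e * (mu + a + b) = mu * e + e * a + e * b by move=> *; ring.
  rewrite /E -!expRD; congr (mu * expR _ + expR _ + expR _); rewrite /w.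
  - by move: dp; clear; nra.
  - by move: dP1; clear; nra.
  - by move: dP2; clear; nra.
exists u; split => //.
- exact: C1_on_radial UdU cdU.
- by move=> x x0; rewrite uE// expR_gt0.
rewrite fE; split => //; first exact: loc_integrable_radial cF FC.
exists (fun x => radial (fun t => dU t * expR (- (2 * t))) (sqn x) *: x); split => // v tv.
have n0 : (0 < n)%N by exact: leq_trans hn.
rewrite -(radial_field_ibp n0 d0n C20 dm cF mC FC tv).
apply: eq_integral => x _; congr EFin; rewrite dotZl mulrA; congr (_ * _).
have [->|x0] := eqVneq x 0; first by rewrite !rad_sqn0 mulr0 oppr0.
rewrite !rad_logr// enormZ enorm_logr// normrM normrM normrN.
set t := logr x; rewrite /dU /m -[in RHS](psiK (zeta t) hp1).
rewrite !powRM// ?mulr_ge0//.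
rewrite (gtr0_norm (expR_gt0 (w t))) (gtr0_norm (expR_gt0 (- (2 * t)))) -!expRM.
(* [|grad u|] is [|psi zeta| e^w e^(-2t) e^t]; its power [p - 2], times [U e^(-2t)], reproduces [E]
   once [delta p = n - p] is used in the exponent. *)
have -> : E t = expR (w t * (p - 2)) * expR (- (2 * t) * (p - 2)) * expR (t * (p - 2))
    * (U t * expR (- (2 * t))).
  by rewrite /U -!expRD; congr expR; rewrite /w; move: dp; clear; nra.
by ring.
Qed.
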